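(* Let $P$ be a polynomial on $\mathbb{R}^d$ and $1\le p\le\infty$. Suppose $P(\partial)^n f\in L^p(\mathbb{R}^d)$ for all $n\in\mathbb{N}_0$. Assume furthermore that either $\mathcal{F}f$ has compact support, or that the set $\{\lambda\in\mathbb{R}^d:|P(i\lambda)|\le R\}$ is compact for all $R\ge 0$. Then, in the extended positive real numbers, $$\lim_{n\to\infty}\|P(\partial)^n f\|_p^{1/n}=R(P,\mathcal{F}f).$$
   Context: $\mathbb{N}_0=\{0,1,2,\ldots\}$; the extended positive real numbers are $[0,\infty]$. Polynomials have complex coefficients. For a polynomial $P$ on $\mathbb{R}^d$, $P(\partial)$ is the corresponding constant coefficient differential operator, so that $P(\partial)e^{i\lambda\cdot x}=P(i\lambda)e^{i\lambda\cdot x}$; it acts on tempered distributions by $\langle P(\partial)T,\phi\rangle=\langle T,P(-\partial)\phi\rangle$ for $\phi$ in the Schwartz space $\mathcal{S}(\mathbb{R}^d)$, and $L^p(\mathbb{R}^d)\subset\mathcal{S}'(\mathbb{R}^d)$. Thus the hypothesis with $n=0$ says $f\in L^p(\mathbb{R}^d)$, and derivatives are in the sense of distributions. The Fourier transform is $\mathcal{F}f(\lambda)=(2\pi)^{-d/2}\int_{\mathbb{R}^d}f(x)e^{-i\lambda\cdot x}\,dx$ on $L^1(\mathbb{R}^d)$, extended to $\mathcal{S}'(\mathbb{R}^d)$ by $\langle\mathcal{F}T,\phi\rangle=\langle T,\mathcal{F}\phi\rangle$. For a distribution $T$ on $\mathbb{R}^d$, $R(P,T)=\sup\{|P(i\lambda)|:\lambda\in\operatorname{supp}T\}\in[0,\infty]$,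 with $R(P,T)=0$ if $T=0$. *)

(* Defs.v *)
From HB Require Import structures.
From mathcomp Require Import all_boot all_order all_algebra.
From mathcomp Require Import complex.
From mathcomp Require Import -(notations) mpoly.
From mathcomp Require Import all_classical all_reals all_analysis.
Import Order.TTheory GRing.Theory Num.Theory.
Import numFieldNormedType.Exports.

Set Implicit Arguments.
Unset Strict Implicit.
Unset Printing Implicit Defensive.

Local Open Scope classical_set_scope.
Local Open Scope ring_scope.
Local Open Scope complex_scope.

Section measurable_rV.
Context {R : realType} (d : nat).

Let coors (i : 'I_d) (x : 'rV[R]_d) : R := x 0 i.

Let rV_set0 : g_sigma_preimage coors set0.
Proof. exact: sigma_algebra0. Qed.

Let rV_setC A : g_sigma_preimage coors A -> g_sigma_preimage coors (~` A).
Proof. exact: sigma_algebraC. Qed.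

Let rV_bigcup (F : _^nat) : (forall i, g_sigma_preimage coors (F i)) ->
  g_sigma_preimage coors (\bigcup_i (F i)).
Proof. exact: sigma_algebra_bigcup. Qed.

HB.instance Definition _ := @isMeasurable.Build default_measure_display
  'rV[R]_d (g_sigma_preimage coors) rV_set0 rV_setC rV_bigcup.

End measurable_rV.

Section measurable_rV_lemmas.
Context {R : realType}.

Lemma measurable_rV_coord d (i : 'I_d) :
  measurable_fun [set: 'rV[R]_d] (fun x : 'rV[R]_d => x 0 i).
Proof.
move=> _ Y mY; rewrite setTI; apply: sub_sigma_algebra => /=.
rewrite -bigcup_seq/=; exists i => /=; first by rewrite mem_index_enum.
by exists Y => //; rewrite setTI.
Qed.

Lemma measurable_fun_rV d1 (T : measurableType d1) d (f : T -> 'rV[R]_d) :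
  (forall i, measurable_fun [set: T] (fun x => f x 0 i)) ->
  measurable_fun [set: T] f.
Proof.
move=> mf _ Y mY; rewrite setTI.
suff : measurable `<=` [set Y | measurable (f @^-1` Y)] by apply.
apply: smallest_sub.
  split=> /=.
  - by rewrite preimage_set0.
  - by move=> A mA; rewrite setTD preimage_setC; exact: measurableC.
  - by move=> F mF; rewrite preimage_bigcup; exact: bigcupT_measurable.
move=> A; rewrite -bigcup_seq => -[i _ [B mB <-]] /=.
by rewrite setTI -[X in measurable X]setTI; exact: mf.
Qed.

End measurable_rV_lemmas.

Section lebesgue_rV.
Context {R : realType}.

Definition rV_cons n (xv : measurableTypeR R * 'rV[R]_n) : 'rV[R]_n.+1 :=
  row_mx (xv.1%:M : 'rV[R]_1) xv.2.

Definition rV_uncons n (v : 'rV[R]_n.+1) : measurableTypeR R * 'rV[R]_n :=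
  (v 0 0, rsubmx (v : 'rV[R]_(1 + n))).

Lemma rV_consK n : cancel (@rV_cons n) (@rV_uncons n).
Proof.
move=> [x v]; rewrite /rV_uncons /rV_cons /= row_mxKr; congr pair.
have -> : (0 : 'I_n.+1) = lshift n (0 : 'I_1) by apply: val_inj.
by rewrite (@row_mxEl _ 1 1 n) mxE eqxx.
Qed.

Lemma rV_cons0 n (xv : measurableTypeR R * 'rV[R]_n) : rV_cons xv 0 0 = xv.1.
Proof. by rewrite -[in RHS](rV_consK xv). Qed.

Lemma rV_consS n (xv : measurableTypeR R * 'rV[R]_n) i : rV_cons xv 0 (lift ord0 i) = xv.2 0 i.
Proof.
rewrite /rV_cons; have -> : lift ord0 i = rshift 1 i by apply: val_inj.
by rewrite (@row_mxEr _ 1 1 n).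
Qed.

Lemma rV_unconsK n : cancel (@rV_uncons n) (@rV_cons n).
Proof.
move=> v; apply/rowP => i; case: (unliftP ord0 i) => [j ->|->].
  by rewrite rV_consS mxE; congr (v _ _); apply: val_inj.
by rewrite rV_cons0.
Qed.

Lemma measurable_rV_cons n : measurable_fun [set: measurableTypeR R * 'rV[R]_n] (@rV_cons n).
Proof.
apply: measurable_fun_rV => i; case: (unliftP ord0 i) => [j ->|->].
  under eq_fun do rewrite rV_consS.
  exact: (measurableT_comp (measurable_rV_coord j) measurable_snd).
rewrite (_ : (fun x => _) = fst) //.
by apply/funext => xv; rewrite rV_cons0.
Qed.

Lemma measurable_rV_uncons n :
  measurable_fun [set: 'rV[R]_n.+1] (@rV_uncons n).
Proof.
apply: measurable_fun_pair; first exact: measurable_rV_coord.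
apply: measurable_fun_rV => i; under eq_fun do rewrite mxE.
exact: measurable_rV_coord.
Qed.


Section step.
Context (n : nat) (mu : {sigma_finite_measure set 'rV[R]_n -> \bar R}).

Definition lebesgue_rV_step : set 'rV[R]_n.+1 -> \bar R :=
  pushforward (@lebesgue_measure R \x mu)%E (@rV_cons n).

Let lebesgue_rV_step0 : lebesgue_rV_step set0 = 0.
Proof. by rewrite /lebesgue_rV_step /pushforward preimage_set0 measure0. Qed.

Let lebesgue_rV_step_ge0 A : (0 <= lebesgue_rV_step A)%E.
Proof. by rewrite /lebesgue_rV_step /pushforward measure_ge0. Qed.

Let lebesgue_rV_step_sigma_additive : semi_sigma_additive lebesgue_rV_step.
Proof.
have mpre A : measurable A -> measurable (@rV_cons n @^-1` A).
  by move=> mA; rewrite -[X in measurable X]setTI; exact: measurable_rV_cons.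
move=> F mF tF mUF; rewrite /lebesgue_rV_step /pushforward preimage_bigcup.
apply: measure_semi_sigma_additive.
- by move=> k; exact: mpre.
- apply/trivIsetP => /= i j _ _ ij; rewrite -preimage_setI.
  by move/trivIsetP : tF => /(_ _ _ _ _ ij) ->//; rewrite preimage_set0.
- by rewrite -preimage_bigcup; exact: mpre.
Qed.

HB.instance Definition _ := isMeasure.Build _ _ _ lebesgue_rV_step
  lebesgue_rV_step0 lebesgue_rV_step_ge0 lebesgue_rV_step_sigma_additive.

Let lebesgue_rV_step_sigma_finite : sigma_finite setT lebesgue_rV_step.
Proof.
have /sigma_finiteP[F [FT Fnd Foo]] := sigma_finiteT (@lebesgue_measure R).
have /sigma_finiteP[G [GT Gnd Goo]] := sigma_finiteT mu.
exists (fun k => @rV_uncons n @^-1` (F k `*` G k)).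
  rewrite -preimage_bigcup (_ : \bigcup_k _ = setT) ?preimage_setT//.
  rewrite -subTset => -[x v] _.
  have [k _ Fkx] : (\bigcup_k F k) x by rewrite -FT.
  have [l _ Glv] : (\bigcup_k G k) v by rewrite -GT.
  exists (maxn k l) => //; split => /=.
  - by move: x Fkx; exact/subsetPset/Fnd/leq_maxl.
  - by move: v Glv; exact/subsetPset/Gnd/leq_maxr.
move=> k; have [mF Fk] := Foo k; have [mG Gk] := Goo k; split.
  rewrite -[X in measurable X]setTI; apply: measurable_rV_uncons => //.
  exact: measurableX.
rewrite /lebesgue_rV_step /pushforward.
rewrite (_ : _ @^-1` _ = F k `*` G k).
  by rewrite product_measure1E// lte_mul_pinfty// ge0_fin_numE.
by apply/funext => x; rewrite /preimage /= -[in RHS](rV_consK x).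
Qed.

HB.instance Definition _ := Measure_isSigmaFinite.Build _ _ _ lebesgue_rV_step
  lebesgue_rV_step_sigma_finite.

End step.

Fixpoint lebesgue_rV (d : nat) : {sigma_finite_measure set 'rV[R]_d -> \bar R} :=
  match d with
  | 0 => @dirac _ 'rV[R]_0 0 R
  | n.+1 => lebesgue_rV_step (lebesgue_rV n)
  end.

Lemma lebesgue_rV_box d (a b : 'rV[R]_d) : (forall i, a 0 i <= b 0 i) ->
  lebesgue_rV d [set x | forall i, x 0 i \in `]a 0 i, b 0 i]] =
  (\prod_i (b 0 i - a 0 i))%:E.
Proof.
elim: d a b => [|n IH] a b ab /=.
  rewrite big_ord0 diracE mem_set//= => -[].
  by [].
rewrite /lebesgue_rV_step /pushforward.
rewrite (_ : _ @^-1` _ = `]a 0 ord0, b 0 ord0]%classic `*`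
   [set x : 'rV[R]_n | forall i, x 0 i \in
    `](\row_j a 0 (lift ord0 j)) 0 i, (\row_j b 0 (lift ord0 j)) 0 i]]).
  have mbox : measurable [set x : 'rV[R]_n | forall i, x 0 i \in
      `](\row_j a 0 (lift ord0 j)) 0 i, (\row_j b 0 (lift ord0 j)) 0 i]].
    rewrite (_ : mkset _ = \bigcap_(i in [set: 'I_n])
       ((fun x : 'rV[R]_n => x 0 i) @^-1`
       `](\row_j a 0 (lift ord0 j)) 0 i, (\row_j b 0 (lift ord0 j)) 0 i]%classic)).
      apply: fin_bigcap_measurable => // i _.
      rewrite -[X in measurable X]setTI.
      by apply: measurable_rV_coord => //; exact: measurable_itv.
    apply/seteqP; split=> x /= h i; [move=> _|]; first exact: h.
    exact: h.
  rewrite product_measure1E// IH; last by move=> i; rewrite !mxE.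
  rewrite big_ord_recl EFinM; congr (_ * _)%E; last first.
    by congr EFin; apply: eq_bigr => i _; rewrite !mxE.
  apply: (etrans (lebesgue_measure_itv _)); rewrite /= lte_fin.
  have [|] := ltP (a 0 ord0) (b 0 ord0); first by rewrite EFinB.
  by move=> ba; rewrite (@le_anti _ _ (a 0 ord0) (b 0 ord0)) ?subrr// ab ba.
apply/seteqP; split=> [[x v]|[x v] []] /=.
- move=> h; split; first by have := h ord0; rewrite rV_cons0.
  by move=> i; have := h (lift ord0 i); rewrite rV_consS !mxE.
- move=> hx hv i; case: (unliftP ord0 i) => [j ->|->].
    by have := hv j; rewrite rV_consS !mxE.
  by rewrite rV_cons0.
Qed.

End lebesgue_rV.

Section schwartz.
Context {R : realType} {d : nat}.
Local Notation C := R[i].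
Local Notation Re := (@complex.Re R).
Local Notation Im := (@complex.Im R).
Local Notation Rd := 'rV[R]_d.
Local Notation Cpoly := (mpoly d C).
Implicit Types (f g phi psi : Rd -> C) (P : Cpoly) (a b : multinom d).

(* The modulus as a real number: `|z| itself lives in C. *)
Definition cabs (z : C) : R := ComplexField.Normc.normc z.

Definition cexpi (t : R) : C := cos t +i* sin t.

(* C carries no normed-module structure over R, so analysis of complex-valued
   functions is done on real and imaginary parts. *)
Definition cderivable f (x v : Rd) : Prop :=
  derivable (Re \o f : Rd -> R) x v /\
  derivable (Im \o f : Rd -> R) x v.

Definition cderive f (v x : Rd) : C :=
  'D_v (Re \o f : Rd -> R) x +i* 'D_v (Im \o f : Rd -> R) x.

Definition ccontinuous f : Prop :=
  continuous (Re \o f : Rd -> R) /\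
  continuous (Im \o f : Rd -> R).

Definition cmeasurable f : Prop :=
  measurable_fun setT (Re \o f : Rd -> R) /\
  measurable_fun setT (Im \o f : Rd -> R).

Definition cintegral f : C :=
  (\int[lebesgue_rV d]_x Re (f x)) +i*
  (\int[lebesgue_rV d]_x Im (f x)).

Definition partial (j : 'I_d) f : Rd -> C := cderive f (delta_mx 0 j).

Definition partials (s : seq 'I_d) f : Rd -> C := foldr partial f s.

Definition mpartial (b : multinom d) f : Rd -> C :=
  partials (flatten [seq nseq (b j) j | j <- enum 'I_d]) f.

Definition smooth f : Prop :=
  forall s : seq 'I_d, ccontinuous (partials s f) /\
    forall (j : 'I_d) (x : Rd), cderivable (partials s f) x (delta_mx 0 j).

Definition monomial (a : multinom d) (x : Rd) : R :=
  \prod_(j < d) x 0 j ^+ a j.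

Definition schwartz_seminorm (a b : multinom d) f : \bar R :=
  ereal_sup [set (`|monomial a x| * cabs (mpartial b f x))%:E | x in [set: Rd]].

Definition schwartz f : Prop :=
  smooth f /\ forall a b, (schwartz_seminorm a b f < +oo)%E.

(* Functionals are total on Rd -> C, but only their values on Schwartz
   functions are meaningful; see dist_eq. *)
Definition functional : Type := (Rd -> C) -> C.
Implicit Types T U : functional.

Definition dist_eq T U : Prop := forall phi, schwartz phi -> T phi = U phi.

(* Linear, and continuous for the topology of the Schwartz seminorms. *)
Definition tempered T : Prop :=
  (forall (c : C) phi psi, schwartz phi -> schwartz psi ->
     T (fun x => c * phi x + psi x) = c * T phi + T psi) /\
  (forall phi, schwartz phi -> forall e : R, 0 < e ->
     exists (N : nat) (r : R), 0 < r /\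
       forall psi, schwartz psi ->
         (forall a b, (mdeg a <= N)%N -> (mdeg b <= N)%N ->
            (schwartz_seminorm a b (fun x => psi x - phi x)%R < r%:E)%E) ->
         cabs (T psi - T phi) < e).

Definition diffop P f : Rd -> C :=
  fun x => \sum_(m <- msupp P) mcoeff m P * mpartial m f x.

(* P(X) |-> P(-X) *)
Definition mpoly_reflect P : Cpoly :=
  comp_mpoly [tuple - mpolyX C (mnm1 j) | j < d] P.

Definition diffop_dist P T : functional :=
  fun phi => T (diffop (mpoly_reflect P) phi).

Definition symbol P (lam : Rd) : C :=
  meval (fun j => 'i * (lam 0 j)%:C) P.

Definition dot (x y : Rd) : R := \sum_(j < d) x 0 j * y 0 j.

Definition fourier f : Rd -> C := fun lam =>
  (((2 * pi) `^ (- (d%:R / 2)))%:C : C) *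
  cintegral (fun x => f x * cexpi (- dot lam x)).

Definition fourier_dist T : functional := fun phi => T (fourier phi).

Definition test_function (U : set Rd) phi : Prop :=
  [/\ smooth phi, compact (closure [set x | phi x != 0]) &
      closure [set x | phi x != 0] `<=` U].

Definition vanishes_on T (U : set Rd) : Prop :=
  forall phi, test_function U phi -> T phi = 0.

Definition dist_support T : set Rd :=
  ~` (\bigcup_(U in [set U : set Rd | open U /\ vanishes_on T U]) U).

(* 0 is adjoined because the supremum is taken in [0, +oo]: this only matters
   when the support is empty. *)
Definition spectral_sup P T : \bar R :=
  ereal_sup (0%E |` [set (cabs (symbol P lam))%:E | lam in dist_support T]).

Definition Lp_norm (p : \bar R) f : \bar R :=
  Lnorm (lebesgue_rV d) p (fun x => (cabs (f x))%:E).

Definition in_Lp (p : \bar R) f : Prop :=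
  cmeasurable f /\ (Lp_norm p f < +oo)%E.

Definition dist_of_fun f : functional :=
  fun phi => cintegral (fun x => f x * phi x).

Definition Lp_representative (p : \bar R) T f : Prop :=
  in_Lp p f /\ dist_eq T (dist_of_fun f).

End schwartz.

Arguments functional R d : clear implicits.

(* Main.v *)
From HB Require Import structures.
Require Import Defs.
From mathcomp Require Import all_boot all_order all_algebra.
From mathcomp Require Import complex.
From mathcomp Require Import -(notations) mpoly.
From mathcomp Require Import all_classical all_reals all_analysis.
From mathcomp Require Import measurable_realfun ess_sup_inf.
From mathcomp Require Import ring lra zify.
Import Order.TTheory GRing.Theory Num.Theory.
Import numFieldNormedType.Exports.

(* The Fourier transform [F f] only enters through [T psi = int g_0 (F psi)] for test
   functions [psi], and [int g_n (F psi) = T (P^n psi)].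

   If [|P(i lam)| > s] at a point of the support, choose a test function [phi] supported in
   [|P| > s] with [T phi <> 0]. Then [T phi = int g_n F(phi P^-n)], and the derivatives of
   [phi P^-n] of order at most [K] are [O(n^K s^-n)], so [|g_n|_p >= C n^-K s^n].

   If the support is compact and [|P| < A] on it, let [chi] be a cutoff equal to 1 near the
   support and supported in [|P| < A]. Then [T (P^n psi) = T (chi P^n psi)] says that [g_n] is,
   up to a constant, the convolution of [g_0] with a Fourier transform of [chi P^n], which is
   [O(n^K A^n)] times an integrable function; Young's inequality gives [|g_n|_p <= C n^K A^n].
   The identification of [g_n] uses that [h = 0] a.e. if [int h (F psi) = 0] for all [psi]: taking
   [psi(l) = b(e l) e^{i y.l}] and letting [e -> 0] gives [int h q = 0] for continuous [q].

   If the support is not compact, then the sublevel sets of [|P|] are, the supremum is infinite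
   and the lower bound suffices. *)

Set Implicit Arguments.
Unset Strict Implicit.
Unset Printing Implicit Defensive.

Local Open Scope classical_set_scope.
Local Open Scope ring_scope.

(** * Lebesgue measure under affine maps *)

(** Everything runs through the product weight [wgt]. Fourier transforms of test functions are
    bounded by M / wgt, and L^p is contained in L^1(dx / wgt) for every p; these two facts stand in
    for Hoelder's inequality and for Schwartz estimates. The decay comes from one fixed differential
    operator [wop], of order two in each variable, so that boundedly many derivatives fall on a
    power of P or of 1 / P. This is why the loss is polynomial in n, and why the norm bounds concern
    g (n + N): N factors are reserved for the derivatives to consume. Constants are never optimised,
    since n-th roots erase them.

    The growth estimate needs powers of a globally smooth and bounded function. Hence a second
    cutoff th, equal to 1 near the support of the given test function: u = th / P or u = th P then
    replaces 1 / P or P.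

    In the uniqueness statement h is only known to be integrable against 1 / wgt. The continuous q
    are therefore required to decay like wgt^-2: Peetre's inequality uses up one power, and the
    other makes the double integral converge. *)

Section affine1.
Context {R : realType}.

(** By uniqueness of Lebesgue measure: |a| times the pushforward agrees with it on half-open
    intervals. *)
Lemma lebesgue_measure_affine (a b : R) (A : set (measurableTypeR R)) :
  a != 0 -> measurable A ->
  (lebesgue_measure ((fun x => a * x + b)%R @^-1` A) = (`|a|^-1)%:E * lebesgue_measure A)%E.
Proof.
move=> a0 mA.
have mphi : measurable_fun setT (fun x : measurableTypeR R => a * x + b : measurableTypeR R).
  by apply: measurable_funD => //; apply: measurable_funM.
pose mp : {measure set (measurableTypeR R) -> \bar R} :=
  measure_function_pushforward__canonical__measure_function_Measure lebesgue_measure mphi.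
pose m : {measure set (measurableTypeR R) -> \bar R} := mscale (NngNum (normr_ge0 a)) mp.
have mE : forall X : set (measurableTypeR R), measurable X -> (lebesgue_measure X = m X)%E.
  apply: lebesgue_measure_unique => X [[x y] /= xy <-].
  rewrite /m /= /mscale /= /pushforward /=.
  have [a_gt0|a_lt0|a_eq0] := ltgtP 0 a; last by rewrite -a_eq0 eqxx in a0.
    have -> : (fun x => a * x + b) @^-1` `]x, y] = `](x - b) / a, (y - b) / a]%classic.
      apply/seteqP; split => z /=; rewrite !in_itv/= ltr_pdivrMr// ler_pdivlMr//.
        by move=> /andP[h1 h2]; apply/andP; split; lra.
      by move=> /andP[h1 h2]; apply/andP; split; lra.
    rewrite !lebesgue_measure_itv /= !lte_fin.
    rewrite ltr_pM2r ?invr_gt0// ltrD2r gtr0_norm//.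
    case: ifPn => _; last by rewrite mule0.
    rewrite -!EFinB -EFinM; congr EFin.
    by field.
  (* A negative slope exchanges the open and the closed end; the length does not see it. *)
  have -> : (fun x => a * x + b) @^-1` `]x, y] = `[(y - b) / a, (x - b) / a[%classic.
    apply/seteqP; split => z /=; rewrite !in_itv/= ltr_ndivlMr// ler_ndivrMr//.
      by move=> /andP[h1 h2]; apply/andP; split; lra.
    by move=> /andP[h1 h2]; apply/andP; split; lra.
  rewrite !lebesgue_measure_itv /= !lte_fin.
  rewrite ltr_nM2r ?invr_lt0// ltrD2r ltr0_norm//.
  case: ifPn => _; last by rewrite mule0.
  rewrite -!EFinB -EFinM; congr EFin.
  by field.
rewrite (mE A)// /m /= /mscale /= /pushforward /= muleA -EFinM mulVf ?normr_eq0// mul1e.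
by [].
Qed.

Lemma ge0_integral_affine1 (a b : R) (F : measurableTypeR R -> \bar R) :
  a != 0 -> measurable_fun setT F -> (forall x, 0 <= F x)%E ->
  (\int[@lebesgue_measure R]_x F (a * x + b)%R = (`|a|^-1)%:E * \int[@lebesgue_measure R]_x F x)%E.
Proof.
move=> a0 mF F0.
have mphi : measurable_fun setT (fun x : measurableTypeR R => a * x + b : measurableTypeR R).
  by apply: measurable_funD => //; apply: measurable_funM.
have := @ge0_integral_pushforward _ _ _ _ R _ mphi lebesgue_measure setT F measurableT mF.
rewrite preimage_setT => /(_ _)/= <-; last by move=> x _; exact: F0.
rewrite -(@ge0_integral_mscale _ _ _ lebesgue_measure _ measurableT (NngNum (ltac:(by rewrite invr_ge0) : 0 <= `|a|^-1)) F)//.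
apply: eq_measure_integral => A mA _ /=.
exact: lebesgue_measure_affine.
Qed.

End affine1.

Section lebesgue_rV_theory.
Context {R : realType}.

Lemma ge0_integral_rVS n (F : 'rV[R]_n.+1 -> \bar R) :
  measurable_fun setT F -> (forall x, 0 <= F x)%E ->
  (\int[lebesgue_rV n.+1]_x F x =
   \int[@lebesgue_measure R]_x \int[lebesgue_rV n]_v F (rV_cons (x, v)))%E.
Proof.
move=> mF F0.
have := @ge0_integral_pushforward _ _ _ _ R _ (@measurable_rV_cons R n)
  (@lebesgue_measure R \x lebesgue_rV n)%E setT F measurableT mF.
rewrite preimage_setT => /(_ _)/=; rewrite -/(lebesgue_rV_step (lebesgue_rV n)) => ->; last by move=> x _; exact: F0.
rewrite -(fubini_tonelli1 (F \o (@rV_cons R n)))//=.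
by apply: measurableT_comp => //; exact: measurable_rV_cons.
Qed.

Lemma measurable_affine_rV d (a : R) (b : 'rV[R]_d) : measurable_fun setT (fun x : 'rV[R]_d => a *: x + b).
Proof.
apply: measurable_fun_rV => i; under eq_fun do rewrite !mxE.
by apply: measurable_funD => //; apply: measurable_funM => //; exact: measurable_rV_coord.
Qed.

Lemma ge0_integral_affine d (a : R) (b : 'rV[R]_d) (F : 'rV[R]_d -> \bar R) :
  a != 0 -> measurable_fun setT F -> (forall x, 0 <= F x)%E ->
  (\int[lebesgue_rV d]_x F (a *: x + b)%R = (`|a|^- d)%:E * \int[lebesgue_rV d]_x F x)%E.
Proof.
move=> a0; elim: d b F => [|d IH] b F mF F0.
  rewrite expr0 invr1 mul1e; apply: eq_integral => x _.
  by congr F; apply/rowP => -[].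
rewrite !ge0_integral_rVS//; last first.
  by apply: (measurableT_comp mF); exact: measurable_affine_rV.
pose b' := rsubmx (b : 'rV[R]_(1 + d)).
have E x v : a *: rV_cons (x, v) + b = rV_cons (a * x + b 0 0, a *: v + b').
  apply/rowP => i; rewrite [LHS]mxE [X in X + _ = _]mxE.
  case: (unliftP ord0 i) => [j ->|->].
    rewrite !rV_consS !mxE /=; congr (_ + b _ _); exact: val_inj.
  by rewrite !rV_cons0.
under eq_integral do under eq_integral do rewrite E.
have mFc : measurable_fun setT (F \o @rV_cons R d).
  by apply: measurableT_comp => //; exact: measurable_rV_cons.
under eq_integral => x _.
  rewrite (IH b' (fun v => F (rV_cons (a * x + b 0 0, v))))//; last first.
    apply: (measurableT_comp mFc); exact: measurable_pair1.
  over.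
have mG : measurable_fun setT (fun x => \int[lebesgue_rV d]_v F (rV_cons (x, v)))%E.
  exact: (measurable_fun_fubini_tonelli_F (F \o @rV_cons R d) mFc (fun x => F0 _)).
have G0 x : (0 <= \int[lebesgue_rV d]_v F (rV_cons (x, v)))%E by apply: integral_ge0.
have c0 : (0 <= (`|a| ^- d)%:E)%E by rewrite lee_fin invr_ge0 exprn_ge0.
move: mG G0; set G := (fun x => \int[lebesgue_rV d]_v F (rV_cons (x, v)))%E => mG G0.
have {}G0 : forall x, (0 <= G x)%E by [].
transitivity (\int[@lebesgue_measure R]_x ((`|a| ^- d)%:E * G (a * x + b 0 0)%R))%E.
  by [].
rewrite -/G; clearbody G.
pose H y := ((`|a| ^- d)%:E * G y)%E.
have mH : measurable_fun setT H by apply: emeasurable_funM.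
have H0 y : (0 <= H y)%E by rewrite /H mule_ge0.
rewrite (_ : (\int[_]_x _)%E = \int[@lebesgue_measure R]_x H (a * x + b 0 0)%R)%E//.
rewrite (ge0_integral_affine1 _ a0 mH H0) /H.
rewrite (ge0_integralZl _ measurableT mG _ c0)//.
by rewrite muleA -EFinM exprS invfM.
Qed.

End lebesgue_rV_theory.

(** * The weight and Borel measurability *)

Section topology_rV.
Context {R : realType}.

Lemma nbhs_rVP d (x : 'rV[R]_d) (A : set 'rV[R]_d) :
  nbhs x A <-> exists2 e : R, 0 < e & forall y : 'rV[R]_d, (forall i, `|y 0 i - x 0 i| < e) -> A y.
Proof.
split.
  move=> /nbhs_ballP[e /= e0 eA]; exists e => // y yx; apply: eA; split => // i j.
  by rewrite (ord1 i) /ball/= distrC yx.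
move=> [e e0 eA]; apply/nbhs_ballP; exists e => //= y [_ xy]; apply: eA => i.
by rewrite distrC; exact: xy.
Qed.

Lemma measurable_open_box d (a : 'rV[R]_d) (e : R) :
  measurable [set x : 'rV[R]_d | forall i, `|x 0 i - a 0 i| < e].
Proof.
rewrite (_ : mkset _ = \bigcap_(i in [set: 'I_d])
   ((fun x : 'rV[R]_d => x 0 i) @^-1` ball (a 0 i) e)).
  apply: fin_bigcap_measurable => // i _; rewrite -[X in measurable X]setTI.
  by apply: measurable_rV_coord => //; exact: measurable_ball.
apply/seteqP; split => x /= h i; [move=> _|]; first by rewrite /ball/= distrC; exact: h.
by have := h i I; rewrite /= /ball/= distrC.
Qed.

(** The sigma-algebra is generated by the coordinates, so Borel sets need an argument: an open set
    is the union of the countably many boxes with rational centre and radius 1 / (k + 1) that it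
    contains. *)
Lemma open_measurable_rV d (U : set 'rV[R]_d) : open U -> measurable U.
Proof.
move=> oU.
pose B (qk : 'rV[rat]_d * nat) := [set x : 'rV[R]_d |
   forall i, `|x 0 i - (map_mx ratr qk.1 : 'rV[R]_d) 0 i| < qk.2.+1%:R^-1].
rewrite (_ : U = \bigcup_(qk in [set qk | B qk `<=` U]) B qk).
  rewrite bigcup_mkcond; apply: countable_bigcupT_measurable => // qk.
  by case: ifPn => // _; exact: measurable_open_box.
apply/seteqP; split => [x Ux|x [qk /= BU]]; last exact: BU.
have /nbhs_rVP[e e0 eU] : nbhs x U by move: oU; rewrite openE => /(_ _ Ux).
(* With 2 / (k + 1) < e, a box of radius 1 / (k + 1) whose centre is that close to x stays within e
   of x. *)
pose k := Num.trunc (2 / e).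
have ke : 2 / e < k.+1%:R by exact: Num.Theory.truncnS_gt.
have k0 : 0 < k.+1%:R^-1 :> R by rewrite invr_gt0 ltr0Sn.
have k2e : k.+1%:R^-1 + k.+1%:R^-1 < e.
  rewrite -mulr2n -[X in X < _]mulr_natl ltr_pdivrMr ?ltr0Sn//.
  by move: ke; rewrite ltr_pdivrMr// mulrC.
have /choice[q qx] : forall i, exists q : rat, `|x 0 i - ratr q| < k.+1%:R^-1.
  move=> i; move: k0; move: (k.+1%:R^-1 : R) => r r0.
  have [|q] := @rat_in_itvoo R (x 0 i - r) (x 0 i + r); first lra.
  by rewrite in_itv/= => /andP[? ?]; exists q; rewrite ltr_norml; apply/andP; split; lra.
exists (\row_i q i, k); last by move=> i /=; rewrite !mxE.
move=> y /= yq; apply: eU => i; have := yq i; rewrite !mxE => yqi.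
rewrite (le_lt_trans (ler_distD (ratr (q i)) _ _))//.
by rewrite (lt_trans _ k2e)// ltrD// distrC.
Qed.

Lemma continuous_measurable_rV d (F : 'rV[R]_d -> R) : continuous F -> measurable_fun setT F.
Proof.
move=> cF; apply: (measurability _ (RGenOInfty.measurableE R)) => //.
move=> /= _ [_ [a ->] <-]; rewrite setTI; apply: open_measurable_rV.
by apply: open_comp => //; move=> x _; exact: cF.
Qed.

End topology_rV.

Section weight.
Context {R : realType}.

(* The weight making Fourier transforms of test functions integrable. *)
Definition wgt d (x : 'rV[R]_d) : R := \prod_i (1 + x 0 i ^+ 2).

Lemma wgt_ge1 d (x : 'rV[R]_d) : 1 <= wgt x.
Proof.
rewrite /wgt; elim/big_ind : _ => // [a b a1 b1|i _]; first nra.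
by rewrite lerDl sqr_ge0.
Qed.

Lemma wgt_gt0 d (x : 'rV[R]_d) : 0 < wgt x.
Proof. exact: lt_le_trans ltr01 (wgt_ge1 x). Qed.

Lemma wgtV_ge0 d (x : 'rV[R]_d) : 0 <= (wgt x)^-1.
Proof. by rewrite invr_ge0 ltW// wgt_gt0. Qed.

Lemma wgtV_le1 d (x : 'rV[R]_d) : (wgt x)^-1 <= 1.
Proof. by rewrite invf_le1 ?wgt_gt0 ?wgt_ge1. Qed.

Lemma measurable_wgt d : measurable_fun setT (@wgt d).
Proof.
rewrite /wgt; apply: measurable_prod => i _.
by apply: measurable_funD => //; apply: measurable_funX; exact: measurable_rV_coord.
Qed.

Lemma measurable_wgtV d : measurable_fun setT (fun x : 'rV[R]_d => (wgt x)^-1).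
Proof.
rewrite (_ : (fun _ => _) = fun x : 'rV[R]_d => expR (- ln (wgt x))).
  apply: measurableT_comp; first exact: measurable_expR.
  apply: measurable_funN; apply: measurableT_comp; first exact: measurable_ln.
  exact: measurable_wgt.
by apply/funext => x; rewrite expRN lnK// posrE wgt_gt0.
Qed.

(** The integrand is even and has the primitive [atan], with limit pi / 2. *)
Lemma integral_wgtV1 : (\int[@lebesgue_measure R]_x ((1 + x ^+ 2)^-1)%:E < +oo)%E.
Proof.
have cf : continuous (fun x : R => (1 + x ^+ 2)^-1).
  move=> x; apply: cvgV; first by rewrite gt_eqF// ltr_pwDl// sqr_ge0.
  by apply: cvgD; [exact: cvg_cst|exact: exprn_continuous].
rewrite ge0_symfun_integralT => [|x|//|x]; last 2 first.
- by rewrite invr_ge0 addr_ge0// sqr_ge0.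
- by rewrite /= sqrrN.
rewrite -set_itvcy (@ge0_continuous_FTC2y _ _ atan 0 (pi / 2)) => [||||||].
- by rewrite -EFinB -EFinM ltry.
- by move=> x _; rewrite invr_ge0 addr_ge0// sqr_ge0.
- exact: continuous_subspaceT.
- exact: cvgy_atan.
- by move=> x _; exact: derivable_atan.
- by apply: cvg_at_right_filter; exact: (@continuous_atan R 0).
- by move=> x _; rewrite derive1_atan.
Qed.

(** The reason for a product weight: the integral factors into one-dimensional ones, whereas 1 / (1
    + |x|^2) is not integrable for d >= 2. *)
Lemma integral_wgtV d : (\int[lebesgue_rV d]_x ((wgt x)^-1)%:E < +oo)%E.
Proof.
elim: d => [|d IH].
  rewrite /= integral_dirac//; [|by apply/measurable_EFinP; exact: measurable_wgtV].
  by rewrite diracE in_setT mul1e ltry.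
rewrite ge0_integral_rVS; last 2 first.
- by apply/measurable_EFinP; exact: measurable_wgtV.
- by move=> x; rewrite lee_fin wgtV_ge0.
have E x v : (wgt (rV_cons (x, v)))^-1 = (1 + x ^+ 2)^-1 * (@wgt d v)^-1.
  rewrite /wgt big_ord_recl rV_cons0 /= invfM; congr (_ * _^-1).
  by apply: eq_bigr => i _; rewrite rV_consS.
under eq_integral => x _.
  under eq_integral do rewrite E EFinM.
  rewrite ge0_integralZl//; last 3 first.
  - by apply/measurable_EFinP; exact: measurable_wgtV.
  - by move=> v _; rewrite lee_fin wgtV_ge0.
  - by rewrite lee_fin invr_ge0 addr_ge0// sqr_ge0.
  over.
rewrite ge0_integralZr//.
- rewrite lte_mul_pinfty//.
  + by apply: integral_ge0 => x _; rewrite lee_fin invr_ge0 addr_ge0// sqr_ge0.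
  + rewrite ge0_fin_numE; first exact: integral_wgtV1.
    by apply: integral_ge0 => x _; rewrite lee_fin invr_ge0 addr_ge0// sqr_ge0.
- apply/measurable_EFinP; apply: measurable_funTS; apply: continuous_measurable_fun.
  move=> x; apply: cvgV; first by rewrite gt_eqF// ltr_pwDl// sqr_ge0.
  by apply: cvgD; [exact: cvg_cst|exact: exprn_continuous].
- by move=> x _; rewrite lee_fin invr_ge0 addr_ge0// sqr_ge0.
- by apply: integral_ge0 => v _; rewrite lee_fin wgtV_ge0.
Qed.

End weight.

(** * Complex-valued integrals *)

Local Open Scope complex_scope.

Section cabs_theory.
Context {R : realType}.
Local Notation C := R[i].
Local Notation Re := (@complex.Re R).
Local Notation Im := (@complex.Im R).
Implicit Types z : C.

Lemma cabs_ge0 z : 0 <= cabs z.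
Proof. by case: z => a b; rewrite /cabs /= sqrtr_ge0. Qed.

Lemma cabs0 : cabs (0 : C) = 0.
Proof. exact: ComplexField.Normc.normc0. Qed.

Lemma cabs1 : cabs (1 : C) = 1.
Proof. exact: ComplexField.Normc.normc1. Qed.

Lemma cabs0_eq0 z : cabs z = 0 -> z = 0.
Proof. exact: ComplexField.Normc.eq0_normc. Qed.

Lemma cabs_gt0 z : z != 0 -> 0 < cabs z.
Proof. by move=> z0; rewrite lt_neqAle cabs_ge0 andbT eq_sym; apply: contra z0 => /eqP/cabs0_eq0 ->. Qed.

Lemma cabsM z1 z2 : cabs (z1 * z2) = cabs z1 * cabs z2.
Proof. exact: ComplexField.Normc.normcM. Qed.

Lemma cabsV z : cabs z^-1 = (cabs z)^-1.
Proof. exact: ComplexField.Normc.normcV. Qed.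

Lemma cabsX z n : cabs (z ^+ n) = cabs z ^+ n.
Proof. by elim: n => [|n IH]; rewrite ?expr0 ?cabs1// !exprS cabsM IH. Qed.

Lemma cabsD z1 z2 : cabs (z1 + z2) <= cabs z1 + cabs z2.
Proof. exact: le_normcD. Qed.

Lemma cabsN z : cabs (- z) = cabs z.
Proof. exact: normcN. Qed.

Lemma cabsC (x : R) : cabs (x%:C) = `|x|.
Proof. by rewrite /cabs /= expr0n /= addr0 sqrtr_sqr. Qed.

Lemma cabs_Re z : `|Re z| <= cabs z.
Proof. by case: z => a b; rewrite /cabs /= -sqrtr_sqr ler_wsqrtr// lerDl sqr_ge0. Qed.

Lemma cabs_Im z : `|Im z| <= cabs z.
Proof. by case: z => a b; rewrite /cabs /= -sqrtr_sqr ler_wsqrtr// lerDr sqr_ge0. Qed.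

Lemma cabs_le_ReIm z : cabs z <= `|Re z| + `|Im z|.
Proof.
have -> : cabs z = cabs ((Re z)%:C + (0 +i* 1) * (Im z)%:C) by congr cabs; case: z => a b; simpc.
rewrite (le_trans (cabsD _ _))// cabsM !cabsC (_ : cabs (0 +i* 1) = 1) ?mul1r//.
by rewrite /cabs /= expr0n expr1n add0r sqrtr1.
Qed.

Lemma cabs_sqr z : cabs z ^+ 2 = Re z ^+ 2 + Im z ^+ 2.
Proof. by case: z => a b; rewrite /cabs /= sqr_sqrtr// addr_ge0// sqr_ge0. Qed.

Lemma cReM z1 z2 : Re (z1 * z2) = Re z1 * Re z2 - Im z1 * Im z2.
Proof. by case: z1 z2 => [a b] [c e]. Qed.

Lemma cImM z1 z2 : Im (z1 * z2) = Re z1 * Im z2 + Im z1 * Re z2.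
Proof. by case: z1 z2 => [a b] [c e]. Qed.

Lemma cReD z1 z2 : Re (z1 + z2) = Re z1 + Re z2.
Proof. by case: z1 z2 => [a b] [c e]. Qed.

Lemma cImD z1 z2 : Im (z1 + z2) = Im z1 + Im z2.
Proof. by case: z1 z2 => [a b] [c e]. Qed.

Lemma cReN z : Re (- z) = - Re z. Proof. by case: z. Qed.

Lemma cImN z : Im (- z) = - Im z. Proof. by case: z. Qed.

Lemma complexP z1 z2 : Re z1 = Re z2 -> Im z1 = Im z2 -> z1 = z2.
Proof. by case: z1 z2 => [a b] [c e] /= -> ->. Qed.

Lemma cabs_cexpi (t : R) : cabs (cexpi t) = 1.
Proof. by rewrite /cabs /= cos2Dsin2 sqrtr1. Qed.

Lemma cexpiD (s t : R) : cexpi (s + t) = cexpi s * cexpi t.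
Proof. by apply: complexP; rewrite ?cReM ?cImM /= ?cosD ?sinD//; ring. Qed.

Lemma cexpi0 : cexpi 0 = 1 :> C.
Proof. by rewrite /cexpi cos0 sin0. Qed.

End cabs_theory.

Lemma cvgr_normB0 (R : realType) (u : nat -> R) (l : R) :
  u n @[n --> \oo] --> l -> `|u n - l| @[n --> \oo] --> 0.
Proof.
move=> ul; apply/cvgrPdist_lt => e e0; move/cvgrPdist_lt : ul => /(_ _ e0).
by apply: filterS => n; rewrite sub0r normrN normr_id distrC.
Qed.

Section cint.
Context {R : realType} {disp : measure_display} {T : measurableType disp}.
Local Notation C := R[i].
Local Notation Re := (@complex.Re R).
Local Notation Im := (@complex.Im R).
Implicit Types (F G : T -> C) (mu : {measure set T -> \bar R}).

(** Counterparts of [cmeasurable] and [cintegral] on an arbitrary measurable type, as Fubini needs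
    them on products; over [lebesgue_rV] they are convertible with the originals. *)
Definition cmeas F : Prop := measurable_fun setT (Re \o F) /\ measurable_fun setT (Im \o F).

Definition cint mu F : C := (\int[mu]_x Re (F x)) +i* (\int[mu]_x Im (F x)).

Definition cintegrable mu F : Prop :=
  cmeas F /\ (\int[mu]_x (cabs (F x))%:E < +oo)%E.

Lemma cmeas_cst (c : C) : cmeas (cst c).
Proof. by split; exact: measurable_cst. Qed.

Lemma cmeasD F G : cmeas F -> cmeas G -> cmeas (fun x => F x + G x).
Proof.
move=> [rF iF] [rG iG]; split.
  rewrite (_ : _ \o _ = (Re \o F) \+ (Re \o G)); first exact: measurable_funD.
  by apply/funext => x; exact: cReD.
rewrite (_ : _ \o _ = (Im \o F) \+ (Im \o G)); first exact: measurable_funD.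
  by apply/funext => x; exact: cImD.
Qed.

Lemma cmeasM F G : cmeas F -> cmeas G -> cmeas (fun x => F x * G x).
Proof.
move=> [rF iF] [rG iG]; split.
  rewrite (_ : _ \o _ = ((Re \o F) \* (Re \o G)) \- ((Im \o F) \* (Im \o G))).
    by apply: measurable_funB; apply: measurable_funM.
  by apply/funext => x; exact: cReM.
rewrite (_ : _ \o _ = ((Re \o F) \* (Im \o G)) \+ ((Im \o F) \* (Re \o G))).
  by apply: measurable_funD; apply: measurable_funM.
by apply/funext => x; exact: cImM.
Qed.

Lemma cmeasZ (c : C) F : cmeas F -> cmeas (fun x => c * F x).
Proof. by move=> mF; apply: cmeasM => //; exact: cmeas_cst. Qed.

Lemma cmeasN F : cmeas F -> cmeas (fun x => - F x).
Proof.
move=> mF; rewrite (_ : (fun _ => _) = fun x => (-1) * F x); first exact: cmeasZ.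
by apply/funext => x; rewrite mulN1r.
Qed.

Lemma cmeasB F G : cmeas F -> cmeas G -> cmeas (fun x => F x - G x).
Proof. by move=> mF mG; apply: cmeasD => //; exact: cmeasN. Qed.

Lemma cmeas_real (f : T -> R) : measurable_fun setT f -> cmeas (fun x => (f x)%:C).
Proof. by move=> mf; split => //; exact: measurable_cst. Qed.

Lemma cmeas_cexpi (f : T -> R) : measurable_fun setT f -> cmeas (fun x => cexpi (f x)).
Proof.
move=> mf; split.
  apply: (measurableT_comp (_ : measurable_fun setT (@cos R))) => //.
  by apply: continuous_measurable_fun; exact: continuous_cos.
apply: (measurableT_comp (_ : measurable_fun setT (@sin R))) => //.
by apply: continuous_measurable_fun; exact: continuous_sin.
Qed.

Lemma measurable_cabs F : cmeas F -> measurable_fun setT (fun x => cabs (F x)).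
Proof.
move=> [rF iF].
rewrite (_ : (fun _ => _) = (fun x => Num.sqrt ((Re \o F) x ^+ 2 + (Im \o F) x ^+ 2))).
  apply: (measurableT_comp (_ : measurable_fun setT (@Num.sqrt R))) => //.
    by apply: continuous_measurable_fun; exact: sqrt_continuous.
  by apply: measurable_funD; apply: measurable_funX.
by apply/funext => x /=; case: (F x).
Qed.

Lemma measurable_cabsE F : cmeas F -> measurable_fun setT (fun x => (cabs (F x))%:E).
Proof. by move=> mF; apply/measurable_EFinP; exact: measurable_cabs. Qed.

Lemma cabs_gee0 F x : (0 <= (cabs (F x))%:E)%E.
Proof. by rewrite lee_fin cabs_ge0. Qed.

Lemma int_cabs_ge0 mu F : (0 <= \int[mu]_x (cabs (F x))%:E)%E.
Proof. by apply: integral_ge0 => x _; exact: cabs_gee0. Qed.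

Lemma le_cintegrable mu F (G : T -> R) : cmeas F -> measurable_fun setT G ->
  (forall x, cabs (F x) <= G x) -> (\int[mu]_x (G x)%:E < +oo)%E -> cintegrable mu F.
Proof.
move=> mF mG FG iG; split=> //; apply: le_lt_trans iG.
apply: ge0_le_integral => //.
- by move=> x _; exact: cabs_gee0.
- exact: measurable_cabsE.
- exact/measurable_EFinP.
- by move=> x _; rewrite lee_fin.
Qed.

Lemma cintegrable_real mu F : cintegrable mu F ->
  mu.-integrable setT (fun x => (cabs (F x))%:E).
Proof.
move=> [mF iF]; apply/integrableP; split; first exact: measurable_cabsE.
by under eq_integral do rewrite gee0_abs ?cabs_gee0//.
Qed.

Lemma cintegrable_Re mu F : cintegrable mu F -> mu.-integrable setT (EFin \o (Re \o F)).
Proof.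
move=> iF; apply: (le_integrable _ _ _ (cintegrable_real iF)) => //.
  by apply/measurable_EFinP; case: iF => -[].
by move=> x _; rewrite /= lee_fin (ger0_norm (cabs_ge0 _)) cabs_Re.
Qed.

Lemma cintegrable_Im mu F : cintegrable mu F -> mu.-integrable setT (EFin \o (Im \o F)).
Proof.
move=> iF; apply: (le_integrable _ _ _ (cintegrable_real iF)) => //.
  by apply/measurable_EFinP; case: iF => -[].
by move=> x _; rewrite /= lee_fin (ger0_norm (cabs_ge0 _)) cabs_Im.
Qed.

Lemma cintegrableD mu F G : cintegrable mu F -> cintegrable mu G ->
  cintegrable mu (fun x => F x + G x).
Proof.
move=> iF iG; apply: (le_cintegrable (G := fun x => cabs (F x) + cabs (G x))).
- by apply: cmeasD; [case: iF|case: iG].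
- by apply: measurable_funD; apply: measurable_cabs; [case: iF|case: iG].
- by move=> x; exact: cabsD.
- under eq_integral do rewrite EFinD.
  rewrite ge0_integralD//.
  + by apply: lte_add_pinfty; [case: iF|case: iG].
  + by move=> x _; exact: cabs_gee0.
  + by apply: measurable_cabsE; case: iF.
  + by move=> x _; exact: cabs_gee0.
  + by apply: measurable_cabsE; case: iG.
Qed.

Lemma cintegrable_bounded mu F G (M : R) : cintegrable mu F -> cmeas G ->
  (forall x, cabs (G x) <= M) -> cintegrable mu (fun x => G x * F x).
Proof.
move=> iF mG GM; apply: (le_cintegrable (G := fun x => M * cabs (F x))).
- by apply: cmeasM => //; case: iF.
- by apply: measurable_funM => //; apply: measurable_cabs; case: iF.
- by move=> x; rewrite cabsM ler_wpM2r// cabs_ge0.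
(* 0 <= M is only known once T has a point. *)
- have [x|h] := pselect (exists x : T, True); last first.
    rewrite (_ : (fun _ => _) = cst 0%E) ?integral0//.
    by apply/funext => x; exfalso; apply: h; exists x.
  case: x => x _; have M0 : 0 <= M by exact: le_trans (cabs_ge0 _) (GM x).
  under eq_integral do rewrite EFinM.
  rewrite ge0_integralZl//; last 2 first.
  + by apply: measurable_cabsE; case: iF.
  + by move=> y _; exact: cabs_gee0.
  rewrite lte_mul_pinfty//.
  by case: iF.
Qed.

Lemma cintegrableZ mu (c : C) F : cintegrable mu F -> cintegrable mu (fun x => c * F x).
Proof.
by move=> iF; apply: (@cintegrable_bounded mu F (cst c) (cabs c)) => //; exact: cmeas_cst.
Qed.

Lemma cintegrableB mu F G : cintegrable mu F -> cintegrable mu G ->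
  cintegrable mu (fun x => F x - G x).
Proof.
move=> iF iG; rewrite (_ : (fun _ => _) = fun x => F x + (-1) * G x).
  by apply: cintegrableD => //; exact: cintegrableZ.
by apply/funext => x; rewrite mulN1r.
Qed.

Lemma eq_cint mu F G : F =1 G -> cint mu F = cint mu G.
Proof. by move=> FG; congr cint; apply/funext. Qed.

Lemma cintD mu F G : cintegrable mu F -> cintegrable mu G ->
  cint mu (fun x => F x + G x) = cint mu F + cint mu G.
Proof.
move=> iF iG; apply: complexP.
  rewrite cReD /= -RintegralD//; [|exact: cintegrable_Re..].
  by apply: eq_Rintegral => x _; rewrite cReD.
rewrite cImD /= -RintegralD//; [|exact: cintegrable_Im..].
by apply: eq_Rintegral => x _; rewrite cImD.
Qed.

Lemma cintZ mu (c : C) F : cintegrable mu F -> cint mu (fun x => c * F x) = c * cint mu F.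
Proof.
move=> iF; have iR := cintegrable_Re iF; have iI := cintegrable_Im iF.
have iZ (k : R) (h : T -> R) : mu.-integrable setT (EFin \o h) ->
    mu.-integrable setT (EFin \o (fun x => k * h x)).
  by move=> ih; apply: eq_integrable (integrableZl measurableT k ih).
apply: complexP.
  rewrite cReM /=; under eq_Rintegral do rewrite cReM.
  by rewrite RintegralB// ?RintegralZl//; exact: iZ.
rewrite cImM /=; under eq_Rintegral do rewrite cImM.
by rewrite RintegralD// ?RintegralZl//; exact: iZ.
Qed.

Lemma cintB mu F G : cintegrable mu F -> cintegrable mu G ->
  cint mu (fun x => F x - G x) = cint mu F - cint mu G.
Proof.
move=> iF iG; rewrite (@eq_cint _ _ (fun x => F x + (-1) * G x)); last by move=> x; rewrite mulN1r.
by rewrite cintD// ?cintZ ?mulN1r//; exact: cintegrableZ.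
Qed.

Lemma cint0 mu : cint mu (fun=> 0) = 0.
Proof. by rewrite /cint /= /Rintegral !integral0. Qed.

(** The factor 2 comes from bounding real and imaginary parts separately. *)
Lemma le_cabs_cint mu F : cintegrable mu F ->
  ((cabs (cint mu F))%:E <= 2%:E * \int[mu]_x (cabs (F x))%:E)%E.
Proof.
move=> iF; have iR := cintegrable_Re iF; have iI := cintegrable_Im iF.
apply: (@le_trans _ _ (`|\int[mu]_x Re (F x)|%:E + `|\int[mu]_x Im (F x)|%:E)%E).
  by rewrite -EFinD lee_fin; exact: cabs_le_ReIm.
rewrite mule_natl mule2n; apply: leeD.
  rewrite EFin_normr_Rintegral// (le_trans (le_abse_integral _ _ _))//.
    by case/integrableP: iR.
  apply: ge0_le_integral => //.
  - by apply: measurableT_comp => //; case/integrableP: iR.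
  - by apply: measurable_cabsE; case: iF.
  - by move=> x _ /=; rewrite lee_fin cabs_Re.
rewrite EFin_normr_Rintegral// (le_trans (le_abse_integral _ _ _))//.
  by case/integrableP: iI.
apply: ge0_le_integral => //.
- by apply: measurableT_comp => //; case/integrableP: iI.
- by apply: measurable_cabsE; case: iF.
- by move=> x _ /=; rewrite lee_fin cabs_Im.
Qed.

Lemma dominated_cint mu (F : nat -> T -> C) (F0 : T -> C) (G : T -> R) :
  (forall n, cmeas (F n)) -> cmeas F0 -> measurable_fun setT G ->
  (\int[mu]_x (G x)%:E < +oo)%E ->
  (forall n x, cabs (F n x) <= G x) ->
  (forall x, cabs (F n x - F0 x) @[n --> \oo] --> 0) ->
  cabs (cint mu (F n) - cint mu F0) @[n --> \oo] --> 0.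
Proof.
move=> mF mF0 mG iG FG FF0.
have G0 x : 0 <= G x by exact: le_trans (cabs_ge0 _) (FG 0%N x).
have F0G x : cabs (F0 x) <= G x.
  apply/ler_addgt0Pr => e e0; have /cvgr0Pnorm_lt/(_ _ e0)[n _ /(_ _ (leqnn n))] := FF0 x.
  rewrite (ger0_norm (cabs_ge0 _)) => h.
  rewrite -[F0 x](subKr (F n x)) (le_trans (cabsD _ _))// lerD// cabsN.
  exact: ltW.
have iGm : mu.-integrable setT (EFin \o G).
  apply/integrableP; split; first exact/measurable_EFinP.
  by under eq_integral do rewrite /= ger0_norm//.
have iF n : cintegrable mu (F n) by apply: le_cintegrable iG.
have iF0 : cintegrable mu F0 by apply: le_cintegrable iG.
(* [pr] stands for [Re] and [Im], which are then treated by the same argument. *)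
have cv (pr : C -> R) : (forall z, `|pr z| <= cabs z) -> (forall x y, pr (x - y) = pr x - pr y) ->
    (forall n, mu.-integrable setT (EFin \o (pr \o F n))) ->
    mu.-integrable setT (EFin \o (pr \o F0)) ->
    \int[mu]_x pr (F n x) @[n --> \oo] --> \int[mu]_x pr (F0 x).
  move=> prle prB ipF ipF0; apply: fine_cvg; rewrite /Rintegral fineK; last first.
    exact: integrable_fin_num.
  apply: (@dominated_cvg _ _ _ mu _ _ (fun n x => (pr (F n x))%:E) _ (EFin \o G)) => //.
  - by move=> n; case/integrableP: (ipF n).
  - move=> x _; apply: cvg_EFin; first exact: nearW.
    apply/cvgrPdist_lt => e e0; have /cvgr0Pnorm_lt/(_ _ e0) := FF0 x.
    apply: filterS => n; rewrite (ger0_norm (cabs_ge0 _)); apply: le_lt_trans.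
    by rewrite distrC -prB.
  - by move=> n x _; rewrite /= lee_fin (le_trans (prle _)).
have cR := cv Re (@cabs_Re R) _ (fun n => cintegrable_Re (iF n)) (cintegrable_Re iF0).
have cI := cv Im (@cabs_Im R) _ (fun n => cintegrable_Im (iF n)) (cintegrable_Im iF0).
apply: (@squeeze_cvgr _ _ _ _ (cst 0) (fun n => `|\int[mu]_x Re (F n x) - \int[mu]_x Re (F0 x)| + `|\int[mu]_x Im (F n x) - \int[mu]_x Im (F0 x)|)).
- apply: nearW => n; rewrite cabs_ge0 (le_trans (cabs_le_ReIm _))//.
- exact: cvg_cst.
- rewrite -[0](addr0 0); apply: cvgD.
    by apply: cvgr_normB0; apply: cR => x y; rewrite cReD cReN.
  by apply: cvgr_normB0; apply: cI => x y; rewrite cImD cImN.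
Qed.

End cint.

Local Open Scope complex_scope.

(** * Fubini's theorem for complex-valued functions *)

Section cfubini.
Context {R : realType} {d1 d2 : measure_display}
  {T1 : measurableType d1} {T2 : measurableType d2}.
Local Notation C := R[i].
Local Notation Re := (@complex.Re R).
Local Notation Im := (@complex.Im R).
Variables (m1 : {sigma_finite_measure set T1 -> \bar R})
  (m2 : {sigma_finite_measure set T2 -> \bar R}).
Implicit Types F : T1 * T2 -> C.

Lemma cmeas_comp d (T : measurableType d) d' (T' : measurableType d') (F : T' -> C) (h : T -> T') :
  cmeas F -> measurable_fun setT h -> cmeas (F \o h).
Proof. by move=> [rF iF] mh; split; [apply: (measurableT_comp rF)|apply: (measurableT_comp iF)]. Qed.

Lemma cmeas_section1 F x : cmeas F -> cmeas (fun y => F (x, y)).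
Proof. by move=> mF; apply: (cmeas_comp mF); exact: measurable_pair1. Qed.

Lemma cmeas_section2 F y : cmeas F -> cmeas (fun x => F (x, y)).
Proof. by move=> mF; apply: (cmeas_comp mF); exact: measurable_pair2. Qed.

Lemma measurable_Rintegral_section (f : T1 * T2 -> R) : measurable_fun setT f ->
  measurable_fun setT (fun x => \int[m2]_y f (x, y)).
Proof.
move=> mf; apply: (measurableT_comp (@fine_measurable R setT measurableT)) => //.
have mfE : measurable_fun setT (EFin \o f) by exact/measurable_EFinP.
rewrite (_ : (fun _ => _) = fun x => (\int[m2]_y (EFin \o f)^\+ (x, y) -
    \int[m2]_y (EFin \o f)^\- (x, y))%E); last first.
  apply/funext => x; rewrite integralE; congr (_ - _)%E.
    by apply: eq_integral => y _; rewrite !funeposE.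
  by apply: eq_integral => y _; rewrite !funenegE.
apply: emeasurable_funB.
  by apply: measurable_fun_fubini_tonelli_F => //; exact: measurable_funepos.
by apply: measurable_fun_fubini_tonelli_F => //; exact: measurable_funeneg.
Qed.

Lemma cmeas_cint F : cmeas F -> cmeas (fun x => cint m2 (fun y => F (x, y))).
Proof.
by move=> [rF iF]; split;
  [apply: (measurable_Rintegral_section rF)|apply: (measurable_Rintegral_section iF)].
Qed.

(** All sections, not just almost all, are assumed integrable, so that [fine] can be removed from
    the inner integrals pointwise. *)
Lemma Rfubini (f : T1 * T2 -> R) : (m1 \x m2)%E.-integrable setT (EFin \o f) ->
  (forall x, m2.-integrable setT (EFin \o (fun y => f (x, y)))) ->
  (forall y, m1.-integrable setT (EFin \o (fun x => f (x, y)))) ->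
  \int[m1]_x (\int[m2]_y f (x, y)) = \int[m2]_y (\int[m1]_x f (x, y)).
Proof.
move=> mf if2 if1; rewrite /Rintegral; congr fine.
under eq_integral => x _ do rewrite (fineK (integrable_fin_num measurableT (if2 x))).
under [RHS]eq_integral => y _ do rewrite (fineK (integrable_fin_num measurableT (if1 y))).
exact: (Fubini mf).
Qed.

Lemma cfubini F : cmeas F ->
  (\int[m1]_x \int[m2]_y (cabs (F (x, y)))%:E < +oo)%E ->
  (forall x, cintegrable m2 (fun y => F (x, y))) ->
  (forall y, cintegrable m1 (fun x => F (x, y))) ->
  cint m1 (fun x => cint m2 (fun y => F (x, y))) =
  cint m2 (fun y => cint m1 (fun x => F (x, y))).
Proof.
move=> mF iF iF2 iF1.
have ipF : (m1 \x m2)%E.-integrable setT (fun z => (cabs (F z))%:E).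
  apply/integrable12ltyP; first exact: measurable_cabsE.
  by under eq_integral do under eq_integral do rewrite gee0_abs ?cabs_gee0//.
apply: complexP; [apply: (@Rfubini (Re \o F))|apply: (@Rfubini (Im \o F))].
- apply: (le_integrable _ _ _ ipF) => //; first by apply/measurable_EFinP; case: mF.
  by move=> z _; rewrite /= lee_fin (ger0_norm (cabs_ge0 _)) cabs_Re.
- by move=> x; exact: (cintegrable_Re (iF2 x)).
- by move=> x; exact: (cintegrable_Re (iF1 x)).
- apply: (le_integrable _ _ _ ipF) => //; first by apply/measurable_EFinP; case: mF.
  by move=> z _; rewrite /= lee_fin (ger0_norm (cabs_ge0 _)) cabs_Im.
- by move=> x; exact: (cintegrable_Im (iF2 x)).
- by move=> x; exact: (cintegrable_Im (iF1 x)).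
Qed.

End cfubini.

Section cint_affine.
Context {R : realType} {d : nat}.
Local Notation C := R[i].
Local Notation Re := (@complex.Re R).
Local Notation Im := (@complex.Im R).
Local Notation mu := (@lebesgue_rV R d).
Implicit Types F : 'rV[R]_d -> C.

Lemma integral_cabs_affine (a : R) (b : 'rV[R]_d) F : a != 0 -> cmeas F ->
  (\int[mu]_x (cabs (F (a *: x + b)%R))%:E = (`|a| ^- d)%:E * \int[mu]_x (cabs (F x))%:E)%E.
Proof.
move=> a0 mF; apply: (@ge0_integral_affine _ _ a b (fun x => (cabs (F x))%:E)) => //.
  exact: measurable_cabsE.
by move=> x; exact: cabs_gee0.
Qed.

Lemma cintegrable_affine (a : R) (b : 'rV[R]_d) F : a != 0 -> cintegrable mu F ->
  cintegrable mu (fun x => F (a *: x + b)).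
Proof.
move=> a0 [mF iF]; split.
  exact: (cmeas_comp mF (measurable_affine_rV a b)).
rewrite integral_cabs_affine// lte_mul_pinfty// lee_fin invr_ge0 exprn_ge0//.
Qed.

Lemma Rintegral_affine (a : R) (b : 'rV[R]_d) (f : 'rV[R]_d -> R) : a != 0 ->
  mu.-integrable setT (EFin \o f) ->
  \int[mu]_x f (a *: x + b) = (`|a| ^- d) * \int[mu]_x f x.
Proof.
move=> a0 iF; have mf := measurable_int _ iF.
have fp := integrable_pos_fin_num measurableT iF.
have fn := integrable_neg_fin_num measurableT iF.
have Ep : (\int[mu]_x (EFin \o (fun y => f (a *: y + b)%R))^\+ x =
    (`|a| ^- d)%:E * \int[mu]_x (EFin \o f)^\+ x)%E.
  rewrite -(ge0_integral_affine b a0 (measurable_funepos mf)); last by move=> x; exact: funepos_ge0.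
  by apply: eq_integral => x _; rewrite !funeposE.
have En : (\int[mu]_x (EFin \o (fun y => f (a *: y + b)%R))^\- x =
    (`|a| ^- d)%:E * \int[mu]_x (EFin \o f)^\- x)%E.
  rewrite -(ge0_integral_affine b a0 (measurable_funeneg mf)); last by move=> x; exact: funeneg_ge0.
  by apply: eq_integral => x _; rewrite !funenegE.
rewrite /Rintegral integralE [X in _ = _ * fine X]integralE Ep En; move: fp fn.
move: (\int[_]_x _)%E => A; move: (\int[_]_x _)%E => B.
by case: A => // A; case: B => // B _ _ /=; rewrite -mulrBr.
Qed.

Lemma cint_affine (a : R) (b : 'rV[R]_d) F : a != 0 -> cintegrable mu F ->
  cint mu (fun x => F (a *: x + b)) = (`|a| ^- d)%:C * cint mu F.
Proof.
move=> a0 iF; apply: complexP.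
  by rewrite cReM /= mul0r subr0 -(Rintegral_affine b a0 (cintegrable_Re iF)).
by rewrite cImM /= mul0r addr0 -(Rintegral_affine b a0 (cintegrable_Im iF)).
Qed.

Lemma cintegrable_shift (b : 'rV[R]_d) F : cintegrable mu F -> cintegrable mu (fun x => F (x + b)).
Proof.
move=> iF; have := cintegrable_affine b (oner_neq0 R) iF.
by under eq_fun do rewrite scale1r.
Qed.

Lemma cint_shift (b : 'rV[R]_d) F : cintegrable mu F -> cint mu (fun x => F (x + b)) = cint mu F.
Proof.
move=> iF; have := cint_affine b (oner_neq0 R) iF.
by under eq_fun do rewrite scale1r; rewrite normr1 expr1n invr1 mul1r.
Qed.

End cint_affine.

(** * Smooth functions *)

Section smooth_theory.
Context {R : realType} {d : nat}.
Local Notation C := R[i].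
Local Notation Re := (@complex.Re R).
Local Notation Im := (@complex.Im R).
Local Notation Rd := 'rV[R]_d.
Implicit Types (f g h : Rd -> C) (x v : Rd).

(** Existence and value of the derivative in one predicate, so that the rules for sums and products
    compose; [cderive] alone says nothing where the derivative does not exist. *)
Definition cder f x v (l : C) : Prop :=
  is_derive x v (Re \o f : Rd -> R) (Re l) /\ is_derive x v (Im \o f : Rd -> R) (Im l).

Lemma cder_cderive f x v l : cder f x v l -> cderive f v x = l.
Proof. by move=> [rf jf]; apply: complexP; rewrite /cderive /= derive_val. Qed.

Lemma cder_cderivable f x v l : cder f x v l -> cderivable f x v.
Proof. by move=> [[rf _] [jf _]]. Qed.

Lemma cderivable_cder f x v : cderivable f x v -> cder f x v (cderive f v x).
Proof. by move=> [rf jf]; split; exact: DeriveDef. Qed.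

Lemma cder_eq f x v l l' : l = l' -> cder f x v l -> cder f x v l'.
Proof. by move=> ->. Qed.

Lemma cder_near f g x v l : (\forall y \near x, f y = g y) -> cder f x v l -> cder g x v l.
Proof.
move=> fg [rf jf]; split.
  by apply: near_eq_is_derive rf; apply: filterS fg => y /= ->.
by apply: near_eq_is_derive jf; apply: filterS fg => y /= ->.
Qed.

Lemma cder_cst (c : C) x v : cder (cst c) x v 0.
Proof. by split; exact: is_derive_cst. Qed.

Lemma cderD f g x v l k : cder f x v l -> cder g x v k -> cder (fun y => f y + g y) x v (l + k).
Proof.
move=> [rf jf] [rg jg]; split.
  rewrite cReD (_ : _ \o _ = (Re \o f) + (Re \o g)); first exact: is_deriveD.
  by apply/funext => y; exact: cReD.
rewrite cImD (_ : _ \o _ = (Im \o f) + (Im \o g)); first exact: is_deriveD.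
by apply/funext => y; exact: cImD.
Qed.

Lemma cderM f g x v l k : cder f x v l -> cder g x v k ->
  cder (fun y => f y * g y) x v (l * g x + f x * k).
Proof.
move=> [rf jf] [rg jg]; split.
  rewrite (_ : _ \o _ = (Re \o f) * (Re \o g) - (Im \o f) * (Im \o g)); last first.
    by apply/funext => y; exact: cReM.
  by apply: is_derive_eq; rewrite !(cReD, cReM, cImM) /= /GRing.scale /=; ring.
rewrite (_ : _ \o _ = (Re \o f) * (Im \o g) + (Im \o f) * (Re \o g)); last first.
  by apply/funext => y; exact: cImM.
by apply: is_derive_eq; rewrite !(cImD, cReM, cImM) /= /GRing.scale /=; ring.
Qed.

Lemma partial_cder f j x l : cder f x (delta_mx 0 j) l -> partial j f x = l.
Proof. exact: cder_cderive. Qed.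

Lemma ccontinuous_cst (c : C) : ccontinuous (cst c : Rd -> C).
Proof. by split; exact: cst_continuous. Qed.

Lemma ccontinuousD f g : ccontinuous f -> ccontinuous g -> ccontinuous (fun y => f y + g y).
Proof.
move=> [rf jf] [rg jg]; split => x.
  rewrite /continuous_at (_ : _ \o _ = (Re \o f) \+ (Re \o g)); last first.
    by apply/funext => y; exact: cReD.
  exact: (cvgD (rf x) (rg x)).
rewrite /continuous_at (_ : _ \o _ = (Im \o f) \+ (Im \o g)); last first.
  by apply/funext => y; exact: cImD.
exact: (cvgD (jf x) (jg x)).
Qed.

Lemma ccontinuousM f g : ccontinuous f -> ccontinuous g -> ccontinuous (fun y => f y * g y).
Proof.
move=> [rf jf] [rg jg]; split => x.
  rewrite /continuous_at (_ : _ \o _ = (Re \o f) \* (Re \o g) \- (Im \o f) \* (Im \o g)); last first.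
    by apply/funext => y; exact: cReM.
  exact: (cvgB (cvgM (rf x) (rg x)) (cvgM (jf x) (jg x))).
rewrite /continuous_at (_ : _ \o _ = (Re \o f) \* (Im \o g) \+ (Im \o f) \* (Re \o g)); last first.
  by apply/funext => y; exact: cImM.
exact: (cvgD (cvgM (rf x) (jg x)) (cvgM (jf x) (rg x))).
Qed.

Lemma ccontinuous_cmeas f : ccontinuous f -> cmeas f.
Proof. by move=> [rf jf]; split; exact: continuous_measurable_rV. Qed.

Lemma partials_rcons s j f : partials (rcons s j) f = partials s (partial j f).
Proof. by rewrite /partials -cats1 foldr_cat. Qed.

Lemma smooth_continuous f : smooth f -> ccontinuous f.
Proof. by move=> /(_ [::])[]. Qed.

Lemma smooth_cder f j x : smooth f -> cder f x (delta_mx 0 j) (partial j f x).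
Proof. by move=> /(_ [::])[_ /(_ j x)]; exact: cderivable_cder. Qed.

Lemma smooth_partial f j : smooth f -> smooth (partial j f).
Proof. by move=> sf s; rewrite -partials_rcons; exact: sf. Qed.

Lemma smooth_partials f s : smooth f -> smooth (partials s f).
Proof. by elim: s => [sf|j s IH sf]; [exact: sf|exact: smooth_partial (IH sf)]. Qed.

(** A coinduction principle: [smooth] quantifies over all iterated partial derivatives, and these
    stay in any class that is closed under differentiation. *)
Lemma smooth_coind (A : set (Rd -> C)) :
  (forall f, A f -> ccontinuous f) ->
  (forall f, A f -> forall j, exists2 g, A g & forall x, cder f x (delta_mx 0 j) (g x)) ->
  forall f, A f -> smooth f.
Proof.
move=> Ac Ad f Af s.
have Ap g j : A g -> A (partial j g).
  move=> /Ad/(_ j)[k Ak gk]; rewrite (_ : partial j g = k)//.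
  by apply/funext => x; exact: partial_cder.
have As : A (partials s f) by elim: s => //= j s; exact: Ap.
split; first exact: Ac.
move=> j x; have [k _ gk] := Ad _ As j; exact: (cder_cderivable (gk x)).
Qed.

(* Unfolding these makes unification diverge. *)
#[local] Opaque smooth partial.

(** Products of smooth functions are not closed under differentiation, because Leibniz' rule
    produces sums of products. This closure is the class to which [smooth_coind] applies. *)
Inductive smooth_alg : (Rd -> C) -> Prop :=
| smooth_alg_base f : smooth f -> smooth_alg f
| smooth_alg_add f g : smooth_alg f -> smooth_alg g -> smooth_alg (fun x => f x + g x)
| smooth_alg_mul f g : smooth_alg f -> smooth_alg g -> smooth_alg (fun x => f x * g x).

Lemma smooth_algP f : smooth_alg f -> smooth f.
Proof.
apply: (@smooth_coind smooth_alg) => {f} f.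
  elim=> [{}f /smooth_continuous//|g h _ cg _ ch|g h _ cg _ ch].
    exact: ccontinuousD.
  exact: ccontinuousM.
elim=> [{}f sf j|g h _ ig _ ih j|g h ag ig ah ih j].
- exists (partial j f); first exact/smooth_alg_base/smooth_partial.
  by move=> x; exact: smooth_cder.
- have [g' ag' gg'] := ig j; have [h' ah' hh'] := ih j.
  exists (fun x => g' x + h' x); first exact: smooth_alg_add.
  by move=> x; exact: cderD.
- have [g' ag' gg'] := ig j; have [h' ah' hh'] := ih j.
  exists (fun x => g' x * h x + g x * h' x).
    by apply: smooth_alg_add; apply: smooth_alg_mul.
  by move=> x; exact: cderM.
Qed.

Lemma smoothD f g : smooth f -> smooth g -> smooth (fun x => f x + g x).
Proof. by move=> sf sg; apply/smooth_algP/smooth_alg_add; exact: smooth_alg_base. Qed.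

Lemma smoothM f g : smooth f -> smooth g -> smooth (fun x => f x * g x).
Proof. by move=> sf sg; apply/smooth_algP/smooth_alg_mul; exact: smooth_alg_base. Qed.

Lemma smooth_cst (c : C) : smooth (cst c : Rd -> C).
Proof.
apply: (@smooth_coind [set f | exists c, f = cst c]); last by exists c.
  by move=> _ [a ->]; exact: ccontinuous_cst.
by move=> _ [a ->] j; exists (cst 0); [exists 0|move=> x; exact: cder_cst].
Qed.

Lemma smoothZ (c : C) f : smooth f -> smooth (fun x => c * f x).
Proof. exact: smoothM (smooth_cst c). Qed.

Lemma smoothN f : smooth f -> smooth (fun x => - f x).
Proof.
move=> sf; rewrite (_ : (fun x => _) = fun x => -1 * f x); first exact: smoothZ sf.
by apply/funext => x; rewrite mulN1r.
Qed.

Lemma smoothB f g : smooth f -> smooth g -> smooth (fun x => f x - g x).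
Proof. move=> sf sg; exact: smoothD sf (smoothN sg). Qed.

Lemma smooth_sum I (r : seq I) (P : pred I) (F : I -> Rd -> C) :
  (forall i, smooth (F i)) -> smooth (fun x => \sum_(i <- r | P i) F i x).
Proof.
move=> sF; elim: r => [|i r IH].
  rewrite (_ : (fun x => _) = cst 0); first exact: smooth_cst.
  by apply/funext => x; rewrite big_nil.
rewrite (_ : (fun x => _) = if P i then (fun x => F i x + \sum_(j <- r | P j) F j x)
    else (fun x => \sum_(j <- r | P j) F j x)).
  by case: (P i); [exact: smoothD (sF i) IH|exact: IH].
by apply/funext => x; rewrite big_cons; case: (P i).
Qed.

Lemma smooth_prod I (r : seq I) (P : pred I) (F : I -> Rd -> C) :
  (forall i, smooth (F i)) -> smooth (fun x => \prod_(i <- r | P i) F i x).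
Proof.
move=> sF; elim: r => [|i r IH].
  rewrite (_ : (fun x => _) = cst 1); first exact: smooth_cst.
  by apply/funext => x; rewrite big_nil.
rewrite (_ : (fun x => _) = if P i then (fun x => F i x * \prod_(j <- r | P j) F j x)
    else (fun x => \prod_(j <- r | P j) F j x)).
  by case: (P i); [exact: smoothM (sF i) IH|exact: IH].
by apply/funext => x; rewrite big_cons; case: (P i).
Qed.

Lemma smoothX f n : smooth f -> smooth (fun x => f x ^+ n).
Proof.
move=> sf; elim: n => [|n IH]; first exact: smooth_cst.
rewrite (_ : (fun x => _) = fun x => f x * f x ^+ n); first exact: smoothM sf IH.
by apply/funext => x; rewrite exprS.
Qed.

Lemma partialD j f g : smooth f -> smooth g ->
  partial j (fun x => f x + g x) = (fun x => partial j f x + partial j g x).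
Proof.
move=> sf sg; apply/funext => x; apply: partial_cder.
exact: cderD (smooth_cder j x sf) (smooth_cder j x sg).
Qed.

Lemma partialM j f g : smooth f -> smooth g ->
  partial j (fun x => f x * g x) = (fun x => partial j f x * g x + f x * partial j g x).
Proof.
move=> sf sg; apply/funext => x; apply: partial_cder.
exact: cderM (smooth_cder j x sf) (smooth_cder j x sg).
Qed.

Lemma partialZ j (c : C) f : smooth f ->
  partial j (fun x => c * f x) = (fun x => c * partial j f x).
Proof.
move=> sf; apply/funext => x; apply: partial_cder.
by apply: cder_eq (cderM (cder_cst c x _) (smooth_cder j x sf)); rewrite mul0r add0r.
Qed.

Lemma partialsD s f g : smooth f -> smooth g ->
  partials s (fun x => f x + g x) = (fun x => partials s f x + partials s g x).
Proof.
move=> sf sg; elim: s => [//|j s IH]; rewrite [LHS]/= IH.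
exact: partialD (smooth_partials s sf) (smooth_partials s sg).
Qed.

Lemma partialsZ s (c : C) f : smooth f ->
  partials s (fun x => c * f x) = (fun x => c * partials s f x).
Proof.
move=> sf; elim: s => [//|j s IH]; rewrite [LHS]/= IH.
exact: partialZ (smooth_partials s sf).
Qed.

(** Restriction to a line makes the one-variable chain rule available. *)
Lemma is_derive_line (F : Rd -> R) x v (l : R) :
  is_derive (0 : R) 1 (fun t : R => F (x + t *: v)) l -> is_derive x v F l.
Proof.
move=> [dF DF]; suff E : (fun h : R => h^-1 *: ((F \o shift x) (h *: v) - F x)) =
    (fun h : R => h^-1 *: (((fun t : R => F (x + t *: v)) \o shift 0) (h *: 1) - F (x + 0 *: v))).
  by split; [rewrite /derivable E|rewrite /derive E].
apply/funext => h; rewrite /= scale0r !addr0 (_ : h *: 1 = h) 1?[x + _]addrC//.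
exact: mulr1.
Qed.

Lemma line_is_derive (F : Rd -> R) x v (l t : R) :
  is_derive (x + t *: v) v F l -> is_derive t 1 (fun t : R => F (x + t *: v)) l.
Proof.
move=> [dF DF].
suff E : (fun h : R => h^-1 *: (((fun t : R => F (x + t *: v)) \o shift t) (h *: 1) - F (x + t *: v))) =
    (fun h : R => h^-1 *: ((F \o shift (x + t *: v)) (h *: v) - F (x + t *: v))).
  by split; [rewrite /derivable E|rewrite /derive E].
apply/funext => h; rewrite /= (_ : h *: 1 = h); last exact: mulr1.
by rewrite scalerDl addrCA.
Qed.

Lemma cder_comp_affine (q q' : R -> R) (a b : R) (i j : 'I_d) x :
  is_derive (a * x 0 i + b) 1 q (q' (a * x 0 i + b)) ->
  cder (fun y => (q (a * y 0 i + b))%:C) x (delta_mx 0 j)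
    ((a *+ (i == j)) * q' (a * x 0 i + b))%:C.
Proof.
move=> dq; split; last exact: is_derive_cst.
apply: is_derive_line => /=.
pose m := a *+ (i == j).
rewrite (_ : (fun t : R => _) = q \o (fun t : R => m * t + (a * x 0 i + b))); last first.
  apply/funext => t /=; congr q; rewrite !mxE /m eqxx /=.
  by case: (i == j); rewrite /= ?mulr1n ?mulr0n; ring.
have dl : is_derive (0 : R) 1 (fun t : R => m * t + (a * x 0 i + b)) m.
  by apply: is_derive_eq; rewrite /GRing.scale /= addr0 !mulr1.
have dq' : is_derive ((fun t : R => m * t + (a * x 0 i + b)) 0) 1 q (q' (a * x 0 i + b)).
  by rewrite mulr0 add0r.
rewrite [X in is_derive _ _ _ X]mulrC.
exact: (@is_derive1_comp R q (fun t : R => m * t + (a * x 0 i + b)) 0 _ _ dq' dl).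
Qed.

Lemma smooth_coord (a b : R) (i : 'I_d) : smooth (fun x : Rd => (a * x 0 i + b)%:C).
Proof.
apply: (@smooth_coind [set f | (exists c, f = cst c) \/ f = fun x : Rd => (a * x 0 i + b)%:C]); last by right.
  move=> _ [[c ->]|->]; first exact: ccontinuous_cst.
  split; last exact: cst_continuous.
  suff : continuous (fun x : Rd => a * x 0 i + b) by [].
  move=> x.
  exact: (cvgD (cvgM (cvg_cst a) (@coord_continuous _ _ _ 0 i x)) (cvg_cst b)).
move=> _ [[c ->]|->] j.
  by exists (cst 0); [left; exists 0|move=> x; exact: cder_cst].
exists (cst (a *+ (i == j))%:C); first by left; eexists.
move=> x; rewrite /cst /= -[X in X%:C]mulr1.
apply: (@cder_comp_affine id (fun=> 1)); exact: is_derive_id.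
Qed.

(** Complex conjugation written out; it serves to write 1 / P as conj P / |P|^2, with a real
    denominator. *)
Lemma smooth_conj f : smooth f -> smooth (fun x => (Re (f x))%:C - (0 +i* 1) * (Im (f x))%:C).
Proof.
move=> sf; apply: (@smooth_coind [set g | exists2 f, smooth f & g = (fun x => (Re (f x))%:C - (0 +i* 1) * (Im (f x))%:C)]); last by exists f.
  move=> _ [g sg ->]; have [cr ci] := smooth_continuous sg; split.
    rewrite (_ : _ \o _ = Re \o g)//; apply/funext => x /=; case: (g x) => u w /=; ring.
  rewrite (_ : _ \o _ = (fun x => - (Im \o g) x)); last first.
    by apply/funext => x /=; case: (g x) => u w /=; ring.
  by move=> x; exact: (cvgN (ci x)).
move=> _ [g sg ->] j; exists (fun x => (Re (partial j g x))%:C - (0 +i* 1) * (Im (partial j g x))%:C).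
  by exists (partial j g) => //; exact: smooth_partial.
move=> x; have [dr di] := smooth_cder j x sg; split.
  rewrite (_ : _ \o _ = Re \o g); last by apply/funext => y /=; case: (g y) => u w /=; ring.
  by apply: is_derive_eq; case: (partial j g x) => u w /=; ring.
rewrite (_ : _ \o _ = - (Im \o g)); last first.
  by apply/funext => y /=; rewrite fctE /=; case: (g y) => u w /=; ring.
by apply: is_derive_eq; case: (partial j g x) => u w /=; ring.
Qed.

End smooth_theory.

Section smooth_exp.
Context {R : realType} {d : nat}.
Local Notation C := R[i].
Local Notation Re := (@complex.Re R).
Local Notation Im := (@complex.Im R).
Local Notation Rd := 'rV[R]_d.

Lemma dotC (x y : Rd) : dot x y = dot y x.
Proof. by rewrite /dot; apply: eq_bigr => i _; rewrite mulrC. Qed.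

Lemma dotDr (x y z : Rd) : dot x (y + z) = dot x y + dot x z.
Proof. by rewrite /dot -big_split; apply: eq_bigr => i _; rewrite mxE mulrDr. Qed.

Lemma dotZr (x y : Rd) (a : R) : dot x (a *: y) = a * dot x y.
Proof. by rewrite /dot mulr_sumr; apply: eq_bigr => i _; rewrite mxE mulrCA. Qed.

Lemma dotNr (x y : Rd) : dot x (- y) = - dot x y.
Proof. by rewrite -scaleN1r dotZr mulN1r. Qed.

Lemma dot_delta (x : Rd) j : dot x (delta_mx 0 j) = x 0 j.
Proof.
rewrite /dot (bigD1 j)//= big1 ?addr0 ?mxE ?eqxx ?mulr1// => i ij.
by rewrite mxE (negbTE ij) andbF mulr0.
Qed.

Lemma smooth_dot (a : Rd) : smooth (fun x : Rd => (dot a x)%:C).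
Proof.
rewrite (_ : (fun _ => _) = fun x : Rd => \sum_j (a 0 j * x 0 j + 0)%:C).
  apply: (smooth_sum _ _ (fun j => smooth_coord (a 0 j) 0 j)).
apply/funext => x; rewrite /dot rmorph_sum; apply: eq_bigr => j _.
by rewrite addr0.
Qed.

Lemma continuous_dot (a : Rd) : continuous (dot a).
Proof. by have [c _] := smooth_continuous (smooth_dot a). Qed.

Lemma measurable_dot : measurable_fun setT (fun z : Rd * Rd => dot z.1 z.2).
Proof.
rewrite /dot; apply: measurable_sum => i; apply: measurable_funM.
  exact: (measurableT_comp (measurable_rV_coord i) measurable_fst).
exact: (measurableT_comp (measurable_rV_coord i) measurable_snd).
Qed.

Lemma cder_cexpi (a x : Rd) j :
  cder (fun y => cexpi (dot a y)) x (delta_mx 0 j) ((0 +i* a 0 j) * cexpi (dot a x)).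
Proof.
have dl : is_derive (0 : R) 1 (fun t : R => a 0 j * t + dot a x) (a 0 j).
  by apply: is_derive_eq; rewrite /GRing.scale /= addr0 mulr1.
have e0 : (fun t : R => a 0 j * t + dot a x) 0 = dot a x by rewrite mulr0 add0r.
have E t : dot a (x + t *: delta_mx 0 j) = a 0 j * t + dot a x.
  by rewrite dotDr dotZr dot_delta addrC mulrC.
split; apply: is_derive_line.
  rewrite (_ : (fun t : R => _) = cos \o (fun t : R => a 0 j * t + dot a x)); last first.
    by apply/funext => t /=; rewrite E.
  have dc : is_derive ((fun t : R => a 0 j * t + dot a x) 0) 1 cos (- sin (dot a x)).
    by rewrite e0; exact: is_derive_cos.
  apply: is_derive_eq (@is_derive1_comp R cos (fun t : R => a 0 j * t + dot a x) 0 _ _ dc dl) _.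
  by rewrite cReM /= mul0r sub0r mulNr mulrC.
rewrite (_ : (fun t : R => _) = sin \o (fun t : R => a 0 j * t + dot a x)); last first.
  by apply/funext => t /=; rewrite E.
have dc : is_derive ((fun t : R => a 0 j * t + dot a x) 0) 1 sin (cos (dot a x)).
  by rewrite e0; exact: is_derive_sin.
apply: is_derive_eq (@is_derive1_comp R sin (fun t : R => a 0 j * t + dot a x) 0 _ _ dc dl) _.
by rewrite cImM /= mul0r add0r mulrC.
Qed.

Lemma ccontinuous_cexpi (a : Rd) : ccontinuous (fun x => cexpi (dot a x)).
Proof.
split => x.
  exact: (continuous_comp (@continuous_dot a x) (@continuous_cos R _)).
exact: (continuous_comp (@continuous_dot a x) (@continuous_sin R _)).
Qed.

Lemma smooth_cexpi (a : Rd) : smooth (fun x : Rd => cexpi (dot a x)).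
Proof.
apply: (@smooth_coind _ _ [set f | exists c, f = fun x : Rd => c * cexpi (dot a x)]).
- move=> _ [c ->]; exact: ccontinuousM (ccontinuous_cst c) (ccontinuous_cexpi a).
- move=> _ [c ->] j; exists (fun x : Rd => c * (0 +i* a 0 j) * cexpi (dot a x)); first by eexists.
  move=> x; apply: cder_eq (cderM (cder_cst c x (delta_mx 0 j)) (cder_cexpi a x j)).
  by rewrite mul0r add0r mulrA.
- by exists 1; apply/funext => x; rewrite mul1r.
Qed.

End smooth_exp.

(** * Smooth quotients *)

Lemma near_cvg0 {R : realType} (T : topologicalType) (F : T -> R) (x : T) :
  (\forall y \near x, F y = 0) -> F y @[y --> x] --> (0 : R).
Proof.
move=> Fx; apply/cvgrPdist_lt => e e0; apply: filterS Fx => y ->.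
by rewrite subrr normr0.
Qed.

Section smooth_quot.
Context {R : realType} {d : nat}.
Local Notation C := R[i].
Local Notation Re := (@complex.Re R).
Local Notation Im := (@complex.Im R).
Local Notation Rd := 'rV[R]_d.
Implicit Types (f g : Rd -> C) (x : Rd).

(** The point x lies outside the closed support of f. Unlike f x = 0, this passes to the derivatives
    of f. *)
Definition near0 f x := \forall y \near x, f y = 0.

Lemma near0_partial f j x : near0 f x -> near0 (partial j f) x.
Proof.
move=> fx; have {}fx : \forall y \near x, near0 f y by apply: near_join.
apply: filterS fx => y fy; apply: partial_cder.
apply: (cder_near _ (cder_cst 0 y (delta_mx 0 j))).
by apply: filterS fy => z ->.
Qed.

Lemma near0_id f x : near0 f x -> f x = 0.
Proof. exact: nbhs_singleton. Qed.

Lemma cderVX (N : Rd -> R) (l : R) x v k : N x != 0 -> is_derive x v N l ->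
  cder (fun y => ((N y)^-1 ^+ k)%:C) x v (- k%:R * l * (N x)^-1 ^+ k.+1)%:C.
Proof.
move=> Nx0 dN; split; last exact: is_derive_cst.
rewrite (_ : _ \o _ = (fun y => (N y)^-1) ^+ k); last first.
  by apply/funext => y /=; rewrite exprfctE.
have dV : is_derive x v (fun y => (N y)^-1) (- (N x) ^- 2 *: l).
  by case: dN => dN <-; apply: DeriveDef; [exact: derivableV|exact: deriveV].
apply: is_derive_eq (is_deriveX k dV) _.
rewrite /GRing.scale /= -exprVn; case: k => [|k]; first by ring.
by rewrite /= !exprS expr0; ring.
Qed.

(** Apply [smooth_coind] to the quotients u / N^k for all k: the derivative is (N u' - k u N') /
    N^(k+1), and its numerator again vanishes near the zeros of N. Near such a zero the quotient is
    0 because u is. *)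
Lemma smooth_quot (t : Rd -> C) (N : Rd -> R) :
  smooth t -> smooth (fun x => (N x)%:C) ->
  (forall x, N x != 0 \/ near0 t x) -> smooth (fun x => t x * ((N x)^-1)%:C).
Proof.
move=> st sN tN.
apply: (@smooth_coind _ _ [set f | exists k t', [/\ smooth t', forall x, N x != 0 \/ near0 t' x
   & f = fun x => t' x * ((N x)^-1 ^+ k)%:C]]); last by exists 1%N, t.
  move=> _ [k [u [su uN ->]]].
  have cN : continuous N by have [] := smooth_continuous sN.
  have cu := smooth_continuous su.
  have key (pr : C -> R) : (forall a b, pr (a * b%:C) = pr a * b) -> pr 0 = 0 ->
      continuous (pr \o u) ->
      continuous (pr \o (fun x => u x * ((N x)^-1 ^+ k)%:C)).
    move=> prM pr0 cpr x; have [Nx|ux] := uN x.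
      rewrite /continuous_at (_ : _ \o _ = fun y => (pr \o u) y * (N y)^-1 ^+ k); last first.
        by apply/funext => y /=; rewrite prM.
      apply: (cvgM (cpr x)).
      have cV : (N y)^-1 @[y --> x] --> (N x)^-1 by exact: (cvgV Nx (cN x)).
      exact: (continuous_comp cV (@exprn_continuous _ k _)).
    have E y : u y = 0 -> (pr \o (fun x => u x * ((N x)^-1 ^+ k)%:C)) y = 0.
      by move=> uy; rewrite /= uy mul0r pr0.
    rewrite /continuous_at (E _ (near0_id ux)).
    exact: (near_cvg0 (filterS E ux)).
  split; apply: key.
  - by move=> a b; rewrite cReM /= mulr0 subr0.
  - by [].
  - by case: cu.
  - by move=> a b; rewrite cImM /= mulr0 add0r.
  - by [].
  - by case: cu.
move=> _ [k [u [su uN ->]]] j.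
pose u' := fun x => partial j u x * (N x)%:C - k%:R * (u x * partial j (fun x => (N x)%:C) x).
exists (fun x => u' x * ((N x)^-1 ^+ k.+1)%:C).
  exists k.+1, u'; split; last exact: erefl.
    apply: smoothB; first exact: smoothM (smooth_partial j su) sN.
    exact: smoothZ (smoothM su (smooth_partial j sN)).
  move=> x; have [Nx|ux] := uN x; [left; exact: Nx|right].
  have pux := near0_partial j ux.
  apply: filterS2 ux pux => y uy puy.
  by rewrite /u' uy puy !(mul0r, mulr0, subr0).
move=> x; have [Nx|ux] := uN x; last first.
  apply: cder_near (cder_eq _ (cder_cst 0 x _)).
    by apply: filterS ux => y -> /=; rewrite mul0r.
  have := near0_id (near0_partial j ux); have := near0_id ux.
  by rewrite /u' => -> ->; rewrite !(mul0r, mulr0, subr0).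
have [dN dI] := smooth_cder j x sN.
have dI0 : Im (partial j (fun x => (N x)%:C) x) = 0.
  have [_ <-] := dI; rewrite (_ : _ \o _ = cst 0)//; exact: derive_cst.
have EN : partial j (fun x => (N x)%:C) x = (Re (partial j (fun x => (N x)%:C) x))%:C.
  by apply: complexP.
have := cderM (smooth_cder j x su) (cderVX k Nx dN).
apply: cder_eq; rewrite /u' EN.
have -> : ((N x)^-1 ^+ k.+1)%:C = ((N x)^-1)%:C * ((N x)^-1 ^+ k)%:C :> C.
  by rewrite -rmorphM exprS.
rewrite exprS !rmorphM rmorphN /= rmorph_nat.
have NV : (N x)%:C * ((N x)^-1)%:C = 1 :> C by rewrite -rmorphM divff.
rewrite mulrBl [X in _ = X - _]mulrA -[X in _ = X * _ - _]mulrA NV mulr1.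
by ring.
Qed.

End smooth_quot.

(** * The flat functions q(1/t) exp(-1/t) *)

Section flat.
Context {R : realType}.
Implicit Types (q : {poly R}) (t : R).

(** The polynomial factor makes the class closed under differentiation; q = 1 is the classical flat
    function. *)
Definition flat q t : R := if 0 < t then q.[t^-1] * expR (- t^-1) else 0.

(** With s = 1/t one has ds/dt = - s^2, so q(s) exp(-s) has the t-derivative s^2 (q - q')(s)
    exp(-s). *)
Definition flat_deriv q : {poly R} := 'X^2 * (q - q^`()).

(** Coefficientwise from exp s >= s^i / i!, whence the factorials in the constant. *)
Lemma horner_expR_bounded q : exists2 M, 0 <= M & forall s, 0 < s -> `|q.[s]| * expR (- s) <= M.
Proof.
exists (\sum_(i < size q) `|q`_i| * i`!%:R).
  by apply: sumr_ge0 => i _; rewrite mulr_ge0.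
move=> s s0; rewrite horner_coef.
apply: (@le_trans _ _ ((\sum_(i < size q) `|q`_i| * s ^+ i) * expR (- s))).
  rewrite ler_wpM2r ?expR_ge0// (le_trans (ler_norm_sum _ _ _))// ler_sum// => i _.
  by rewrite normrM (ger0_norm (exprn_ge0 _ (ltW s0))).
rewrite mulr_suml ler_sum// => i _; rewrite -mulrA ler_wpM2l//.
rewrite expRN ler_pdivrMr ?expR_gt0//.
case: i => -[|i] /= _; first by rewrite fact0 mul1r expr0 -expR0 ler_expR ltW.
have := expR_ge1Dxn i (ltW s0).
move=> h; rewrite mulrC -ler_pdivrMr ?ltr0n ?fact_gt0//.
by apply: le_trans h; rewrite lerDr.
Qed.

(** The previous bound for X^2 q at s = 1/t. Quadratic decay makes the derivative at 0 exist and
    vanish. *)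
Lemma flat_bound q : exists2 M, 0 <= M & forall t, `|flat q t| <= M * t ^+ 2.
Proof.
have [M M0 hM] := horner_expR_bounded ('X^2 * q); exists M => // t; rewrite /flat.
case: ifPn => [t0|_]; last by rewrite normr0 mulr_ge0// sqr_ge0.
have ti : 0 < t^-1 by rewrite invr_gt0.
have := hM _ ti; rewrite hornerM hornerXn normrM (ger0_norm (sqr_ge0 _)) => h.
rewrite normrM (ger0_norm (expR_ge0 _)).
rewrite -ler_pdivrMr ?exprn_gt0// mulrC -exprVn mulrA.
exact: h.
Qed.

Lemma flat_is_derive q t : is_derive t 1 (flat q) (flat (flat_deriv q) t).
Proof.
have [t0|t0|->] := ltgtP t 0.
- apply: (near_eq_is_derive (f := (cst 0 : R -> R))); last first.
    by rewrite {1}/flat ifN ?ltNge ?(ltW t0)//; exact: is_derive_cst.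
  near=> s; rewrite /flat ifN//= -leNgt ltW//.
  by near: s; exact: lt_nbhsl.
- apply: (near_eq_is_derive (f := (fun s : R => q.[s^-1] * expR (- s^-1) : R))).
    by near=> s; rewrite /flat ifT//; near: s; exact: lt_nbhsr.
  rewrite /flat t0 /flat_deriv.
  have tn0 : t != 0 by rewrite gt_eqF.
  have dV : is_derive t 1 (fun s : R => s^-1) (- t ^- 2).
    by have := @is_deriveV R id t 1 1 tn0 (is_derive_id _ _); rewrite /GRing.scale /= mulr1.
  have dVN : is_derive t 1 (fun s : R => - s^-1) (t ^- 2).
    by have := is_deriveN dV; rewrite opprK.
  have dq := @is_derive1_comp R (horner q) (fun s => s^-1) t _ _ (is_derive_poly q _) dV.
  have de := @is_derive1_comp R expR (fun s => - s^-1) t _ _ (is_derive_expR _) dVN.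
  apply: is_derive_eq (is_deriveM dq de) _.
  rewrite !hornerE /= /GRing.scale /= !exprVn.
  by ring.
have [M M0 hM] := flat_bound q.
have f0 p : flat p 0 = 0 by rewrite /flat ltxx.
have key : h^-1 *: ((flat q \o shift 0) (h *: (1 : R)) - flat q 0) @[h --> 0^'] --> (0 : R).
  apply/cvgr0Pnorm_lt => e e0.
  near=> h.
  have hn0 : h != 0 by near: h; exact: nbhs_dnbhs_neq.
  rewrite f0 subr0 /= /shift /= addr0 (_ : h *: 1 = h); last exact: mulr1.
  rewrite /GRing.scale /= normrM normfV.
  rewrite mulrC ltr_pdivrMr ?normr_gt0//.
  apply: (le_lt_trans (hM h)); rewrite -real_normK ?num_real// expr2 mulrA ltr_pM2r ?normr_gt0//.
  apply: (@le_lt_trans _ _ ((M + 1) * `|h|)); first by rewrite ler_wpM2r// lerDl.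
  rewrite mulrC -ltr_pdivlMr ?ltr_wpDl//.
  near: h; apply: nbhs_dnbhs.
  apply/nbhs_ballP; exists (e / (M + 1)); first by rewrite /= divr_gt0// ltr_wpDl.
  by move=> z; rewrite /ball /= sub0r normrN.
split; first by apply/cvg_ex; exists 0.
by rewrite f0; exact/cvg_lim.
Unshelve. all: by end_near. Qed.

Lemma continuous_flat q : continuous (flat q).
Proof.
move=> t; apply/differentiable_continuous/derivable1_diffP.
by case: (flat_is_derive q t).
Qed.

Lemma smooth_flat d q (a b : R) (i : 'I_d) : smooth (fun x : 'rV[R]_d => (flat q (a * x 0 i + b))%:C).
Proof.
apply: (@smooth_coind _ _ [set f | exists p, f = fun x : 'rV[R]_d => (flat p (a * x 0 i + b))%:C]); last by exists q.
  move=> _ [p ->]; split; last exact: cst_continuous.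
  have cc : continuous (fun x : 'rV[R]_d => a * x 0 i + b).
    by have [c _] := smooth_continuous (smooth_coord a b i).
  move=> x; exact: (continuous_comp (cc x) (@continuous_flat p _)).
move=> _ [p ->] j; exists (fun x : 'rV[R]_d => (flat ((a *+ (i == j)) *: flat_deriv p) (a * x 0 i + b))%:C).
  by eexists.
move=> x; apply: cder_eq (@cder_comp_affine R d (flat p) (flat (flat_deriv p)) a b i j x (flat_is_derive p _)).
congr (_%:C).
by rewrite /flat; case: ifPn; rewrite ?mulr0// hornerZ mulrA.
Qed.

End flat.

(** * Test functions *)

Section bump.
Context {R : realType}.

Lemma flat1_ge0 (t : R) : 0 <= flat 1 t.
Proof. by rewrite /flat; case: ifP => // _; rewrite hornerC mul1r expR_ge0. Qed.

Lemma flat1_gt0 (t : R) : 0 < t -> 0 < flat 1 t.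
Proof. by move=> t0; rewrite /flat t0 hornerC mul1r expR_gt0. Qed.

Lemma flat1_eq0 (t : R) : t <= 0 -> flat 1 t = 0.
Proof. by move=> t0; rewrite /flat ltNge t0. Qed.

(** Never zero, since t or 1 - t is positive. This turns [step] into a smooth transition from 0 for
    t <= 0 to 1 for t >= 1. *)
Definition step_den (t : R) : R := flat 1 t + flat 1 (1 - t).

Lemma step_den_gt0 t : 0 < step_den t.
Proof.
rewrite /step_den; have [t0|t0] := ltP 0 t.
  by rewrite ltr_pwDl ?flat1_gt0 ?flat1_ge0.
by rewrite ltr_wpDl ?flat1_ge0// flat1_gt0//; lra.
Qed.

Definition step (t : R) : R := flat 1 t / step_den t.

Lemma step_ge0 t : 0 <= step t.
Proof. by rewrite divr_ge0 ?flat1_ge0// ltW// step_den_gt0. Qed.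

Lemma step_le1 t : step t <= 1.
Proof. by rewrite ler_pdivrMr ?step_den_gt0// mul1r lerDl flat1_ge0. Qed.

Lemma step1 t : 1 <= t -> step t = 1.
Proof.
move=> t1; have d0 := step_den_gt0 t; rewrite /step.
have -> : flat 1 t = step_den t by rewrite /step_den [X in _ + X]flat1_eq0 ?addr0//; lra.
by rewrite divff// gt_eqF.
Qed.

Lemma step0 t : t <= 0 -> step t = 0.
Proof. by move=> t0; rewrite /step flat1_eq0// mul0r. Qed.

Lemma smooth_step d (a b : R) (i : 'I_d) : smooth (fun x : 'rV[R]_d => (step (a * x 0 i + b))%:C).
Proof.
rewrite (_ : (fun _ => _) = fun x : 'rV[R]_d =>
    (flat 1 (a * x 0 i + b))%:C * ((step_den (a * x 0 i + b))^-1)%:C); last first.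
  by apply/funext => x; rewrite -rmorphM.
apply: (smooth_quot (N := fun x : 'rV[R]_d => step_den (a * x 0 i + b))).
- exact: smooth_flat.
- rewrite (_ : (fun _ => _) = fun x : 'rV[R]_d =>
      (flat 1 (a * x 0 i + b))%:C + (flat 1 (- a * x 0 i + (1 - b)))%:C).
    exact: smoothD (smooth_flat _ _ _ _) (smooth_flat _ _ _ _).
  apply/funext => x; rewrite -rmorphD /step_den; congr (_ + flat _ _)%:C; ring.
- by move=> x; left; rewrite gt_eqF// step_den_gt0.
Qed.

(** Equal to 1 on the box of half-side e about a, and to 0 off the box of half-side 2 e. *)
Definition bump d (a : 'rV[R]_d) (e : R) (x : 'rV[R]_d) : R :=
  \prod_i (step (2 - (x 0 i - a 0 i) / e) * step (2 + (x 0 i - a 0 i) / e)).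

Lemma bump_ge0 d (a : 'rV[R]_d) e x : 0 <= bump a e x.
Proof. by apply: prodr_ge0 => i _; rewrite mulr_ge0// step_ge0. Qed.

Lemma bump_le1 d (a : 'rV[R]_d) e x : bump a e x <= 1.
Proof.
by apply: prodr_ile1 => i; rewrite mulr_ge0 ?step_ge0//= mulr_ile1// ?step_ge0 ?step_le1.
Qed.

Lemma bump1 d (a : 'rV[R]_d) (e : R) (x : 'rV[R]_d) : 0 < e ->
  (forall i, `|x 0 i - a 0 i| <= e) -> bump a e x = 1.
Proof.
move=> e0 h; rewrite /bump big1// => i _; have := h i.
rewrite ler_norml => /andP[h1 h2].
rewrite !step1 ?mulr1//.
  have : (- e) / e <= (x 0 i - a 0 i) / e by rewrite ler_pM2r ?invr_gt0.
  by rewrite mulNr divff ?gt_eqF//; lra.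
have : (x 0 i - a 0 i) / e <= e / e by rewrite ler_pM2r ?invr_gt0.
by rewrite divff ?gt_eqF//; lra.
Qed.

Lemma bump0 d (a : 'rV[R]_d) (e : R) (x : 'rV[R]_d) i : 0 < e ->
  2 * e <= `|x 0 i - a 0 i| -> bump a e x = 0.
Proof.
move=> e0 h; rewrite /bump (bigD1 i)//=.
have [h1|h1] := lerP 0 (x 0 i - a 0 i).
  rewrite (@step0 (2 - _)) ?mul0r//.
  have : 2 * e / e <= (x 0 i - a 0 i) / e by rewrite ler_pM2r ?invr_gt0// -(ger0_norm h1).
  by rewrite mulfK ?gt_eqF//; lra.
rewrite (@step0 (2 + (x 0 i - a 0 i) / e)) ?mulr0 ?mul0r//.
have : 2 * e / e <= - (x 0 i - a 0 i) / e by rewrite ler_pM2r ?invr_gt0// -(ltr0_norm h1).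
by rewrite mulfK ?gt_eqF// mulNr; lra.
Qed.

Lemma smooth_bump d (a : 'rV[R]_d) e : smooth (fun x => (bump a e x)%:C).
Proof.
rewrite (_ : (fun _ => _) = fun x : 'rV[R]_d => \prod_i
    ((step ((- e^-1) * x 0 i + (2 + a 0 i / e)))%:C *
     (step (e^-1 * x 0 i + (2 - a 0 i / e)))%:C)).
  apply: smooth_prod => i; exact: smoothM (smooth_step _ _ _) (smooth_step _ _ _).
apply/funext => x; rewrite /bump rmorph_prod; apply: eq_bigr => i _.
by rewrite -rmorphM; congr (step _ * step _)%:C; ring.
Qed.

End bump.

(** * Test functions, cutoffs and localisation *)

Section test_functions.
Context {R : realType} {d : nat}.
Local Notation C := R[i].
Local Notation Re := (@complex.Re R).
Local Notation Im := (@complex.Im R).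
Local Notation Rd := 'rV[R]_d.
Implicit Types (f g phi : Rd -> C) (x : Rd) (K U : set Rd).

(* Test functions with the support conditions in a more usable form. *)
Definition tfn phi : Prop := smooth phi /\ exists r : R, forall x, phi x != 0 -> forall i, `|x 0 i| <= r.

Definition tfn_in U phi : Prop := tfn phi /\ forall x, ~ U x -> near0 phi x.

Lemma near0_closure phi x : ~ closure [set y | phi y != 0] x -> near0 phi x.
Proof.
move=> /existsNP[A /not_implyP[Ax /set0P/negP]]; rewrite negbK => /eqP A0.
apply: filterS Ax => y Ay; apply: contrapT => /eqP phiy.
by have : ([set y | phi y != 0] `&` A) y by []; rewrite A0.
Qed.

Lemma closure_near0 phi x : near0 phi x -> ~ closure [set y | phi y != 0] x.
Proof. by move=> phix /(_ _ phix)[y /= [+ yE]]; rewrite yE eqxx. Qed.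

Lemma coord_le_norm x i : `|x 0 i| <= `|x|.
Proof.
rewrite [leRHS]/Num.norm /= mx_normrE.
by apply/bigmax_geP; right => /=; exists (0, i).
Qed.

Lemma bounded_rV (A : set Rd) : compact A -> exists r : R, forall x, A x -> forall i, `|x 0 i| <= r.
Proof.
move=> /compact_bounded[M [_ hM]]; exists (M + 1) => x Ax i.
have /hM/(_ _ Ax) /= : M < M + 1 by rewrite ltrDl.
exact: le_trans (coord_le_norm x i).
Qed.

Lemma compact_box (r : R) (A : set Rd) : closed A ->
  (forall x, A x -> forall i, `|x 0 i| <= r) -> compact A.
Proof.
move=> cA hA; apply: bounded_closed_compact => //.
exists `|r|; split; first exact: num_real.
move=> M rM x Ax; suff : `|x| <= M by [].
rewrite [leLHS]/Num.norm /= mx_normrE.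
apply/bigmax_leP; split; first by rewrite (le_trans _ (ltW rM)).
move=> [i j] _ /=; rewrite (ord1 i) (le_trans (hA _ Ax j))// (le_trans (ler_norm _))//.
exact: ltW.
Qed.

Lemma near_gt_coord x i (r : R) : r < `|x 0 i| -> nbhs x [set y : Rd | r < `|y 0 i|].
Proof.
move=> rx; apply/nbhs_rVP; exists (`|x 0 i| - r); first by rewrite subr_gt0.
move=> y /(_ i) h; have := lerB_dist (x 0 i) (x 0 i - y 0 i).
by rewrite subKr /= [`|y 0 i - _|]distrC in h * => h'; lra.
Qed.

Lemma closure_box (r : R) (A : set Rd) : (forall x, A x -> forall i, `|x 0 i| <= r) ->
  forall x, closure A x -> forall i, `|x 0 i| <= r.
Proof.
move=> hA x cx i; rewrite leNgt; apply/negP => /near_gt_coord/cx[y [/hA/(_ i)]].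
by rewrite leNgt => /negP.
Qed.

Lemma test_functionP U phi : test_function U phi <-> tfn_in U phi.
Proof.
split=> [[sphi cphi phiU]|[[sphi [r hr]] phiU]].
  split; last by move=> x Ux; apply: near0_closure => /phiU.
  split; first exact: sphi.
  have [r hr] := bounded_rV cphi; exists r => x phix; apply: hr.
  exact: subset_closure.
split; first exact: sphi.
  apply: (@compact_box r); first exact: closed_closure.
  exact: closure_box.
by move=> x cx; apply: contrapT => /phiU/closure_near0.
Qed.

Lemma tfn_smooth phi : tfn phi -> smooth phi.
Proof. by case. Qed.

Lemma tfnM f phi : smooth f -> tfn phi -> tfn (fun x => f x * phi x).
Proof.
move=> sf [sphi [r hr]]; split; first exact: smoothM sf sphi.
by exists r => x; rewrite mulf_eq0 negb_or => /andP[_ /hr].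
Qed.

Lemma tfnD f g : tfn f -> tfn g -> tfn (fun x => f x + g x).
Proof.
move=> [sf [r hr]] [sg [s hs]]; split; first exact: smoothD sf sg.
exists (Num.max r s) => x fgx i; rewrite le_max; have [f0|/hr/(_ i) ->//] := eqVneq (f x) 0.
by move: fgx; rewrite f0 add0r => /hs/(_ i) ->; rewrite orbT.
Qed.

Lemma tfnZ (c : C) f : tfn f -> tfn (fun x => c * f x).
Proof. exact: tfnM (smooth_cst c). Qed.

Lemma tfn_partial phi j : tfn phi -> tfn (partial j phi).
Proof.
move=> [sphi [r hr]]; split; first exact: smooth_partial sphi.
exists r => x; apply: contraNP => /existsNP[i /negP]; rewrite -ltNge => /near_gt_coord xi.
apply/eqP/near0_id/near0_partial; apply: filterS xi => y yi.
by apply: contrapT => /eqP/hr/(_ i); rewrite leNgt yi.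
Qed.

Lemma tfn_bounded phi : tfn phi -> exists2 M, 0 <= M & forall x, cabs (phi x) <= M.
Proof.
move=> [sphi [r hr]]; have [cr ci] := smooth_continuous sphi.
pose K : set Rd := [set v | forall i, v ord0 i \in `[(- r), r]].
have cK : compact K.
  apply: (@rV_compact _ _ (fun=> `[(- r), r]%classic)) => _; exact: segment_compact.
have bd (F : Rd -> R) : continuous F -> exists2 M, 0 <= M & forall x, K x -> `|F x| <= M.
  move=> cF; have : compact (F @` K).
    by apply: continuous_compact => //; exact: continuous_subspaceT.
  move=> /compact_bounded[M [_ hM]]; exists (`|M| + 1); first by rewrite addr_ge0.
  move=> x Kx; apply: hM; last by exists x.
  by rewrite (le_lt_trans (ler_norm _))// ltrDl.
have [M1 M10 h1] := bd _ cr; have [M2 M20 h2] := bd _ ci.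
exists (M1 + M2); first exact: addr_ge0.
move=> x; have [->|phix] := eqVneq (phi x) 0; first by rewrite cabs0 addr_ge0.
have Kx : K x by move=> i /=; rewrite in_itv /= -ler_norml; exact: hr.
by rewrite (le_trans (cabs_le_ReIm _))// lerD//; [exact: h1|exact: h2].
Qed.

Lemma smooth_wgt : smooth (fun x : Rd => (wgt x)%:C).
Proof.
rewrite (_ : (fun _ => _) = fun x : Rd => \prod_i (1 + (1 * x 0 i + 0)%:C * (1 * x 0 i + 0)%:C)).
  apply: smooth_prod => i; apply: smoothD (smooth_cst 1) _.
  exact: smoothM (smooth_coord 1 0 i) (smooth_coord 1 0 i).
apply/funext => x; rewrite /wgt rmorph_prod; apply: eq_bigr => i _.
by rewrite mul1r addr0 -rmorphM -expr2 rmorphD.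
Qed.

(** The product of [wgt] and phi is again a test function, hence bounded. *)
Lemma tfn_le_wgtV phi : tfn phi -> exists2 M, 0 <= M & forall x, cabs (phi x) <= M / wgt x.
Proof.
move=> tphi; have [M M0 hM] := tfn_bounded (tfnM smooth_wgt tphi); exists M => // x.
rewrite ler_pdivlMr ?wgt_gt0//; have := hM x.
by rewrite cabsM cabsC gtr0_norm ?wgt_gt0// mulrC.
Qed.

Lemma smooth_cmeas f : smooth f -> cmeas f.
Proof. by move=> sf; exact/ccontinuous_cmeas/smooth_continuous. Qed.

Lemma wgtV_cintegrable (F : Rd -> C) (M : R) : cmeas F ->
  (forall x, cabs (F x) <= M / wgt x) -> cintegrable (@lebesgue_rV R d) F.
Proof.
move=> mF hM; have M0 : 0 <= M.
  by have := le_trans (cabs_ge0 _) (hM 0); rewrite pmulr_lge0// invr_gt0 wgt_gt0.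
apply: (le_cintegrable mF _ hM).
  by apply: measurable_funM => //; exact: measurable_wgtV.
under eq_integral do rewrite EFinM.
rewrite ge0_integralZl//.
- by rewrite lte_mul_pinfty//; exact: integral_wgtV.
- by apply/measurable_EFinP; exact: measurable_wgtV.
- by move=> x _; rewrite lee_fin wgtV_ge0.
Qed.

Lemma tfn_cintegrable phi : tfn phi -> cintegrable (@lebesgue_rV R d) phi.
Proof.
move=> tphi; have [M _ hM] := tfn_le_wgtV tphi.
exact: wgtV_cintegrable (smooth_cmeas (tfn_smooth tphi)) hM.
Qed.

Lemma tfn_bump (a : Rd) (e : R) : 0 < e -> tfn (fun x => (bump a e x)%:C).
Proof.
move=> e0; split; first exact: smooth_bump.
exists (\sum_i `|a 0 i| + 2 * e) => x bx i.
have : `|x 0 i - a 0 i| < 2 * e.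
  by rewrite ltNge; apply/negP => /(bump0 e0) b0; rewrite b0 eqxx in bx.
have : `|a 0 i| <= \sum_i `|a 0 i| by rewrite (bigD1 i)//= lerDl sumr_ge0.
by have := ler_normD (x 0 i - a 0 i) (a 0 i); rewrite subrK; lra.
Qed.

Lemma bump_near0 (a : Rd) (e : R) x i : 0 < e -> 2 * e < `|x 0 i - a 0 i| ->
  near0 (fun x => (bump a e x)%:C) x.
Proof.
move=> e0 h; apply/nbhs_rVP; exists (`|x 0 i - a 0 i| - 2 * e); first by rewrite subr_gt0.
move=> y /(_ i) yx; rewrite (@bump0 _ _ _ _ _ i)//.
have := ler_distD (y 0 i) (x 0 i) (a 0 i); rewrite distrC in yx; lra.
Qed.

(** The factor 3 leaves room for bumps: [bump x (e x)] is 1 on the covering box and is supported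
    within 2 e, hence inside V x. *)
Lemma box_cover K (V : Rd -> set Rd) : compact K -> (forall x, K x -> nbhs x (V x)) ->
  exists s : seq Rd, exists e : Rd -> R, [/\ forall x, 0 < e x, forall x, x \in s -> K x,
    forall x (y : Rd), x \in s -> (forall i, `|y 0 i - x 0 i| < 3 * e x) -> V x y &
    forall y : Rd, K y -> exists2 x, x \in s & forall i, `|y 0 i - x 0 i| < e x].
Proof.
move=> cK KV.
have /choice[e he] : forall x, exists e : R, 0 < e /\
    (K x -> forall y : Rd, (forall i, `|y 0 i - x 0 i| < 3 * e) -> V x y).
  move=> x; have [/KV/nbhs_rVP[e e0 he]|nK] := pselect (K x); last by exists 1; split.
  exists (e / 3); split; first by rewrite divr_gt0.
  by move=> _ y; rewrite mulrCA divff// mulr1; exact: he.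
move: (cK); rewrite compact_cover => /(_ _ K (fun x => [set y : Rd | forall i, `|y 0 i - x 0 i| < e x])).
case.
- move=> x _; rewrite openE => y /= hy; rewrite /interior.
  (* The distance to the nearest face; the initial value 1 of the minimum covers d = 0. *)
  have [f0 hf] : exists2 f : R, 0 < f & forall i, f <= e x - `|y 0 i - x 0 i|.
    exists (\big[Num.min/1]_i (e x - `|y 0 i - x 0 i|)).
      by elim/big_ind : _ => // [u w|i _]; [rewrite lt_min => -> ->|rewrite subr_gt0].
    by move=> i; rewrite (bigD1 i)//= ge_min lexx.
  move=> hf'; apply/nbhs_rVP; exists f0 => // z hz i.
  have := ler_distD (y 0 i) (z 0 i) (x 0 i); have := hf' i; have := hz i; lra.
- move=> x Kx; exists x => // i; rewrite subrr normr0.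
  by have [] := he x.
move=> D DK KD; exists (finmap.enum_fset D), e; split.
- by move=> x; have [] := he x.
- by move=> x xD; have := DK _ xD; rewrite inE.
- move=> x y xD; have [_] := he x; apply.
  by have := DK _ xD; rewrite inE.
- by move=> y /KD[x xD hx]; exists x.
Qed.

(** Take chi = 1 - prod (1 - bump): it is 1 where one of the bumps is 1 and 0 where all of them
    vanish, so no division is involved. *)
Lemma smooth_urysohn K U : compact K -> open U -> K `<=` U ->
  exists chi : Rd -> R, [/\ tfn_in U (fun x => (chi x)%:C), forall x, 0 <= chi x <= 1 &
    forall x, K x -> \forall y \near x, chi y = 1].
Proof.
move=> cK oU KU.
have [|s [e [e0 _ sU Ks]]] := @box_cover K (fun=> U) cK.
  by move=> x /KU Ux; move: oU; rewrite openE => /(_ _ Ux).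
pose q x : R := \prod_(a <- s) (1 - bump a (e a) x).
have q01 x : 0 <= q x <= 1.
  rewrite /q; elim/big_rec : _ => [|a y _ /andP[y0 y1]]; first by rewrite ler01 lexx.
  have b0 := bump_ge0 a (e a) x; have b1 := bump_le1 a (e a) x.
  by rewrite mulr_ge0 ?subr_ge0//= mulr_ile1// ?subr_ge0// gerBl.
have qn x a : a \in s -> bump a (e a) x = 1 -> q x = 0.
  move=> as_ ba; rewrite /q (big_rem a)//= ba subrr mul0r//.
exists (fun x => 1 - q x); split.
- split.
    split.
      rewrite (_ : (fun _ => _) = fun x : Rd => 1 - \prod_(a <- s) (1 - (bump a (e a) x)%:C)).
        apply: smoothB (smooth_cst 1) _; apply: smooth_prod => a.
        exact: smoothB (smooth_cst 1) (smooth_bump a (e a)).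
      apply/funext => x; rewrite rmorphB rmorph1; congr (_ - _).
      by rewrite /q rmorph_prod; apply: eq_bigr => a _; rewrite rmorphB rmorph1.
    have : forall a, exists r, forall x, bump a (e a) x != 0 -> forall i, `|x 0 i| <= r.
      move=> a; have [_ [r hr]] := tfn_bump a (e0 a); exists r => x bx; apply: hr.
      by apply: contra bx => /eqP[->].
    move=> /choice[r hr].
    exists (\sum_(a <- s) `|r a|) => x qx i.
    have [a as_ ba] : exists2 a, a \in s & bump a (e a) x != 0.
      apply: contrapT => h; move/negP : qx; apply; apply/eqP.
      rewrite /q big_seq big1 ?subrr// => a as_.
      suff -> : bump a (e a) x = 0 by rewrite subr0.
      by apply: contrapT => /eqP ba; apply: h; exists a.
    rewrite (le_trans (hr a x ba i))// (le_trans (ler_norm _))//.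
    by rewrite (big_rem a)//= lerDl sumr_ge0.
  move=> x Ux.
  have : \forall y \near x, forall a, a \in s -> bump a (e a) y = 0.
    have h a : a \in s -> near0 (fun x => (bump a (e a) x)%:C) x.
      move=> as_; apply: contrapT => nb; apply: Ux; apply: (sU a) => // i.
      rewrite ltNge; apply/negP => h; apply: nb; apply: (@bump_near0 _ _ _ i) => //.
      by apply: lt_le_trans h; rewrite ltr_pM2r ?e0// ltr_nat.
    move: h; elim: s {sU Ks q q01 qn} => [_|a s IH h]; first by apply: (@filterS _ (nbhs x) _ setT); [move=> y _ a; rewrite in_nil|exact: filterT].
    have h1 := h a (mem_head _ _).
    have h2 : \forall y \near x, forall a, a \in s -> bump a (e a) y = 0.
      by apply: IH => b bs; apply: h; rewrite inE bs orbT.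
    apply: filterS2 h1 h2 => y [b1] b2 b; rewrite inE => /predU1P[->//|]; exact: b2.
  apply: filterS => y hy; rewrite /q big_seq big1 ?subrr// => a /hy ->.
  by rewrite subr0.
- by move=> x; have /andP[h1 h2] := q01 x; rewrite subr_ge0 h2 gerBl h1.
- move=> x Kx; have [a as_ ha] := Ks _ Kx.
  suff : nbhs x [set y : Rd | forall i, `|y 0 i - a 0 i| <= e a].
    by apply: filterS => y hy; rewrite (qn y a) ?subr0//; exact: bump1.
  have [f0 ff hf] : exists2 f : R, 0 < f & forall i, f <= e a - `|x 0 i - a 0 i|.
    exists (\big[Num.min/1]_i (e a - `|x 0 i - a 0 i|)).
      by elim/big_ind : _ => // [u w|i _]; [rewrite lt_min => -> ->|rewrite subr_gt0].
    by move=> i; rewrite (bigD1 i)//= ge_min lexx.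
  apply/nbhs_rVP; exists f0 => // y hy i.
  have := ler_distD (x 0 i) (y 0 i) (a 0 i); have := hf i; have := hy i; lra.
Qed.

(** The usual localisation of distributions, without a partition of unity: removing the bumps of a
    finite cover one at a time does not change the value of T, and nothing is left at the end. *)
Lemma vanish_cover (T : (Rd -> C) -> C) phi :
  (forall f g, tfn f -> tfn g -> T (fun x => f x + g x) = T f + T g) ->
  tfn phi ->
  (forall x, near0 phi x \/ exists2 U, nbhs x U & forall f, tfn_in U f -> T f = 0) ->
  T phi = 0.
Proof.
move=> TD tphi hU.
have T0 : T (fun=> 0) = 0.
  have t0 : tfn (fun=> 0 : C) by split; [exact: smooth_cst|exists 0 => x; rewrite eqxx].
  have := TD _ _ t0 t0; under eq_fun do rewrite addr0.
  by move/eqP; rewrite -subr_eq subrr => /eqP.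
pose S := closure [set x | phi x != 0].
have cS : compact S.
  by have [_ cS _] := (test_functionP setT phi).2 (conj tphi (fun x n => False_ind _ (n I))).
have /choice[V hV] : forall x, exists U, S x -> nbhs x U /\ forall f, tfn_in U f -> T f = 0.
  move=> x; have [phix|[U xU UT]] := hU x; last by exists U.
  by exists setT => /(closure_near0 phix).
have [|s [e [e0 sS sV Ss]]] := @box_cover S V cS; first by move=> x /hV[].
(* Multiplication by 1 - bump subtracts a function supported where T vanishes. *)
have key (l : seq Rd) psi : {subset l <= s} -> tfn psi ->
    T psi = T (fun x => (\prod_(a <- l) (1 - bump a (e a) x))%:C * psi x).
  elim: l psi => [|a l IH] psi ls tpsi.
    by congr T; apply/funext => x; rewrite big_nil mul1r.
  have as_ : a \in s by apply: ls; rewrite mem_head.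
  have sb := smooth_bump a (e a).
  have t1 : tfn (fun x => (bump a (e a) x)%:C * psi x) by exact: tfnM.
  have t2 : tfn (fun x => (1 - (bump a (e a) x)%:C) * psi x).
    by apply: tfnM tpsi; exact: smoothB (smooth_cst 1) sb.
  have -> : psi = fun x => (bump a (e a) x)%:C * psi x + (1 - (bump a (e a) x)%:C) * psi x.
    by apply/funext => x; rewrite -mulrDl addrC subrK mul1r.
  rewrite (TD _ _ t1 t2) (_ : T _ = 0) ?add0r; last first.
    have [_] := hV _ (sS _ as_); apply; split; first exact: t1.
    move=> x Vx; have [i hi] : exists i, 3 * e a <= `|x 0 i - a 0 i|.
      apply: contrapT => h; apply: Vx; apply: (sV a) => // i.
      by rewrite ltNge; apply/negP => h'; apply: h; exists i.
    have : near0 (fun x => (bump a (e a) x)%:C) x.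
      apply: (@bump_near0 _ _ _ i) => //; apply: lt_le_trans hi.
      by rewrite ltr_pM2r ?e0// ltr_nat.
    by apply: filterS => y ->; rewrite mul0r.
  rewrite (IH _ _ t2); last by move=> b bl; apply: ls; rewrite inE bl orbT.
  congr T; apply/funext => x; rewrite big_cons.
  have -> : (bump a (e a) x)%:C * psi x + (1 - (bump a (e a) x)%:C) * psi x = psi x.
    by rewrite -mulrDl addrC subrK mul1r.
  by rewrite mulrA rmorphM rmorphB rmorph1 [X in X * _]mulrC.
(* At a point of the support of phi some bump equals 1, so the full product is 0. *)
rewrite (key s) => [|//|//]; rewrite -[RHS]T0; congr T; apply/funext => x.
have [->|phix] := eqVneq (phi x) 0; first by rewrite mulr0.
have [a as_ ha] : exists2 a, a \in s & forall i, `|x 0 i - a 0 i| < e a.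
  by apply: Ss; exact: subset_closure.
by rewrite (big_rem a)//= bump1 ?subrr ?mul0r// => i; exact: ltW.
Qed.

End test_functions.

(** * Remainder estimates and Peetre's inequality *)

Section real_estimates.
Context {R : realType}.

Lemma mvt_le (f df : R -> R) (M a b : R) : (forall x : R, is_derive x 1 f (df x)) ->
  (forall c, `|c - a| <= `|b - a| -> `|df c| <= M) -> `|f b - f a| <= M * `|b - a|.
Proof.
move=> fd dfM.
have cf x y : {within `[x, y], continuous f}.
  by apply: derivable_within_continuous => z _; exact: ex_derive.
have [ab|ba|->] := ltgtP a b; last by rewrite !subrr normr0 mulr0.
  have [c] := MVT ab (fun x _ => fd x) (cf _ _).
  rewrite in_itv /= => /andP[ac cb] ->; rewrite normrM ler_wpM2r//.
  by apply: dfM; rewrite !gtr0_norm ?subr_gt0// lerB// ltW.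
have [c] := MVT ba (fun x _ => fd x) (cf _ _).
rewrite in_itv /= => /andP[bc ca] E; rewrite distrC E normrM [`|a - b|]distrC ler_wpM2r//.
apply: dfM; rewrite !ltr0_norm ?subr_lt0//; lra.
Qed.

Lemma sin_le (a : R) : `|sin a| <= `|a|.
Proof.
have := @mvt_le sin cos 1 0 a (fun x => is_derive_sin x) (fun c _ => _).
rewrite sin0 !subr0 mul1r; apply => c.
by rewrite ler_norml cos_geN1 cos_le1.
Qed.

Lemma cosB1_le (a : R) : `|cos a - 1| <= a ^+ 2.
Proof.
have := @mvt_le cos (fun x => - sin x) `|a| 0 a (fun x => is_derive_cos x).
rewrite cos0 !subr0 -normrM -expr2 (ger0_norm (sqr_ge0 a)); apply => c.
by rewrite !subr0 normrN; exact: le_trans (sin_le c).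
Qed.

Lemma sinB_le (a : R) : `|sin a - a| <= 2 * a ^+ 2.
Proof.
(* For |a| > 1 the triangle inequality gives 2 |a| <= 2 a^2; otherwise the mean value theorem gives
   |a|^3. *)
have [a1|a1] := lerP `|a| 1; last first.
  apply: (le_trans (ler_normB _ _)); have := sin_le a.
  by rewrite -[a ^+ 2]real_normK ?num_real//; nra.
have dg (x : R) : is_derive x 1 (fun t : R => sin t - t) (cos x - 1).
  exact: (is_deriveB (is_derive_sin x) (is_derive_id x 1)).
have := @mvt_le (fun t : R => sin t - t) (fun x => cos x - 1) (`|a| ^+ 2) 0 a dg.
rewrite sin0 !subr0 => h; apply: (le_trans (h _)) => [c|].
  rewrite !subr0 => ca; apply: (le_trans (cosB1_le c)).
  by rewrite -[c ^+ 2]real_normK ?num_real// lerXn2r// nnegrE.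
rewrite -[a ^+ 2]real_normK ?num_real//.
have := normr_ge0 a; nra.
Qed.

(** The second-order remainder of exp(i a), with a crude constant; it controls derivatives under the
    integral sign. *)
Lemma cexpi_quad (a : R) : cabs (cexpi a - 1 - (0 +i* a)) <= 3 * a ^+ 2.
Proof.
apply: (le_trans (cabs_le_ReIm _)).
rewrite !(cReD, cImD, cReN, cImN) /= !oppr0 !addr0.
have := cosB1_le a; have := sinB_le a; lra.
Qed.

Lemma cexpi_lip (a b : R) : cabs (cexpi a - cexpi b) <= 2 * `|a - b|.
Proof.
apply: (le_trans (cabs_le_ReIm _)); rewrite !(cReD, cImD, cReN, cImN) /=.
rewrite mulr_natl mulr2n lerD//.
  have := @mvt_le cos (fun x => - sin x) 1 b a (fun x => is_derive_cos x).
  by rewrite mul1r; apply => c _; rewrite normrN ler_norml sin_geN1 sin_le1.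
have := @mvt_le sin cos 1 b a (fun x => is_derive_sin x).
by rewrite mul1r; apply => c _; rewrite ler_norml cos_geN1 cos_le1.
Qed.

(** The difference quotient is within K |h| of l. Integrating a pointwise remainder estimate yields
    exactly such a bound, which avoids interchanging limits. *)
Lemma is_derive_quad (d : nat) (F : 'rV[R]_d -> R) x v (l K : R) : 0 <= K ->
  (forall h : R, `|F (x + h *: v) - F x - h * l| <= K * h ^+ 2) -> is_derive x v F l.
Proof.
move=> K0 hF.
have key : h^-1 *: ((F \o shift x) (h *: v) - F x) @[h --> 0^'] --> (l : R).
  apply/cvgrPdist_lt => e e0; near=> h.
  have hn0 : h != 0 by near: h; exact: nbhs_dnbhs_neq.
  rewrite /= [_ + x]addrC.
  have -> : l - h^-1 *: (F (x + h *: v) - F x) = - (h^-1 * (F (x + h *: v) - F x - h * l)).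
    by rewrite mulrBr mulrA mulVf// mul1r opprB.
  rewrite normrN normrM normfV mulrC ltr_pdivrMr ?normr_gt0//.
  apply: (le_lt_trans (hF h)); rewrite -real_normK ?num_real// expr2 mulrA ltr_pM2r ?normr_gt0//.
  apply: (@le_lt_trans _ _ ((K + 1) * `|h|)); first by rewrite ler_wpM2r// lerDl.
  rewrite mulrC -ltr_pdivlMr ?ltr_wpDl//.
  near: h; apply: nbhs_dnbhs.
  apply/nbhs_ballP; exists (e / (K + 1)); first by rewrite /= divr_gt0// ltr_wpDl.
  by move=> z; rewrite /ball /= sub0r normrN.
split; first by apply/cvg_ex; exists l.
exact/cvg_lim.
Unshelve. all: by end_near. Qed.

Lemma cder_quad (d : nat) (f : 'rV[R]_d -> R[i]) x v (l : R[i]) (K : R) : 0 <= K ->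
  (forall h : R, cabs (f (x + h *: v) - f x - h%:C * l) <= K * h ^+ 2) -> cder f x v l.
Proof.
move=> K0 hf; split; apply: (@is_derive_quad _ _ _ _ _ K) => // h.
  by apply: le_trans (hf h); apply: le_trans (cabs_Re _); rewrite !(cReD, cReN, cReM) /= mul0r subr0.
by apply: le_trans (hf h); apply: le_trans (cabs_Im _); rewrite !(cImD, cImN, cImM) /= mul0r addr0.
Qed.

(** Peetre's inequality, from 1 + a^2 <= 2 (1 + b^2) (1 + (a - b)^2) in each coordinate. It compares
    the weights of translated points. *)
Lemma wgt_peetre d (x y : 'rV[R]_d) : wgt x <= 2 ^+ d * wgt y * wgt (x - y).
Proof.
have -> : 2 ^+ d * wgt y * wgt (x - y) =
    \prod_i (2 * (1 + y 0 i ^+ 2) * (1 + (x - y) 0 i ^+ 2)).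
  by rewrite /wgt !big_split /= prodr_const card_ord.
rewrite /wgt ler_prod// => i _; rewrite addr_ge0 ?sqr_ge0//= !mxE.
move: (x 0 i) (y 0 i) => a b.
by have := sqr_ge0 (b - (a - b)); have := sqr_ge0 (b * (a - b)); nra.
Qed.

Lemma wgt_delta_le d (j : 'I_d) (t : R) : `|t| <= 1 -> wgt (t *: delta_mx 0 j : 'rV[R]_d) <= 2.
Proof.
move=> t1; rewrite /wgt (bigD1 j)//= big1 ?mulr1 => [|i ij].
  rewrite !mxE !eqxx mulr1 -real_normK ?num_real//.
  by have := normr_ge0 t; nra.
by rewrite !mxE (negbTE ij) andbF mulr0 expr0n addr0.
Qed.

End real_estimates.

Section taylor.
Context {R : realType} {d : nat}.
Local Notation C := R[i].
Local Notation Re := (@complex.Re R).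
Local Notation Im := (@complex.Im R).
Local Notation Rd := 'rV[R]_d.
Implicit Types (phi : Rd -> C).

Lemma real_taylor (g g' g'' : R -> R) (M t : R) :
  (forall s : R, is_derive s 1 g (g' s)) -> (forall s : R, is_derive s 1 g' (g'' s)) ->
  (forall s, `|s| <= `|t| -> `|g'' s| <= M) ->
  `|g t - g 0 - t * g' 0| <= M * t ^+ 2.
Proof.
move=> dg dg' hM.
have dh (s : R) : is_derive s 1 (fun s : R => g s - s * g' 0) (g' s - g' 0).
  have dl : is_derive s 1 (fun s : R => s * g' 0) (g' 0).
    by apply: is_derive_eq; rewrite /GRing.scale /= mulr1 mulr0 add0r.
  exact: (is_deriveB (dg s) dl).
have := @mvt_le _ _ _ (M * `|t|) 0 t dh.
move=> h; have -> : g t - g 0 - t * g' 0 = g t - t * g' 0 - (g 0 - 0 * g' 0) by ring.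
rewrite -[t ^+ 2]real_normK ?num_real// expr2 mulrA.
apply: (le_trans (h _)); last by rewrite subr0.
move=> s; rewrite !subr0 => st.
have := @mvt_le _ _ _ M 0 s dg'; rewrite subr0 => h'.
apply: (le_trans (h' _)) => [u|]; first by rewrite !subr0 => us; apply: hM; exact: le_trans us st.
have M0 : 0 <= M by apply: le_trans (normr_ge0 _) (hM 0 _); rewrite normr0.
by rewrite ler_wpM2l.
Qed.

(** The second derivative decays like 1 / wgt at the intermediate point; for |t| <= 1 Peetre's
    inequality moves this decay to x, which makes the remainder integrable in x. *)
Lemma tfn_taylor phi j : tfn phi -> exists2 K, 0 <= K & forall x t, `|t| <= 1 ->
  cabs (phi (x + t *: delta_mx 0 j) - phi x - t%:C * partial j phi x) <= K * t ^+ 2 / wgt x.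
Proof.
move=> tphi; have tp := tfn_partial j tphi; have tpp := tfn_partial j tp.
have [M M0 hM] := tfn_le_wgtV tpp.
(* 2^d comes from [wgt_peetre] and 2 from [wgt_delta_le]. *)
pose N := M * 2 ^+ d * 2.
have N0 : 0 <= N by rewrite !mulr_ge0// exprn_ge0.
have bd x (s : R) : `|s| <= 1 -> cabs (partial j (partial j phi) (x + s *: delta_mx 0 j)) <= N / wgt x.
  move=> s1; apply: (le_trans (hM _)).
  rewrite ler_pdivrMr ?wgt_gt0// mulrAC ler_pdivlMr ?wgt_gt0// /N -!mulrA ler_wpM2l//.
  have := wgt_peetre x (x + s *: delta_mx 0 j).
  rewrite opprD addrA subrr sub0r -scaleNr => /le_trans; apply.
  rewrite -mulrA ler_wpM2l ?exprn_ge0// mulrC ler_wpM2r ?(ltW (wgt_gt0 _))//.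
  by apply: wgt_delta_le; rewrite normrN.
have key (pr : C -> R) x t : (forall z, `|pr z| <= cabs z) ->
    (forall (f : Rd -> C) y v l, cder f y v l -> is_derive y v (pr \o f) (pr l)) -> `|t| <= 1 ->
    `|pr (phi (x + t *: delta_mx 0 j)) - pr (phi x) - t * pr (partial j phi x)| <= N / wgt x * t ^+ 2.
  move=> prle prd t1.
  have l1 (s : R) := line_is_derive (prd _ _ _ _ (smooth_cder j (x + s *: delta_mx 0 j) (tfn_smooth tphi))).
  have l2 (s : R) := line_is_derive (prd _ _ _ _ (smooth_cder j (x + s *: delta_mx 0 j) (tfn_smooth tp))).
  have := @real_taylor _ _ _ (N / wgt x) t l1 l2; rewrite /= scale0r addr0; apply.
  by move=> s st; apply: (le_trans (prle _)); apply: bd; exact: le_trans st t1.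
exists (N + N); first exact: addr_ge0.
move=> x t t1; apply: (le_trans (cabs_le_ReIm _)).
have -> : (N + N) * t ^+ 2 / wgt x = N / wgt x * t ^+ 2 + N / wgt x * t ^+ 2 by ring.
rewrite lerD//.
  have := key Re x t (@cabs_Re R) (fun f y v l => @proj1 _ _) t1.
  by rewrite !(cReD, cReN, cReM) /= mul0r subr0.
have := key Im x t (@cabs_Im R) (fun f y v l => @proj2 _ _) t1.
by rewrite !(cImD, cImN, cImM) /= mul0r addr0.
Qed.

End taylor.

(** * Fourier transforms of test functions *)

Lemma continuous_at_dist {R : realType} (T : topologicalType) (F : T -> R) (x : T) :
  (forall e : R, 0 < e -> nbhs x [set y | `|F x - F y| < e]) -> continuous_at x F.
Proof. by move=> h; apply/cvgrPdist_lt => e e0; exact: h. Qed.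

Section fourier_tfn.
Context {R : realType} {d : nat}.
Local Notation C := R[i].
Local Notation Re := (@complex.Re R).
Local Notation Im := (@complex.Im R).
Local Notation Rd := 'rV[R]_d.
Local Notation mu := (@lebesgue_rV R d).
Implicit Types (f g phi psi : Rd -> C) (x lam : Rd).

Definition wgtV_mass : R := fine (\int[mu]_x ((wgt x)^-1)%:E).
Local Notation W := wgtV_mass.

Lemma wgtV_mass_ge0 : 0 <= W.
Proof. by apply: fine_ge0; apply: integral_ge0 => x _; rewrite lee_fin wgtV_ge0. Qed.

Lemma wgtV_massE : (\int[mu]_x ((wgt x)^-1)%:E = W%:E)%E.
Proof.
rewrite /wgtV_mass fineK// ge0_fin_numE; first exact: integral_wgtV.
by apply: integral_ge0 => x _; rewrite lee_fin wgtV_ge0.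
Qed.

Lemma wgtV_bound_ge0 f (M : R) : (forall x, cabs (f x) <= M / wgt x) -> 0 <= M.
Proof.
move=> hM; have := le_trans (cabs_ge0 _) (hM 0).
by rewrite pmulr_lge0// invr_gt0 wgt_gt0.
Qed.

Lemma int_cabs_wgt_le f (M : R) : cmeas f -> (forall x, cabs (f x) <= M / wgt x) ->
  (\int[mu]_x (cabs (f x))%:E <= (M * W)%:E)%E.
Proof.
move=> mf hM; have M0 := wgtV_bound_ge0 hM.
rewrite EFinM -wgtV_massE -ge0_integralZl//.
- apply: ge0_le_integral => //.
  + by move=> x _; exact: cabs_gee0.
  + exact: measurable_cabsE.
  + apply/measurable_EFinP; apply: measurable_funM => //; exact: measurable_wgtV.
  + by move=> x _; rewrite lee_fin.
- by apply/measurable_EFinP; exact: measurable_wgtV.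
- by move=> x _; rewrite lee_fin wgtV_ge0.
Qed.

Lemma cint_wgt_le f (M : R) : cmeas f -> (forall x, cabs (f x) <= M / wgt x) ->
  cabs (cint mu f) <= 2 * (M * W).
Proof.
move=> mf hM; rewrite -lee_fin (le_trans (le_cabs_cint (wgtV_cintegrable mf hM)))//.
by rewrite EFinM lee_wpmul2l ?lee_fin//; exact: int_cabs_wgt_le.
Qed.

Definition fourier_cst : C := ((2 * pi) `^ (- (d%:R / 2)))%:C.
Local Notation kap := fourier_cst.

Definition ekern lam x : C := cexpi (- dot lam x).

Lemma fourierE f lam : fourier f lam = kap * cint mu (fun x => f x * ekern lam x).
Proof. by []. Qed.

Lemma smooth_ekern lam : smooth (ekern lam).
Proof.
rewrite (_ : ekern lam = fun x => cexpi (dot (- lam) x)); first exact: smooth_cexpi.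
by apply/funext => x; rewrite /ekern dotC [in RHS]dotC dotNr.
Qed.

Lemma cabs_ekern lam x : cabs (ekern lam x) = 1.
Proof. exact: cabs_cexpi. Qed.

Lemma ekernDr lam x y : ekern lam (x + y) = ekern lam x * ekern lam y.
Proof. by rewrite /ekern dotDr opprD cexpiD. Qed.

Lemma ekernC lam x : ekern lam x = ekern x lam.
Proof. by rewrite /ekern dotC. Qed.

Lemma ekernDl lam y x : ekern (lam + y) x = ekern lam x * ekern y x.
Proof. by rewrite ekernC ekernDr !(ekernC x). Qed.

Lemma cintegrable_ekern f lam : cintegrable mu f -> cintegrable mu (fun x => f x * ekern lam x).
Proof.
move=> iF; rewrite (_ : (fun x => _) = (fun x => ekern lam x * f x)); last first.
  by apply/funext => x; rewrite mulrC.
apply: (cintegrable_bounded (M := 1) iF); first exact: smooth_cmeas (smooth_ekern lam).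
by move=> x; rewrite cabs_ekern.
Qed.

Lemma fourierD f g lam : cintegrable mu f -> cintegrable mu g ->
  fourier (fun x => f x + g x) lam = fourier f lam + fourier g lam.
Proof.
move=> iF iG; rewrite !fourierE -mulrDr -cintD; [|exact: cintegrable_ekern..].
by congr (_ * _); apply: eq_cint => x; rewrite mulrDl.
Qed.

Lemma fourierZ (c : C) f lam : cintegrable mu f ->
  fourier (fun x => c * f x) lam = c * fourier f lam.
Proof.
move=> iF; rewrite !fourierE mulrCA -[X in _ = _ * X]cintZ; last exact: cintegrable_ekern.
by congr (_ * _); apply: eq_cint => x; rewrite mulrA.
Qed.

Lemma fourier_sum I (r : seq I) (F : I -> Rd -> C) lam : (forall i, cintegrable mu (F i)) ->
  fourier (fun x => \sum_(i <- r) F i x) lam = \sum_(i <- r) fourier (F i) lam /\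
  cintegrable mu (fun x => \sum_(i <- r) F i x).
Proof.
move=> iF; elim: r => [|i r [IH1 IH2]].
  rewrite big_nil; under eq_fun do rewrite big_nil; split.
    rewrite fourierE (@eq_cint _ _ _ _ _ (fun=> 0)) ?cint0 ?mulr0// => x.
    by rewrite mul0r.
  split; first exact: cmeas_cst.
  by under eq_integral do rewrite cabs0; rewrite integral0.
rewrite big_cons -IH1; under eq_fun do rewrite big_cons; split.
  by rewrite fourierD.
exact: cintegrableD.
Qed.

Lemma fourier_le f lam (M : R) : cmeas f -> (forall x, cabs (f x) <= M / wgt x) ->
  cabs (fourier f lam) <= cabs kap * (2 * (M * W)).
Proof.
move=> mf hM; rewrite fourierE cabsM ler_wpM2l ?cabs_ge0//; apply: cint_wgt_le.
  by apply: cmeasM => //; exact: smooth_cmeas (smooth_ekern lam).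
by move=> x; rewrite cabsM cabs_ekern mulr1.
Qed.

Lemma linear_small0 (z : C) (K : R) :
  (forall t : R, 0 < t -> t <= 1 -> cabs (t%:C * z) <= K * t ^+ 2) -> z = 0.
Proof.
move=> h; apply: cabs0_eq0; apply/eqP; rewrite eq_le cabs_ge0 andbT.
have K0 : 0 <= K by have := le_trans (cabs_ge0 _) (h 1 ltr01 (lexx 1)); rewrite expr1n mulr1.
apply/ler_addgt0Pr => e e0; rewrite add0r.
pose t := Num.min 1 (e / (K + 1)).
have t0 : 0 < t by rewrite lt_min ltr01/= divr_gt0// ltr_wpDl.
have t1 : t <= 1 by rewrite ge_min lexx.
have := h t t0 t1; rewrite cabsM cabsC gtr0_norm// expr2 mulrA mulrC ler_pM2r// => /le_trans; apply.
have : t <= e / (K + 1) by rewrite ge_min lexx orbT.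
rewrite ler_pdivlMr ?ltr_wpDl// => te; apply: le_trans te.
by rewrite mulrC ler_wpM2l ?ltW// ltrDl.
Qed.

(** Translation invariance replaces integration by parts: integrating phi(x + t e_j) - phi(x)
    against the kernel gives (exp(i t lam_j) - 1) times the integral of phi against it. Both sides
    are linear in t up to O(t^2), so the linear terms agree. *)
Lemma fourier_partial phi j lam : tfn phi ->
  fourier (partial j phi) lam = (0 +i* lam 0 j) * fourier phi lam.
Proof.
move=> tphi; have iphi := tfn_cintegrable tphi.
have ipphi := tfn_cintegrable (tfn_partial j tphi).
rewrite !fourierE mulrCA; congr (_ * _).
set A := cint mu (fun x => phi x * ekern lam x); set B := cint mu _.
have [K K0 hK] := tfn_taylor j tphi.
have E (t : R) : cint mu (fun x => (phi (x + t *: delta_mx 0 j) - phi x - t%:C * partial j phi x) * ekern lam x)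
    = (cexpi (t * lam 0 j) - 1) * A - t%:C * B.
  have i1 : cintegrable mu (fun x => phi (x + t *: delta_mx 0 j) * ekern lam (x + t *: delta_mx 0 j)).
    exact: (cintegrable_shift (t *: delta_mx 0 j) (cintegrable_ekern lam iphi)).
  have -> : (cexpi (t * lam 0 j) - 1) * A - t%:C * B =
      (cexpi (t * lam 0 j) * A - A) - t%:C * B by rewrite mulrBl mul1r.
  rewrite /B -cintZ; last exact: cintegrable_ekern.
  rewrite -[X in cexpi _ * X - _](cint_shift (t *: delta_mx 0 j) (cintegrable_ekern lam iphi)).
  rewrite -[cexpi _ * _](cintZ _ i1) /A -cintB; [|exact: cintegrableZ|exact: cintegrable_ekern].
  rewrite -cintB; first last.
  - exact: cintegrableZ (cintegrable_ekern _ _).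
  - by apply: cintegrableB; [exact: cintegrableZ|exact: cintegrable_ekern].
  apply: eq_cint => x; rewrite ekernDr.
  have -> : cexpi (t * lam 0 j) * (phi (x + t *: delta_mx 0 j) * (ekern lam x * ekern lam (t *: delta_mx 0 j)))
     = phi (x + t *: delta_mx 0 j) * ekern lam x.
    rewrite /ekern dotZr dot_delta [in LHS]mulrCA [X in _ * X]mulrCA -cexpiD subrr cexpi0 mulr1.
    by [].
  by rewrite !mulrBl mulrA.
apply/esym/eqP; rewrite -subr_eq0; apply/eqP.
(* The first summand bounds the integrated Taylor remainder of phi, the second the remainder of
   exp(i t lam_j). *)
apply: (@linear_small0 _ (2 * (K * W) + 3 * lam 0 j ^+ 2 * cabs A)) => t t0 t1.
have -> : t%:C * ((0 +i* lam 0 j) * A - B) =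
    ((cexpi (t * lam 0 j) - 1) * A - t%:C * B)
    - (cexpi (t * lam 0 j) - 1 - (0 +i* (t * lam 0 j))) * A.
  have -> : (0 +i* (t * lam 0 j)) = t%:C * (0 +i* lam 0 j) by apply: complexP => /=; ring.
  ring.
apply: (le_trans (cabsD _ _)); rewrite [leRHS]mulrDl; apply: lerD.
  rewrite -E (_ : 2 * (K * W) * t ^+ 2 = 2 * (K * t ^+ 2 * W)); last by ring.
  apply: cint_wgt_le.
    apply: cmeasM; last exact: smooth_cmeas (smooth_ekern lam).
    apply: cmeasB; last by apply: cmeasZ; case: ipphi.
    by apply: cmeasB; [case: (cintegrable_shift (t *: delta_mx 0 j) iphi)|case: iphi].
  move=> x; rewrite cabsM cabs_ekern mulr1 (le_trans (hK _ _ _))//.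
  by rewrite gtr0_norm.
rewrite cabsN cabsM mulrAC ler_wpM2r ?cabs_ge0//.
by apply: (le_trans (cexpi_quad _)); rewrite le_eqVlt; apply/orP; left; apply/eqP; ring.
Qed.

Lemma smooth_imcoord j : smooth (fun x : Rd => 0 +i* - x 0 j : C).
Proof.
rewrite (_ : (fun x => _) = fun x : Rd => (0 +i* 1) * (-1 * x 0 j + 0)%:C).
  exact: smoothZ (smooth_coord _ _ _).
by apply/funext => x; apply: complexP => /=; ring.
Qed.

(** The remainder of the kernel costs a factor x_j^2, which is harmless because x_j^2 phi still
    decays like 1 / wgt. *)
Lemma fourier_cder phi j lam : tfn phi ->
  cder (fourier phi) lam (delta_mx 0 j) (fourier (fun x => (0 +i* - x 0 j) * phi x) lam).
Proof.
move=> tphi; have iphi := tfn_cintegrable tphi.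
have t1 := tfnM (smooth_imcoord j) tphi.
have [M M0 hM] := tfn_le_wgtV (tfnM (smooth_imcoord j) t1).
apply: (@cder_quad _ _ _ _ _ _ (cabs kap * (2 * (3 * M * W)))).
  by rewrite !mulr_ge0 ?cabs_ge0 ?wgtV_mass_ge0.
move=> h.
have i1 := tfn_cintegrable t1.
have -> : fourier phi (lam + h *: delta_mx 0 j) - fourier phi lam -
     h%:C * fourier (fun x => (0 +i* - x 0 j) * phi x) lam =
   kap * cint mu (fun x => phi x * (cexpi (- h * x 0 j) - 1 - (0 +i* (- h * x 0 j))) * ekern lam x).
  rewrite !fourierE mulrCA -mulrBr -mulrBr; congr (_ * _).
  rewrite -cintZ; last exact: cintegrable_ekern.
  rewrite -cintB; [|exact: cintegrable_ekern..].
  rewrite -cintB; first last.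
  - exact: cintegrableZ (cintegrable_ekern _ _).
  - by apply: cintegrableB; exact: cintegrable_ekern.
  apply: eq_cint => x; rewrite ekernDl.
  have -> : ekern (h *: delta_mx 0 j) x = cexpi (- h * x 0 j).
    by rewrite /ekern dotC dotZr dot_delta mulNr.
  have -> : (0 +i* (- h * x 0 j)) = h%:C * (0 +i* - x 0 j) by apply: complexP => /=; ring.
  ring.
rewrite cabsM -mulrA ler_wpM2l ?cabs_ge0//.
have -> : 2 * (3 * M * W) * h ^+ 2 = 2 * (3 * M * h ^+ 2 * W) by ring.
apply: cint_wgt_le.
  apply: cmeasM; last exact: smooth_cmeas (smooth_ekern lam).
  apply: cmeasM; first by case: iphi.
  have mx : measurable_fun setT (fun x : Rd => - h * x 0 j).
    by apply: measurable_funM => //; exact: measurable_rV_coord.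
  apply: cmeasB; last by split => //; exact: measurable_cst.
  by apply: cmeasB; [exact: cmeas_cexpi|exact: cmeas_cst].
move=> x; rewrite !cabsM cabs_ekern mulr1.
apply: (le_trans (ler_wpM2l (cabs_ge0 _) (cexpi_quad _))).
have := hM x; rewrite !cabsM.
have -> : cabs (0 +i* - x 0 j) = `|x 0 j|.
  by rewrite /cabs /= expr0n add0r sqrtr_sqr normrN.
rewrite mulrA -expr2 real_normK ?num_real// => hx.
have -> : cabs (phi x) * (3 * (- h * x 0 j) ^+ 2) = 3 * h ^+ 2 * (x 0 j ^+ 2 * cabs (phi x)) by ring.
have -> : 3 * M * h ^+ 2 / wgt x = 3 * h ^+ 2 * (M / wgt x) by ring.
by rewrite ler_wpM2l// mulr_ge0// sqr_ge0.
Qed.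

Lemma ccontinuous_fourier phi : tfn phi -> ccontinuous (fourier phi).
Proof.
move=> tphi; have iphi := tfn_cintegrable tphi.
(* The sum of the 1 + x_i^2 dominates the sum of the |x_i|, the Lipschitz constant of the kernel in
   lam up to a factor; being smooth, it can be multiplied into phi. *)
have ss : smooth (fun x : Rd => \sum_i (1 + (1 * x 0 i + 0)%:C * (1 * x 0 i + 0)%:C) : C).
  apply: smooth_sum => i; apply: smoothD (smooth_cst 1) _.
  exact: smoothM (smooth_coord 1 0 i) (smooth_coord 1 0 i).
have [M M0 hM] := tfn_le_wgtV (tfnM ss tphi).
have key lam (y : Rd) (e : R) : 0 <= e -> (forall i, `|y 0 i - lam 0 i| <= e) ->
    cabs (fourier phi y - fourier phi lam) <= cabs kap * (2 * (2 * e * M * W)).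
  move=> e0 hy; rewrite !fourierE -mulrBr cabsM ler_wpM2l ?cabs_ge0//.
  rewrite -cintB; [|exact: cintegrable_ekern..].
  apply: cint_wgt_le.
    by apply: cmeasB; apply: cmeasM; first [exact: smooth_cmeas (smooth_ekern _)|by case: iphi].
  move=> x; rewrite -mulrBr cabsM.
  apply: (le_trans (ler_wpM2l (cabs_ge0 _) (cexpi_lip _ _))).
  have hd : `|- dot y x - - dot lam x| <= e * \sum_i (1 + x 0 i ^+ 2).
    rewrite opprK addrC -[dot lam x - _]opprB normrN /dot -sumrB.
    rewrite (le_trans (ler_norm_sum _ _ _))// mulr_sumr ler_sum// => i _.
    rewrite -mulrBl normrM ler_pM//.
    by rewrite ler_norml; have := sqr_ge0 (x 0 i - 1); have := sqr_ge0 (x 0 i + 1);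
      move=> ? ?; apply/andP; split; nra.
  have := hM x; rewrite cabsM.
  have -> : (\sum_i (1 + (1 * x 0 i + 0)%:C * (1 * x 0 i + 0)%:C) : C) = (\sum_i (1 + x 0 i ^+ 2))%:C.
    rewrite rmorph_sum; apply: eq_bigr => i _.
    by rewrite mul1r addr0 -rmorphM -expr2 rmorphD rmorph1.
  have s0 : 0 <= \sum_i (1 + x 0 i ^+ 2) by apply: sumr_ge0 => i _; rewrite addr_ge0// sqr_ge0.
  rewrite cabsC ger0_norm// => hs.
  have -> : 2 * e * M / wgt x = 2 * e * (M / wgt x) by ring.
  apply: le_trans (ler_wpM2l _ hs); last by rewrite mulr_ge0.
  have := cabs_ge0 (phi x); move: hd; move: (`|_|) (cabs _) (\sum_i _) => a b c; nra.
have cc (pr : C -> R) : (forall z, `|pr z| <= cabs z) -> (forall a b, pr (a - b) = pr a - pr b) ->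
    continuous (pr \o fourier phi).
  move=> prle prB lam; apply: continuous_at_dist => e e0.
  pose K := cabs kap * (2 * (2 * M * W)) + 1.
  have K0 : 0 < K by rewrite ltr_wpDl// !mulr_ge0 ?cabs_ge0 ?wgtV_mass_ge0.
  apply/nbhs_rVP; exists (e / K); first by rewrite divr_gt0.
  move=> y hy; rewrite /= distrC -prB (le_lt_trans (prle _))//.
  have := key lam y (e / K) (ltW (divr_gt0 e0 K0)) (fun i => ltW (hy i)).
  move=> /le_lt_trans; apply.
  have -> : cabs kap * (2 * (2 * (e / K) * M * W)) = (K - 1) * (e / K) by rewrite /K; ring.
  rewrite mulrBl mul1r mulrCA divff ?gt_eqF// mulr1 gtrBl divr_gt0//.
by split; apply: cc => [z|a b]; rewrite ?cabs_Re ?cabs_Im ?(cReD, cReN) ?(cImD, cImN).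
Qed.

Lemma smooth_fourier phi : tfn phi -> smooth (fourier phi).
Proof.
move=> tphi; apply: (@smooth_coind _ _ [set f | exists2 psi, tfn psi & f = fourier psi]); last by exists phi.
  by move=> _ [psi tpsi ->]; exact: ccontinuous_fourier.
move=> _ [psi tpsi ->] j; exists (fourier (fun x => (0 +i* - x 0 j) * psi x)).
  by eexists; [exact: tfnM (smooth_imcoord j) tpsi|].
by move=> lam; exact: fourier_cder.
Qed.

Lemma tfn_improd (s : seq 'I_d) phi : tfn phi -> tfn (fun x => (\prod_(j <- s) (0 +i* - x 0 j)) * phi x).
Proof. exact: tfnM (smooth_prod _ _ smooth_imcoord). Qed.

Lemma partials_fourier s phi : tfn phi ->
  partials s (fourier phi) = fourier (fun x => (\prod_(j <- s) (0 +i* - x 0 j)) * phi x).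
Proof.
move=> tphi; elim: s => [|j s IH].
  apply: (congr1 fourier); apply/funext => x; by rewrite big_nil mul1r.
rewrite [LHS]/= IH; apply/funext => lam; apply: partial_cder.
have := fourier_cder j lam (tfn_improd s tphi); apply: cder_eq.
apply: (congr1 (fun h => fourier h lam)); apply/funext => x.
by rewrite big_cons mulrA.
Qed.

(** Each factor lam_j of the monomial is traded for a derivative of phi, so both inductions quantify
    over phi. *)
Lemma fourier_moment_bounded phi (a : multinom d) : tfn phi ->
  exists M, forall lam, `|monomial a lam| * cabs (fourier phi lam) <= M.
Proof.
rewrite /monomial; move: (index_enum _) => r tphi.
elim: r phi tphi => [|j r IH] phi tphi.
  have [M _ hM] := tfn_le_wgtV tphi.
  exists (cabs kap * (2 * (M * W))) => lam; rewrite big_nil normr1 mul1r.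
  exact: fourier_le (smooth_cmeas (tfn_smooth tphi)) hM.
suff key k : exists M, forall lam,
    `|lam 0 j ^+ k * \prod_(j <- r) lam 0 j ^+ a j| * cabs (fourier phi lam) <= M.
  by have [M hM] := key (a j); exists M => lam; rewrite big_cons.
elim: k phi tphi => [|k IHk] phi tphi.
  by have [M hM] := IH _ tphi; exists M => lam; rewrite expr0 mul1r.
have [M hM] := IHk _ (tfn_partial j tphi); exists M => lam.
apply: le_trans (hM lam); rewrite fourier_partial// cabsM.
have -> : cabs (0 +i* lam 0 j) = `|lam 0 j| by rewrite /cabs /= expr0n add0r sqrtr_sqr.
by rewrite !normrM exprS normrM le_eqVlt; apply/orP; left; apply/eqP; ring.
Qed.

(** Required because [dist_eq] identifies functionals on Schwartz functions only. *)
Lemma schwartz_fourier phi : tfn phi -> schwartz (fourier phi).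
Proof.
move=> tphi; split; first exact: smooth_fourier.
move=> a b; rewrite /schwartz_seminorm /mpartial.
rewrite partials_fourier//.
have [M hM] := fourier_moment_bounded a (tfn_improd (flatten [seq nseq (b j) j | j <- enum 'I_d]) tphi).
apply: (@le_lt_trans _ _ M%:E); last exact: ltry.
by apply: ub_ereal_sup => _ [lam _ <-]; rewrite lee_fin.
Qed.

End fourier_tfn.
Arguments wgtV_mass R d : clear implicits.
Arguments fourier_cst R d : clear implicits.

(** * Symbols, decay, and growth of powers *)

Section symbol.
Context {R : realType} {d : nat}.
Local Notation C := R[i].
Local Notation Rd := 'rV[R]_d.
Local Notation mu := (@lebesgue_rV R d).
Implicit Types (f g phi psi u : Rd -> C) (x lam : Rd) (P : mpoly d C).

Lemma smooth_symbol P : smooth (symbol P).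
Proof.
rewrite (_ : symbol P = fun lam => \sum_(m <- msupp P) mcoeff m P *
    \prod_i ((0 +i* 1) * (1 * lam 0 i + 0)%:C) ^+ m i).
  apply: smooth_sum => m; apply: smoothZ; apply: smooth_prod => i; apply: smoothX.
  exact: smoothZ (smooth_coord 1 0 i).
apply/funext => lam; rewrite /symbol mevalE; apply: eq_bigr => m _.
by congr (_ * _); apply: eq_bigr => i _; rewrite mul1r addr0.
Qed.

Lemma meval_reflect P (z : 'I_d -> C) : meval z (mpoly_reflect P) = meval (fun i => - z i) P.
Proof.
rewrite /mpoly_reflect comp_mpoly_meval; apply: meval_eq => i.
by rewrite tnth_mktuple mevalN mevalXU.
Qed.

(** Differentiating exp(-i lam.x) in lam produces factors -i x_j; the reflection of P cancels this
    sign. *)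
Lemma fourier_symbol P phi : tfn phi ->
  diffop (mpoly_reflect P) (fourier phi) = fourier (fun x => symbol P x * phi x).
Proof.
move=> tphi; apply/funext => lam; rewrite /diffop.
set Q := mpoly_reflect P.
pose F (m : multinom d) x := mcoeff m Q * ((\prod_(j <- flatten [seq nseq (m j) j | j <- enum 'I_d]) (0 +i* - x 0 j)) * phi x).
have tF m : tfn (F m) by exact: tfnZ (tfn_improd _ tphi).
have [FE _] := fourier_sum (msupp Q) lam (fun m => tfn_cintegrable (tF m)).
transitivity (\sum_(m <- msupp Q) fourier (F m) lam).
  apply: eq_bigr => m _; rewrite /mpartial partials_fourier// fourierZ//.
  exact: tfn_cintegrable (tfn_improd _ tphi).
rewrite -FE; apply: (congr1 (fun h => fourier h lam)); apply/funext => x.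
rewrite /F; under eq_bigr do rewrite mulrA; rewrite -mulr_suml; congr (_ * _).
have -> : symbol P x = meval (fun i => 0 +i* - x 0 i) Q.
  rewrite /Q meval_reflect /symbol; apply: meval_eq => i.
  by apply: complexP => /=; ring.
rewrite mevalE; apply: eq_bigr => m _; congr (_ * _).
rewrite big_flatten /= big_map -[index_enum _]enumT.
by apply: eq_bigr => i _; rewrite big_nseq -Monoid.iteropE.
Qed.

(** Its symbol 1 + lam_j^2 is one factor of [wgt]. *)
Definition Dop j phi x : C := phi x - partial j (partial j phi) x.

Lemma tfn_Dop j phi : tfn phi -> tfn (Dop j phi).
Proof.
move=> tphi; have t2 := tfnZ (-1) (tfn_partial j (tfn_partial j tphi)).
rewrite (_ : Dop j phi = fun x => phi x + -1 * partial j (partial j phi) x); first exact: tfnD.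
by apply/funext => x; rewrite mulN1r.
Qed.

Lemma fourier_Dop j phi lam : tfn phi ->
  fourier (Dop j phi) lam = (1 + lam 0 j ^+ 2)%:C * fourier phi lam.
Proof.
move=> tphi; have tp := tfn_partial j tphi; have t2 := tfn_partial j tp.
rewrite (_ : Dop j phi = fun x => phi x + -1 * partial j (partial j phi) x); last first.
  by apply/funext => x; rewrite mulN1r.
rewrite fourierD; [|exact: tfn_cintegrable|exact: tfn_cintegrable (tfnZ _ t2)].
rewrite fourierZ; last exact: tfn_cintegrable.
rewrite !fourier_partial//.
have -> : (1 + lam 0 j ^+ 2)%:C = 1 + -1 * ((0 +i* lam 0 j) * (0 +i* lam 0 j)) :> C.
  by apply: complexP => /=; ring.
ring.
Qed.

(* The operator with symbol [wgt]. *)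
Definition wop phi : Rd -> C := foldr Dop phi (enum 'I_d).

Lemma tfn_wop phi : tfn phi -> tfn (wop phi).
Proof.
move=> tphi; rewrite /wop; elim: (enum 'I_d) => [|j s IH]; first exact: tphi.
exact: tfn_Dop.
Qed.

Lemma fourier_wop phi lam : tfn phi -> fourier (wop phi) lam = (wgt lam)%:C * fourier phi lam.
Proof.
move=> tphi.
have key s : tfn (foldr Dop phi s) /\
    fourier (foldr Dop phi s) lam = (\prod_(j <- s) (1 + lam 0 j ^+ 2))%:C * fourier phi lam.
  elim: s => [|j s [IH1 IH2]]; first by rewrite big_nil mul1r.
  split; first exact: tfn_Dop.
  by rewrite [foldr _ _ _]/= fourier_Dop// IH2 big_cons mulrA -rmorphM.
by have [_ ->] := key (enum 'I_d); rewrite /wgt -[index_enum _]enumT.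
Qed.

Lemma fourier_decay phi (M : R) lam : tfn phi -> (forall x, cabs (wop phi x) <= M / wgt x) ->
  cabs (fourier phi lam) <= cabs (fourier_cst R d) * (2 * (M * wgtV_mass R d)) / wgt lam.
Proof.
move=> tphi hM; rewrite ler_pdivlMr ?wgt_gt0//.
have := fourier_le lam (smooth_cmeas (tfn_smooth (tfn_wop tphi))) hM.
by rewrite fourier_wop// cabsM cabsC gtr0_norm ?wgt_gt0// mulrC.
Qed.

Lemma fourier_le_wgtV phi : tfn phi -> exists2 M, 0 <= M &
  forall lam, cabs (fourier phi lam) <= M / wgt lam.
Proof.
move=> tphi; have [M M0 hM] := tfn_le_wgtV (tfn_wop tphi).
exists (cabs (fourier_cst R d) * (2 * (M * wgtV_mass R d))).
  by rewrite !mulr_ge0 ?cabs_ge0 ?wgtV_mass_ge0.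
by move=> lam; exact: fourier_decay.
Qed.

(** One power of the weight is spent on Peetre's inequality, the other on integrability. *)
Lemma fourier_le_wgtV2 phi : tfn phi -> exists2 M, 0 <= M &
  forall lam, cabs (fourier phi lam) <= M / wgt lam / wgt lam.
Proof.
move=> tphi; have [M M0 hM] := fourier_le_wgtV (tfn_wop tphi); exists M => // lam.
rewrite ler_pdivlMr ?wgt_gt0//; have := hM lam.
by rewrite fourier_wop// cabsM cabsC gtr0_norm ?wgt_gt0// mulrC.
Qed.

Lemma cintegrable_fourier phi : tfn phi -> cintegrable mu (fourier phi).
Proof.
move=> tphi; have [M _ hM] := fourier_le_wgtV tphi; apply: wgtV_cintegrable hM.
exact: smooth_cmeas (smooth_fourier tphi).
Qed.

(** The list does not depend on phi, so applying it to phi u^n involves derivatives of order bounded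
    independently of n. *)
Lemma wop_partials : exists l : seq (C * seq 'I_d), forall phi, smooth phi ->
  wop phi = fun x => \sum_(p <- l) p.1 * partials p.2 phi x.
Proof.
rewrite /wop; elim: (enum 'I_d) => [|j s [l IH]].
  exists [:: (1, [::])] => phi sphi; apply/funext => x; by rewrite big_seq1 mul1r.
exists (l ++ [seq (- p.1, [:: j, j & p.2]) | p <- l]) => phi sphi.
rewrite [foldr _ _ _]/= (IH _ sphi); apply/funext => x; rewrite big_cat big_map /Dop.
have E k (h : seq 'I_d -> Rd -> C) : (forall s, smooth (h s)) ->
    partial k (fun x => \sum_(p <- l) p.1 * h p.2 x) = fun x => \sum_(p <- l) p.1 * partial k (h p.2) x.
  move=> sh; elim: l {IH} => [|p l IHl].
    apply/funext => y; rewrite big_nil; apply: partial_cder.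
    rewrite (_ : (fun x => _) = cst 0); first exact: cder_cst.
    by apply/funext => z; rewrite big_nil.
  rewrite (_ : (fun x => _) = fun x => p.1 * h p.2 x + \sum_(p <- l) p.1 * h p.2 x); last first.
    by apply/funext => y; rewrite big_cons.
  have s1 := smoothZ p.1 (sh p.2).
  have s2 : smooth (fun x => \sum_(p <- l) p.1 * h p.2 x).
    by apply: smooth_sum => q; exact: smoothZ.
  rewrite (partialD k s1 s2) IHl (partialZ k p.1 (sh p.2)).
  by apply/funext => y; rewrite big_cons.
rewrite (E j (fun s => partials s phi)); last by move=> t; exact: smooth_partials.
rewrite (E j (fun s => partial j (partials s phi))); last first.
  by move=> t; apply: smooth_partial; exact: smooth_partials.
congr (_ + _); rewrite -sumrN; apply: eq_bigr => p _.
by rewrite mulNr.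
Qed.

Lemma partialX j u n : smooth u ->
  partial j (fun x => u x ^+ n.+1) = fun x => n.+1%:R * (u x ^+ n * partial j u x).
Proof.
move=> su; elim: n => [|n IH].
  rewrite (_ : (fun x => u x ^+ 1) = u); last by apply/funext => x; rewrite expr1.
  by apply/funext => x; rewrite expr0 !mul1r.
rewrite (_ : (fun x => u x ^+ n.+2) = fun x => u x * u x ^+ n.+1); last first.
  by apply/funext => x; rewrite exprS.
rewrite (partialM j su (smoothX n.+1 su)) IH; apply/funext => x.
by rewrite [n.+2%:R]mulrS !exprS; ring.
Qed.

(** Every derivative falls on phi or consumes one factor u at the price of the exponent. Starting
    from n + size s factors, n of them survive and give A^n. The innermost derivative is carried out
    first, which turns phi into other test functions; hence the induction from the right. *)
Lemma partials_pow_growth u (A : R) s phi : smooth u -> (forall x, cabs (u x) <= A) -> tfn phi ->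
  exists K : nat, exists2 M, 0 <= M & forall n x,
    cabs (partials s (fun x => phi x * u x ^+ (n + size s)) x) <= M * n.+1%:R ^+ K * A ^+ n / wgt x.
Proof.
move=> su uA; have A0 : 0 <= A by exact: le_trans (cabs_ge0 _) (uA 0).
elim/last_ind: s phi => [|s j IH] phi tphi.
  have [M M0 hM] := tfn_le_wgtV tphi; exists 0%N, M => // n x.
  rewrite expr0 mulr1 addn0 cabsM cabsX mulrAC ler_pM ?exprn_ge0 ?cabs_ge0 ?hM//.
  by rewrite lerXn2r ?nnegrE ?cabs_ge0.
(* With m = n + size s, the derivative of phi u^(m+1) is t1 u^m + (m+1) t2 u^m. *)
have t1 : tfn (fun x => u x * partial j phi x) by exact: tfnM su (tfn_partial j tphi).
have t2 : tfn (fun x => partial j u x * phi x) by exact: tfnM (smooth_partial j su) tphi.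
have [K1 [M1 M10 h1]] := IH _ t1; have [K2 [M2 M20 h2]] := IH _ t2.
exists (K1 + K2 + 1)%N, (M1 + (size s).+1%:R * M2).
  by rewrite addr_ge0// mulr_ge0.
move=> n x; rewrite partials_rcons size_rcons addnS.
set m := (n + size s)%N.
have sm := smoothX m su.
rewrite (partialM j (tfn_smooth tphi) (smoothX m.+1 su)) partialX//.
rewrite (_ : (fun x => _) = fun x => u x * partial j phi x * u x ^+ m +
    m.+1%:R * (partial j u x * phi x * u x ^+ m)); last first.
  by apply/funext => y; rewrite exprS; ring.
have s1 := smoothM (tfn_smooth t1) sm; have s2 := smoothM (tfn_smooth t2) sm.
rewrite (partialsD s s1 (smoothZ _ s2)) (partialsZ s _ s2).
apply: (le_trans (cabsD _ _)); rewrite cabsM.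
have -> : cabs (m.+1%:R : C) = m.+1%:R by rewrite -(rmorph_nat (real_complex R)) cabsC ger0_norm.
have n1 : 1 <= n.+1%:R :> R by rewrite ler1n.
have mn : m.+1%:R <= (size s).+1%:R * n.+1%:R :> R by rewrite -natrM ler_nat /m; nia.
have w0 := wgtV_ge0 x.
have Aw : 0 <= A ^+ n / wgt x by rewrite mulr_ge0// exprn_ge0.
apply: (@le_trans _ _ (M1 * n.+1%:R ^+ K1 * A ^+ n / wgt x +
    ((size s).+1%:R * n.+1%:R) * (M2 * n.+1%:R ^+ K2 * A ^+ n / wgt x))).
  by rewrite lerD ?h1// ler_pM ?cabs_ge0 ?h2.
have -> : M1 * n.+1%:R ^+ K1 * A ^+ n / wgt x + (size s).+1%:R * n.+1%:R * (M2 * n.+1%:R ^+ K2 * A ^+ n / wgt x)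
   = (M1 * n.+1%:R ^+ K1 + (size s).+1%:R * M2 * n.+1%:R ^+ K2.+1) * (A ^+ n / wgt x).
  by rewrite exprS; ring.
rewrite -[leRHS]mulrA ler_wpM2r// mulrDl lerD// ler_wpM2l ?mulr_ge0//.
  by rewrite ler_weXn2l// -addnA leq_addr.
by rewrite ler_weXn2l//; lia.
Qed.

(** Expand [wop] into partial derivatives and bound each of them; N and K depend on [wop] but not on
    n. *)
Lemma fourier_pow_growth u (A : R) phi : smooth u -> (forall x, cabs (u x) <= A) -> tfn phi ->
  exists N K : nat, exists2 M, 0 <= M & forall n lam,
    cabs (fourier (fun x => phi x * u x ^+ (n + N)) lam) <= M * n.+1%:R ^+ K * A ^+ n / wgt lam.
Proof.
move=> su uA tphi; have A0 : 0 <= A by exact: le_trans (cabs_ge0 _) (uA 0).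
have [l hl] := wop_partials.
suff [N [K [M M0 hM]]] : exists N K : nat, exists2 M, 0 <= M & forall n x,
    cabs (\sum_(p <- l) p.1 * partials p.2 (fun x => phi x * u x ^+ (n + N)) x)
      <= M * n.+1%:R ^+ K * A ^+ n / wgt x.
  exists N, K, (cabs (fourier_cst R d) * (2 * (M * wgtV_mass R d))).
    by rewrite !mulr_ge0 ?cabs_ge0 ?wgtV_mass_ge0.
  move=> n lam.
  have tt : tfn (fun x => phi x * u x ^+ (n + N)).
    rewrite (_ : (fun x => _) = fun x => u x ^+ (n + N) * phi x); first exact: tfnM (smoothX _ su) tphi.
    by apply/funext => x; rewrite mulrC.
  have := @fourier_decay _ (M * n.+1%:R ^+ K * A ^+ n) lam tt.
  rewrite (hl _ (tfn_smooth tt)) => /(_ (hM n)) /le_trans; apply.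
  by rewrite le_eqVlt; apply/orP; left; apply/eqP; ring.
(* Any common bound on the orders will do: the surplus factors u^(N - size p.2) are absorbed into
   the test function. *)
pose N := (\sum_(p <- l) size p.2)%N; exists N.
have : forall p, p \in l -> (size p.2 <= N)%N.
  by move=> p pl; rewrite /N (big_rem p)//= leq_addr.
elim: l N {hl} => [|p l IH] N hN.
  exists 0%N, 0 => // n x; by rewrite big_nil cabs0 !mul0r.
have [|K1 [M1 M10 h1]] := IH N; first by move=> q ql; apply: hN; rewrite inE ql orbT.
have pN := hN _ (mem_head _ _).
have tp : tfn (fun x => phi x * u x ^+ (N - size p.2)).
  rewrite (_ : (fun x => _) = fun x => u x ^+ (N - size p.2) * phi x); first exact: tfnM (smoothX _ su) tphi.
  by apply/funext => x; rewrite mulrC.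
have [K2 [M2 M20 h2]] := partials_pow_growth p.2 su uA tp.
exists (K1 + K2)%N, (cabs p.1 * M2 + M1); first by rewrite addr_ge0// mulr_ge0// cabs_ge0.
move=> n x; rewrite big_cons; apply: (le_trans (cabsD _ _)); rewrite cabsM.
have n1 : 1 <= n.+1%:R :> R by rewrite ler1n.
have Aw : 0 <= A ^+ n / wgt x by rewrite mulr_ge0 ?exprn_ge0 ?wgtV_ge0.
have := h1 n x; have := h2 n x.
rewrite (_ : (fun x => phi x * u x ^+ (N - size p.2) * u x ^+ (n + size p.2)) =
   fun x => phi x * u x ^+ (n + N)); last first.
  by apply/funext => y; rewrite -mulrA -exprD addnCA subnK.
move=> h2' h1'; apply: (le_trans (lerD (ler_wpM2l (cabs_ge0 _) h2') h1')).
have -> : cabs p.1 * (M2 * n.+1%:R ^+ K2 * A ^+ n / wgt x) + M1 * n.+1%:R ^+ K1 * A ^+ n / wgt x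
  = (cabs p.1 * M2 * n.+1%:R ^+ K2 + M1 * n.+1%:R ^+ K1) * (A ^+ n / wgt x) by ring.
rewrite -[leRHS]mulrA ler_wpM2r// mulrDl lerD// ler_wpM2l ?mulr_ge0 ?cabs_ge0//.
  by rewrite ler_weXn2l// leq_addl.
by rewrite ler_weXn2l// leq_addr.
Qed.

End symbol.

(** * Fourier inversion *)

Section fubini_prod.
Context {R : realType} {d : nat}.
Local Notation C := R[i].
Local Notation Rd := 'rV[R]_d.
Local Notation mu := (@lebesgue_rV R d).

(** Domination by a product settles all integrability conditions of [cfubini] at once. *)
Lemma cfubini_prod (F : Rd * Rd -> C) (a b : Rd -> C) : cmeas F ->
  cintegrable mu a -> cintegrable mu b -> (forall x y, cabs (F (x, y)) <= cabs (a x) * cabs (b y)) ->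
  cint mu (fun x => cint mu (fun y => F (x, y))) = cint mu (fun y => cint mu (fun x => F (x, y))).
Proof.
move=> mF ia ib Fab; have [ma la] := ia; have [mb lb] := ib.
have lF x : (\int[mu]_y (cabs (F (x, y)))%:E <= (cabs (a x))%:E * \int[mu]_y (cabs (b y))%:E)%E.
  rewrite -ge0_integralZl; first last.
  - by rewrite lee_fin cabs_ge0.
  - by move=> y _; exact: cabs_gee0.
  - exact: measurable_cabsE.
  - exact: measurableT.
  apply: ge0_le_integral => //.
  - by move=> y _; exact: cabs_gee0.
  - by apply: measurable_cabsE; exact: cmeas_section1.
  - by apply: emeasurable_funM => //; exact: measurable_cabsE.
  - by move=> y _; rewrite -EFinM lee_fin.
apply: cfubini => //.
- apply: (@le_lt_trans _ _ (\int[mu]_x ((cabs (a x))%:E * \int[mu]_y (cabs (b y))%:E))%E).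
    apply: ge0_le_integral => //.
    + by move=> x _; exact: int_cabs_ge0.
    + apply: (measurable_fun_fubini_tonelli_F (fun z => (cabs (F z))%:E)); first exact: measurable_cabsE.
      by move=> z; exact: cabs_gee0.
    + by apply: emeasurable_funM => //; exact: measurable_cabsE.
  rewrite ge0_integralZr//; last 3 first.
  - exact: measurable_cabsE.
  - by move=> x _; exact: cabs_gee0.
  - exact: int_cabs_ge0.
  rewrite lte_mul_pinfty ?int_cabs_ge0// ge0_fin_numE//; exact: int_cabs_ge0.
- move=> x; split; first exact: cmeas_section1.
  by apply: le_lt_trans (lF x) _; rewrite lte_mul_pinfty// lee_fin cabs_ge0.
- move=> y; apply: (le_cintegrable (G := fun x => cabs (b y) * cabs (a x))).
  + exact: cmeas_section2.
  + by apply: measurable_funM => //; exact: measurable_cabs.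
  + by move=> x; rewrite mulrC.
  + under eq_integral do rewrite EFinM; rewrite ge0_integralZl//.
    * by rewrite lte_mul_pinfty// lee_fin cabs_ge0.
    * exact: measurable_cabsE.
    * by move=> x _; exact: cabs_gee0.
    * by rewrite lee_fin cabs_ge0.
Qed.

Lemma cmeas_fst (f : Rd -> C) : cmeas f -> cmeas (fun z : Rd * Rd => f z.1).
Proof. by move=> mf; exact: (cmeas_comp mf measurable_fst). Qed.

Lemma cmeas_snd (f : Rd -> C) : cmeas f -> cmeas (fun z : Rd * Rd => f z.2).
Proof. by move=> mf; exact: (cmeas_comp mf measurable_snd). Qed.

Lemma cmeas_ekern : cmeas (fun z : Rd * Rd => ekern z.1 z.2).
Proof.
by apply: cmeas_cexpi; apply: measurableT_comp => //; exact: measurable_dot.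
Qed.

Lemma measurable_lin (a b : R) : measurable_fun setT (fun z : Rd * Rd => a *: z.1 + b *: z.2).
Proof.
apply: measurable_fun_rV => i; under eq_fun do rewrite !mxE.
apply: measurable_funD; apply: measurable_funM => //.
  exact: (measurableT_comp (measurable_rV_coord i) measurable_fst).
exact: (measurableT_comp (measurable_rV_coord i) measurable_snd).
Qed.

Lemma fourier_mult (phi psi : Rd -> C) : cintegrable mu phi -> cintegrable mu psi ->
  cint mu (fun x => fourier phi x * psi x) = cint mu (fun y => phi y * fourier psi y).
Proof.
move=> iphi ipsi; set kap := fourier_cst R d.
pose F (z : Rd * Rd) := psi z.1 * (phi z.2 * ekern z.1 z.2).
have mF : cmeas F.
  apply: cmeasM; first by apply: cmeas_fst; case: ipsi.
  by apply: cmeasM; [apply: cmeas_snd; case: iphi|exact: cmeas_ekern].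
transitivity (cint mu (fun x => kap * cint mu (fun y => F (x, y)))).
  apply: eq_cint => x; rewrite fourierE /F /= cintZ; last exact: cintegrable_ekern.
  by rewrite -mulrA; congr (_ * _); rewrite mulrC.
transitivity (cint mu (fun y => kap * cint mu (fun x => F (x, y)))); last first.
  apply: eq_cint => y; rewrite fourierE mulrCA; congr (_ * _).
  rewrite -cintZ; last exact: cintegrable_ekern.
  by apply: eq_cint => x; rewrite /F /= mulrCA [ekern y x]ekernC.
have bd x y : cabs (kap * F (x, y)) <= cabs (kap * psi x) * cabs (phi y).
  by rewrite !cabsM cabs_ekern mulr1 mulrA.
have E1 x : kap * cint mu (fun y => F (x, y)) = cint mu (fun y => kap * F (x, y)).
  rewrite cintZ// /F /=; apply: cintegrableZ; exact: cintegrable_ekern.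
have E2 y : kap * cint mu (fun x => F (x, y)) = cint mu (fun x => kap * F (x, y)).
  rewrite cintZ// /F /= (_ : (fun x => _) = fun x => phi y * (psi x * ekern y x)).
    by apply: cintegrableZ; exact: cintegrable_ekern.
  by apply/funext => x; rewrite mulrCA [ekern y x]ekernC.
under eq_cint do rewrite E1.
under [RHS]eq_cint do rewrite E2.
apply: (@cfubini_prod (fun z => kap * F z) (fun x => kap * psi x) phi) => //.
- exact: cmeasZ.
- exact: cintegrableZ.
Qed.

End fubini_prod.

Section smooth_affine.
Context {R : realType} {d : nat}.
Local Notation C := R[i].
Local Notation Re := (@complex.Re R).
Local Notation Im := (@complex.Im R).
Local Notation Rd := 'rV[R]_d.
Local Notation mu := (@lebesgue_rV R d).

Lemma is_derive_affine (F : Rd -> R) (a : R) (b x v : Rd) (l : R) :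
  is_derive (a *: x + b) v F l -> is_derive x v (fun y => F (a *: y + b)) (a * l).
Proof.
move=> dF; apply: is_derive_line.
have d0 : is_derive (0 : R) 1 (fun t : R => F (a *: x + b + t *: v)) l.
  by apply: line_is_derive; rewrite scale0r addr0.
have da : is_derive (0 : R) 1 (fun t : R => a * t) a.
  by apply: is_derive_eq; rewrite /GRing.scale /= mulr1.
have d0' : is_derive ((fun t : R => a * t) 0) 1 (fun t : R => F (a *: x + b + t *: v)) l.
  by rewrite mulr0.
have := @is_derive1_comp R (fun t : R => F (a *: x + b + t *: v)) (fun t : R => a * t) 0 _ _ d0' da.
rewrite mulrC; rewrite (_ : _ \o _ = (fun t : R => F (a *: (x + t *: v) + b)))//.
by apply/funext => t /=; rewrite scalerDr scalerA addrAC.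
Qed.

Lemma smooth_affine (a : R) (b : Rd) (f : Rd -> C) : smooth f -> smooth (fun x => f (a *: x + b)).
Proof.
move=> sf; apply: (@smooth_coind _ _ [set g | exists f (c : C), smooth f /\ g = fun x => c * f (a *: x + b)]); last first.
  by exists f, 1; split; [exact: sf|apply/funext => x; rewrite mul1r].
- move=> _ [g [c [sg ->]]] j.
  exists (fun x => (c * a%:C) * partial j g (a *: x + b)).
    by exists (partial j g), (c * a%:C); split; [exact: smooth_partial|].
  move=> x; have [dr di] := smooth_cder j (a *: x + b) sg.
  have da : cder (fun y => g (a *: y + b)) x (delta_mx 0 j) (a%:C * partial j g (a *: x + b)).
    split; first by rewrite cReM /= mul0r subr0; exact: is_derive_affine dr.
    by rewrite cImM /= mul0r addr0; exact: is_derive_affine di.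
  by apply: cder_eq (cderM (cder_cst c x _) da); rewrite mul0r add0r mulrA.
- move=> _ [g [c [sg ->]]]; apply: ccontinuousM; first exact: ccontinuous_cst.
  have [cr ci] := smooth_continuous sg.
  have ca : continuous (fun x : Rd => a *: x + b).
    by move=> x; exact: (cvgD (@scaler_continuous _ _ a x) (cvg_cst b)).
  by split => x; [exact: (continuous_comp (ca x) (cr _))|exact: (continuous_comp (ca x) (ci _))].
Qed.

Lemma tfn_affine (a : R) (b : Rd) (f : Rd -> C) : a != 0 -> tfn f -> tfn (fun x => f (a *: x + b)).
Proof.
move=> a0 [sf [r hr]]; split; first exact: smooth_affine.
exists ((r + \sum_i `|b 0 i|) / `|a|) => x fx i.
rewrite ler_pdivlMr ?normr_gt0// mulrC -normrM.
have := hr _ fx i; rewrite !mxE => h.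
have : `|b 0 i| <= \sum_i `|b 0 i| by rewrite (bigD1 i)//= lerDl sumr_ge0.
have := ler_normB (a * x 0 i + b 0 i) (b 0 i); rewrite addrK; lra.
Qed.

Lemma seq_cvg_cabs (f : Rd -> C) (x z : Rd) : ccontinuous f ->
  cabs (f (x + n.+1%:R^-1 *: z) - f x) @[n --> \oo] --> (0 : R).
Proof.
move=> [cr ci].
have sx : x + n.+1%:R^-1 *: z @[n --> \oo] --> x.
  rewrite -[X in _ --> X]addr0; apply: cvgD; first exact: cvg_cst.
  rewrite -[X in _ --> X](scale0r z); apply: cvgZl; exact: cvg_harmonic.
have lr := cvg_comp _ _ sx (cr x); have li := cvg_comp _ _ sx (ci x).
apply: (@squeeze_cvgr _ _ _ _ (cst 0) (fun n => `|Re (f (x + n.+1%:R^-1 *: z)) - Re (f x)| + `|Im (f (x + n.+1%:R^-1 *: z)) - Im (f x)|)).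
- apply: nearW => n; rewrite cabs_ge0 (le_trans (cabs_le_ReIm _))//.
  by rewrite !(cReD, cImD, cReN, cImN).
- exact: cvg_cst.
- rewrite -[X in _ --> X](addr0 0); apply: cvgD.
    exact: (@cvgr_normB0 _ (fun n => Re (f (x + n.+1%:R^-1 *: z)))).
  exact: (@cvgr_normB0 _ (fun n => Im (f (x + n.+1%:R^-1 *: z)))).
Qed.

Lemma cabs_cvg_unique (u : nat -> C) (a b : C) :
  cabs (u n - a) @[n --> \oo] --> (0 : R) -> cabs (u n - b) @[n --> \oo] --> (0 : R) -> a = b.
Proof.
move=> ua ub; apply/eqP; rewrite -subr_eq0; apply/eqP/cabs0_eq0.
apply/eqP; rewrite eq_le cabs_ge0 andbT.
have : cabs (u n - a) + cabs (u n - b) @[n --> \oo] --> (0 + 0 : R) by exact: cvgD.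
rewrite addr0 => uab.
apply: (ler_cvg_to (cvg_cst (cabs (a - b))) uab).
apply: nearW => n; have -> : a - b = - (u n - a) + (u n - b) by ring.
by rewrite (le_trans (cabsD _ _))// cabsN.
Qed.

End smooth_affine.

Section inversion.
Context {R : realType} {d : nat}.
Local Notation C := R[i].
Local Notation Re := (@complex.Re R).
Local Notation Im := (@complex.Im R).
Local Notation Rd := 'rV[R]_d.
Local Notation mu := (@lebesgue_rV R d).
Implicit Types (phi psi u : Rd -> C).

Lemma fourier_scale (e : R) phi lam : 0 < e -> cintegrable mu phi ->
  fourier (fun x => phi (e *: x)) lam = (e ^- d)%:C * fourier phi (e^-1 *: lam).
Proof.
move=> e0 iphi; rewrite !fourierE mulrCA; congr (_ * _).
have := cint_affine (0 : Rd) (lt0r_neq0 e0) (cintegrable_ekern (e^-1 *: lam) iphi).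
rewrite gtr0_norm// => <-; apply: eq_cint => x; rewrite addr0; congr (_ * _).
by rewrite /ekern dotZr [dot (e^-1 *: _) _]dotC dotZr mulrA divff ?gt_eqF// mul1r dotC.
Qed.

(** The multiplication formula for phi and psi(x / n), with the dilation moved from psi to phi on
    the other side; let n tend to infinity. Thus the integral of F phi is a fixed multiple of
    phi(0), and no Gaussian has to be computed. *)
Lemma fourier_swap0 phi psi : tfn phi -> tfn psi ->
  psi 0 * cint mu (fourier phi) = phi 0 * cint mu (fourier psi).
Proof.
move=> tphi tpsi.
have e0 n : 0 < n.+1%:R^-1 :> R by rewrite invr_gt0.
have en0 n : n.+1%:R^-1 != 0 :> R by rewrite gt_eqF.
have scl n (f : Rd -> C) : tfn f -> tfn (fun x => f (n.+1%:R^-1 *: x)).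
  by move=> tf; have := tfn_affine 0 (en0 n) tf; under eq_fun do rewrite addr0.
have E n : cint mu (fun x => fourier phi x * psi (n.+1%:R^-1 *: x)) =
    cint mu (fun z => phi (n.+1%:R^-1 *: z) * fourier psi z).
  rewrite fourier_mult; [|exact: tfn_cintegrable|exact: tfn_cintegrable (scl n _ tpsi)].
  have iH : cintegrable mu (fun y => phi y * fourier psi (n.+1%:R *: y)).
    have [M _ hM] := tfn_bounded tphi.
    apply: (cintegrable_bounded (M := M) _ (smooth_cmeas (tfn_smooth tphi)) hM).
    have n0 : n.+1%:R != 0 :> R by rewrite pnatr_eq0.
    have := cintegrable_affine (0 : Rd) n0 (cintegrable_fourier tpsi).
    by under eq_fun do rewrite addr0.
  have n0 : n.+1%:R != 0 :> R by rewrite pnatr_eq0.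
  transitivity (cint mu (fun y => phi (n.+1%:R^-1 *: y + 0) * fourier psi (n.+1%:R *: (n.+1%:R^-1 *: y + 0)))); last first.
    by apply: eq_cint => y; rewrite addr0 scalerA mulfV// scale1r.
  rewrite (cint_affine (0 : Rd) (en0 n) iH) (gtr0_norm (e0 n)) -(cintZ _ iH); apply: eq_cint => y.
  by rewrite (fourier_scale _ (e0 n) (tfn_cintegrable tpsi)) invrK mulrCA.
have cv (f g : Rd -> C) : tfn f -> cintegrable mu g ->
    cabs (cint mu (fun x => f (n.+1%:R^-1 *: x) * g x) - cint mu (fun x => f 0 * g x)) @[n --> \oo] --> (0 : R).
  move=> tf ig; have [M M0 hM] := tfn_bounded tf.
  apply: (@dominated_cint _ _ _ _ _ _ (fun x => M * cabs (g x))).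
  - move=> n; apply: cmeasM; last by case: ig.
    exact: smooth_cmeas (tfn_smooth (scl n _ tf)).
  - by apply: cmeasZ; case: ig.
  - by apply: measurable_funM => //; apply: measurable_cabs; case: ig.
  - have [_] := cintegrableZ (M%:C) ig; under eq_integral do rewrite cabsM cabsC ger0_norm//.
    by [].
  - by move=> n x; rewrite cabsM ler_wpM2r ?cabs_ge0.
  - move=> x.
    have := seq_cvg_cabs 0 x (smooth_continuous (tfn_smooth tf)).
    rewrite (_ : (fun n => cabs (f (n.+1%:R^-1 *: x) * g x - f 0 * g x)) =
        fun n => cabs (f (0 + n.+1%:R^-1 *: x) - f 0) * cabs (g x)); last first.
      by apply/funext => n; rewrite add0r -mulrBl cabsM.
    by move=> h; rewrite -[X in _ --> X](mul0r (cabs (g x))); exact: (cvgM h (cvg_cst _)).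
rewrite -[LHS]cintZ; last exact: cintegrable_fourier.
rewrite -[RHS]cintZ; last exact: cintegrable_fourier.
pose u1 n := cint mu (fun x => psi (n.+1%:R^-1 *: x) * fourier phi x).
pose u2 n := cint mu (fun x => phi (n.+1%:R^-1 *: x) * fourier psi x).
have h1 : cabs (u1 n - cint mu (fun x => psi 0 * fourier phi x)) @[n --> \oo] --> (0 : R).
  exact: cv _ _ tpsi (cintegrable_fourier tphi).
have h2 : cabs (u2 n - cint mu (fun x => phi 0 * fourier psi x)) @[n --> \oo] --> (0 : R).
  exact: cv _ _ tphi (cintegrable_fourier tpsi).
have u12 : u1 = u2.
  by apply/funext => n; rewrite /u2 -E; apply: eq_cint => x; exact: mulrC.
by rewrite u12 in h1; exact: cabs_cvg_unique h1 h2.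
Qed.

(* The value [(2 pi)^(d/2)] of this constant is irrelevant: only [inv_cst != 0] matters. *)
Definition inv_cst : C := cint mu (fourier (fun x : Rd => (bump 0 1 x)%:C)).

Lemma bump00 : bump (0 : Rd) 1 0 = 1 :> R.
Proof. by apply: bump1 => // i; rewrite subrr normr0. Qed.

Lemma fourier_shift phi lam x : cintegrable mu phi ->
  fourier (fun y => phi (y + lam)) x = cexpi (dot x lam) * fourier phi x.
Proof.
move=> iphi; rewrite !fourierE mulrCA; congr (_ * _).
have := cint_shift lam (cintegrable_ekern x iphi) => <-.
rewrite -cintZ; last exact: (cintegrable_shift lam (cintegrable_ekern x iphi)).
apply: eq_cint => y; rewrite ekernDr.
have -> : cexpi (dot x lam) * (phi (y + lam) * (ekern x y * ekern x lam)) =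
    phi (y + lam) * ekern x y * (cexpi (dot x lam) * ekern x lam) by ring.
have -> : cexpi (dot x lam) * ekern x lam = 1 by rewrite /ekern -cexpiD subrr cexpi0.
by rewrite mulr1.
Qed.

(** Compare the translate u(x + lam) with the bump, whose value at 0 is 1, in [fourier_swap0]. *)
Lemma fourier_inversion u lam : tfn u ->
  cint mu (fun y => cexpi (dot y lam) * fourier u y) = inv_cst * u lam.
Proof.
move=> tu; have tl : tfn (fun x => u (x + lam)).
  by have := tfn_affine lam (oner_neq0 R) tu; under eq_fun do rewrite scale1r.
have := fourier_swap0 tl (tfn_bump 0 ltr01); rewrite bump00 mul1r add0r mulrC => <-.
by apply: eq_cint => y; rewrite fourier_shift//; exact: tfn_cintegrable.
Qed.

(** Insert the inversion formula for u into the integral defining F(u psi) and exchange the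
    integrals; the inner one is F psi at x - y. *)
Lemma fourier_prod u psi x : tfn u -> tfn psi ->
  inv_cst * fourier (fun y => u y * psi y) x =
  cint mu (fun y => fourier u y * fourier psi (x - y)).
Proof.
move=> tu tpsi; set kap := fourier_cst R d.
have iu := cintegrable_fourier tu; have ip := tfn_cintegrable tpsi.
pose F (z : Rd * Rd) := (kap * psi z.1 * ekern x z.1) * (cexpi (dot z.2 z.1) * fourier u z.2).
have mF : cmeas F.
  apply: cmeasM.
    apply: (@cmeas_fst _ _ (fun l => kap * psi l * ekern x l)); apply: cmeasM.
      by apply: cmeasZ; case: ip.
    exact: smooth_cmeas (smooth_ekern x).
  apply: cmeasM; last by apply: cmeas_snd; case: iu.
  apply: cmeas_cexpi; rewrite (_ : (fun z : Rd * Rd => _) = fun z => dot z.1 z.2); first exact: measurable_dot.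
  by apply/funext => z; rewrite dotC.
have iFl l : cintegrable mu (fun y => cexpi (dot y l) * fourier u y).
  apply: (cintegrable_bounded (M := 1)) => //.
    rewrite (_ : (fun y => _) = fun y => cexpi (dot l y)); last by apply/funext => y; rewrite dotC.
    exact: smooth_cmeas (smooth_cexpi l).
  by move=> y; rewrite cabs_cexpi.
transitivity (cint mu (fun l => cint mu (fun y => F (l, y)))).
  rewrite fourierE mulrCA -cintZ; last first.
    apply: cintegrable_ekern.
    exact: tfn_cintegrable (tfnM (tfn_smooth tu) tpsi).
  rewrite -cintZ; last first.
    apply: cintegrableZ; apply: cintegrable_ekern.
    exact: tfn_cintegrable (tfnM (tfn_smooth tu) tpsi).
  apply: eq_cint => l; rewrite /F /= cintZ// fourier_inversion//.
  by rewrite -/kap; ring.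
rewrite (@cfubini_prod _ _ F (fun l => kap * psi l) (fourier u))//; first last.
- move=> l y; have -> : F (l, y) = kap * psi l * (ekern x l * cexpi (dot y l)) * fourier u y.
    by rewrite /F /=; ring.
  by rewrite !cabsM cabs_ekern cabs_cexpi !mulr1.
- exact: cintegrableZ.
apply: eq_cint => y; rewrite fourierE -/kap mulrCA.
rewrite -(cintZ (fourier u y) (cintegrable_ekern (x - y) ip)).
rewrite -(cintZ kap (cintegrableZ (fourier u y) (cintegrable_ekern (x - y) ip))).
apply: eq_cint => l; rewrite /F /= ekernDl.
have -> : ekern (- y) l = cexpi (dot y l) by rewrite /ekern dotC dotNr opprK dotC.
ring.
Qed.

End inversion.
Arguments inv_cst R d : clear implicits.

(** * Functions orthogonal to all Fourier transforms *)

Section positivity.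
Context {R : realType} {d : nat}.
Local Notation C := R[i].
Local Notation Re := (@complex.Re R).
Local Notation Im := (@complex.Im R).
Local Notation Rd := 'rV[R]_d.
Local Notation mu := (@lebesgue_rV R d).

Lemma integral_continuous_gt0 (G : Rd -> R) (x : Rd) : continuous G -> (forall x, 0 <= G x) -> 0 < G x ->
  (0 < \int[mu]_x (G x)%:E)%E.
Proof.
move=> cG G0 Gx; have mG := continuous_measurable_rV cG.
have h2 : 0 < G x / 2 by rewrite divr_gt0.
have : nbhs x [set y : Rd | `|G x - G y| < G x / 2].
  by move/cvgrPdist_lt : (cG x); apply.
move=> /nbhs_rVP[e e0 he].
pose a : Rd := \row_i (x 0 i - e / 2); pose b : Rd := \row_i (x 0 i + e / 2).
have ab i : a 0 i <= b 0 i by rewrite !mxE; lra.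
set B := [set y : Rd | forall i, y 0 i \in `]a 0 i, b 0 i]].
have mB : measurable B.
  rewrite (_ : B = \bigcap_(i in [set: 'I_d]) ((fun y : Rd => y 0 i) @^-1` `]a 0 i, b 0 i]%classic)).
    apply: fin_bigcap_measurable => // i _.
    by rewrite -[X in measurable X]setTI; apply: measurable_rV_coord => //; exact: measurable_itv.
  by apply/seteqP; split=> y /= h i; [move=> _|]; exact: h.
have muB : mu B = (e ^+ d)%:E.
  rewrite /B lebesgue_rV_box//; congr EFin.
  rewrite (eq_bigr (fun=> e)); first by rewrite prodr_const card_ord.
  by move=> i _; rewrite !mxE; lra.
have GB y : B y -> G x / 2 <= G y.
  move=> By; have : `|G x - G y| < G x / 2.
    by apply: he => i; have := By i; rewrite in_itv /= !mxE => /andP[h1 h3]; rewrite ltr_norml; lra.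
  by rewrite ltr_norml; lra.
apply: (@lt_le_trans _ _ (\int[mu]_(y in B) (cst (G x / 2)%:E y))%E).
  by rewrite integral_cst// [X in (_ * X)%E]muB -EFinM lte_fin mulr_gt0// exprn_gt0.
apply: (@le_trans _ _ (\int[mu]_(y in B) (G y)%:E)%E).
  apply: ge0_le_integral => //.
  - by move=> y _; rewrite lee_fin ltW.
  - by apply/measurable_EFinP; exact: measurable_funTS.
apply: ge0_subset_integral => //; first exact/measurable_EFinP.
by move=> y _; rewrite lee_fin.
Qed.

Lemma fourier_realN (f : Rd -> R) (lam : Rd) : cintegrable mu (fun x => (f x)%:C) ->
  Re (fourier (fun x => (f x)%:C) (- lam)) = Re (fourier (fun x => (f x)%:C) lam) /\
  Im (fourier (fun x => (f x)%:C) (- lam)) = - Im (fourier (fun x => (f x)%:C) lam).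
Proof.
move=> intf.
have dN x : dot (- lam) x = - dot lam x by rewrite dotC dotNr dotC.
have [eR eI] : Re \o (fun x => (f x)%:C * ekern (- lam) x) = Re \o (fun x => (f x)%:C * ekern lam x) /\
    Im \o (fun x => (f x)%:C * ekern (- lam) x) = fun x => (-1) * Im ((f x)%:C * ekern lam x).
  split; apply/funext => x.
    by rewrite /= dN opprK cosN !mul0r.
  by rewrite /= dN opprK sinN !mul0r; ring.
rewrite !fourierE /fourier_cst !cReM !cImM {1 3}/cint /= !mul0r !subr0 !addr0; split.
  by congr (_ * _); congr (Rintegral _ _ _).
rewrite -[RHS]mulrN; congr (_ * _); rewrite -mulN1r -RintegralZl//; last exact: cintegrable_Im (cintegrable_ekern lam intf).
by congr (Rintegral _ _ _).
Qed.

(** Otherwise [fourier_prod] at 0, with both factors the bump b, says that the integral of F b(y) F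
    b(-y) is 0. As b is real this integrand is |F b|^2, which is continuous and positive at 0. *)
Lemma inv_cst_neq0 : inv_cst R d != 0.
Proof.
apply/eqP => c0; pose b := bump (0 : Rd) 1.
have tb : tfn (fun x => (b x)%:C) by exact: tfn_bump.
have ib := tfn_cintegrable tb.
pose F : Rd -> C := fourier (fun x => (b x)%:C).
pose G : Rd -> R := fun y => Re (F y) ^+ 2 + Im (F y) ^+ 2.
have [cr ci] := smooth_continuous (smooth_fourier tb).
have cG : continuous G.
  have c2 (g : Rd -> R) : continuous g -> continuous (fun y => g y ^+ 2).
    by move=> cg y; exact: (cvgM (cg y) (cg y)).
  by move=> y; exact: (cvgD (c2 _ cr y) (c2 _ ci y)).
have G0 y : 0 <= G y by rewrite addr_ge0 ?sqr_ge0.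
have RF0 : 0 < Re (F 0).
  rewrite /F fourierE cReM /= mul0r subr0 mulr_gt0//; first by rewrite powR_gt0// mulr_gt0 ?pi_gt0.
  have cb : continuous b by have [] := smooth_continuous (tfn_smooth tb).
  have := integral_continuous_gt0 (x := 0) cb (bump_ge0 _ _).
  rewrite /b bump00 => /(_ ltr01) pos.
  rewrite (_ : Rintegral _ _ _ = \int[mu]_x b x).
    apply: fine_gt0; rewrite pos /=.
    have := integrable_lty measurableT (cintegrable_Re ib).
    by [].
  apply: eq_Rintegral => x _; rewrite /ekern (_ : dot 0 x = 0).
    by rewrite oppr0 cos0 mulr1 mul0r subr0.
  by rewrite dotC -(scale0r (0 : Rd)) dotZr mul0r.
have GF0 : 0 < G 0 by rewrite /G ltr_pwDl ?sqr_ge0// exprn_gt0.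
have := integral_continuous_gt0 cG G0 GF0.
have := fourier_prod 0 tb tb; rewrite c0 mul0r => /esym E0.
have EG : cint mu (fun y => F y * F (0 - y)) = (\int[mu]_y G y)%:C.
  apply: complexP.
    apply: eq_Rintegral => y _; have [h1 h2] := fourier_realN y ib.
    by rewrite sub0r cReM h1 h2 /G /F; ring.
  rewrite [LHS](_ : _ = \int[mu]_y (0 : R)); first by rewrite /Rintegral integral0.
  apply: eq_Rintegral => y _; have [h1 h2] := fourier_realN y ib.
  by rewrite sub0r cImM h1 h2 /F; ring.
have iG : (\int[mu]_y (G y)%:E < +oo)%E.
  have [M _ hM] := fourier_le_wgtV tb.
  have [_] := cintegrable_bounded (cintegrable_fourier tb) (smooth_cmeas (smooth_fourier tb)) 
    (fun x => le_trans (hM x) (ler_piMr (wgtV_bound_ge0 hM) (wgtV_le1 x))).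
  rewrite -/F; congr (_ < _)%E; apply: eq_integral => y _; congr EFin.
  by rewrite cabsM -expr2 cabs_sqr.
have : \int[mu]_y G y = 0 by move: EG; rewrite E0 => /esym[].
rewrite /Rintegral => /eqP; rewrite fine_eq0; last first.
  by rewrite ge0_fin_numE// integral_ge0// => x _; rewrite lee_fin.
by move=> /eqP ->; rewrite ltxx.
Qed.

End positivity.

(** * Mollification of the orthogonality relation *)

Section mollification.
Context {R : realType} {d : nat}.
Local Notation C := R[i].
Local Notation Re := (@complex.Re R).
Local Notation Im := (@complex.Im R).
Local Notation Rd := 'rV[R]_d.
Local Notation mu := (@lebesgue_rV R d).

Lemma wgt_scale_le (s : R) (x : Rd) : `|s| <= 1 -> wgt (s *: x) <= wgt x.
Proof.
move=> s1; apply: ler_prod => i _; rewrite addr_ge0 ?sqr_ge0//= lerD2l mxE exprMn.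
by rewrite ler_piMl ?sqr_ge0// -[s ^+ 2]real_normK ?num_real// expr_le1.
Qed.

Lemma wgtVB_le (x y : Rd) : (wgt (x - y))^-1 <= 2 ^+ d * wgt y / wgt x.
Proof.
rewrite ler_pdivlMr ?wgt_gt0// mulrC ler_pdivrMr ?wgt_gt0//; exact: wgt_peetre.
Qed.

Lemma fourier_modulate phi (y x : Rd) :
  fourier (fun l => cexpi (dot y l) * phi l) x = fourier phi (x - y).
Proof.
rewrite !fourierE; congr (_ * _); apply: eq_cint => l; rewrite ekernDl.
have -> : ekern (- y) l = cexpi (dot y l) by rewrite /ekern dotC dotNr opprK dotC.
by ring.
Qed.

Lemma measurable_affineN (e : R) (x : Rd) : measurable_fun setT (fun z : Rd => x - e *: z).
Proof.
apply: measurable_fun_rV => i; under eq_fun do rewrite !mxE.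
apply: measurable_funB => //; apply: measurable_funM => //; exact: measurable_rV_coord.
Qed.

Let b0 : Rd -> C := fun x => (bump 0 1 x)%:C.
Let tb0 : tfn b0. Proof. exact: tfn_bump. Qed.

(** Test functions whose transforms form an approximate identity at y, up to the factor
    [inv_cst]. *)
Lemma fourier_dilate_modulate (e : R) (y x : Rd) : 0 < e ->
  tfn (fun l => cexpi (dot y l) * b0 (e *: l)) /\
  fourier (fun l => cexpi (dot y l) * b0 (e *: l)) x = (e ^- d)%:C * fourier b0 (e^-1 *: (x - y)).
Proof.
move=> e0; split.
  apply: tfnM (smooth_cexpi y) _.
  by have := tfn_affine 0 (lt0r_neq0 e0) tb0; under eq_fun do rewrite addr0.
by rewrite (fourier_modulate (fun l => b0 (e *: l))) (fourier_scale _ e0 (tfn_cintegrable tb0)).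
Qed.

Variables (h : Rd -> C) (q : Rd -> R) (Q : R).
Hypothesis ih : cintegrable mu (fun x => ((wgt x)^-1)%:C * h x).
Hypothesis mh : cmeas h.
Hypothesis hF : forall psi, tfn psi -> cint mu (fun x => h x * fourier psi x) = 0.
Hypothesis cq : continuous q.
Hypothesis qQ : forall x, `|q x| <= Q / wgt x / wgt x.

Let mq : cmeas (fun x => (q x)%:C).
Proof. by apply: cmeas_real; exact: continuous_measurable_rV. Qed.

Let mqs (e : R) (x : Rd) : cmeas (fun z : Rd => (q (x - e *: z))%:C).
Proof. exact: (cmeas_comp mq (measurable_affineN e x)). Qed.

Let Q0 : 0 <= Q.
Proof.
have := le_trans (normr_ge0 _) (qQ 0).
by rewrite !pmulr_lge0 ?invr_gt0 ?wgt_gt0.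
Qed.

Let qQ1 x : `|q x| <= Q / wgt x.
Proof.
by apply: le_trans (qQ x) _; rewrite ler_piMr ?wgtV_le1// mulr_ge0 ?wgtV_ge0.
Qed.

(** The convolution of q with e^-d F b0(x / e), after the change of variable that confines e to the
    argument of q. It tends to [inv_cst] q(x), since [inv_cst] is the integral of F b0. *)
Let K (e : R) (x : Rd) : C := cint mu (fun z => (q (x - e *: z))%:C * fourier b0 z).

(** After exchanging the integrals, the inner one pairs h with the transform of a test function, for
    each fixed y. *)
Lemma mollify_eq0 (e : R) : 0 < e -> e <= 1 -> cint mu (fun x => h x * K e x) = 0.
Proof.
move=> e0 e1; have [M M0 hM] := fourier_le_wgtV tb0.
have mF0 := smooth_cmeas (smooth_fourier tb0).
have en0 := lt0r_neq0 e0.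
pose F (z : Rd * Rd) := h z.1 * ((e ^- d)%:C * (q z.2)%:C * fourier b0 (e^-1 *: (z.1 - z.2))).
have mL : measurable_fun setT (fun z : Rd * Rd => e^-1 *: (z.1 - z.2)).
  by have := measurable_lin (d := d) e^-1 (- e^-1); under eq_fun do rewrite scaleNr -scalerBr.
have mF : cmeas F.
  apply: cmeasM; first exact: cmeas_fst.
  by apply: cmeasM (cmeasZ _ (cmeas_snd mq)) (cmeas_comp mF0 mL).
have EK x : cint mu (fun y => F (x, y)) = h x * K e x.
  have iq : cintegrable mu (fun z => (q (x - e *: z))%:C * fourier b0 z).
    apply: (cintegrable_bounded (M := Q)) (cintegrable_fourier tb0) _ _.
      exact: mqs.
    by move=> z; rewrite cabsC (le_trans (qQ1 _))// ler_piMr// wgtV_le1.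
  have iF : cintegrable mu (fun y => (q y)%:C * fourier b0 (e^-1 *: (x - y))).
    have := cintegrable_affine (e^-1 *: x) (_ : - e^-1 != 0) iq.
    rewrite oppr_eq0 invr_eq0 en0 => /(_ isT); congr cintegrable; apply/funext => y.
    have -> : x - e *: (- e^-1 *: y + e^-1 *: x) = y by apply/rowP => i; rewrite !mxE; field.
    by have -> : - e^-1 *: y + e^-1 *: x = e^-1 *: (x - y) by apply/rowP => i; rewrite !mxE; ring.
  transitivity (h x * ((e ^- d)%:C * cint mu (fun y => (q y)%:C * fourier b0 (e^-1 *: (x - y))))).
    rewrite -(cintZ (e ^- d)%:C iF) -(cintZ (h x) (cintegrableZ (e ^- d)%:C iF)).
    by apply: eq_cint => y; rewrite /F /=; ring.
  have ne0 : - e != 0 by rewrite oppr_eq0.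
  have ea : `|- e| = e by rewrite normrN gtr0_norm.
  have := cint_affine x ne0 iF; rewrite ea => <-; apply: (congr1 (fun u => h x * u)).
  apply: eq_cint => z.
  have -> : e^-1 *: (x - (- e *: z + x)) = z by apply/rowP => i; rewrite !mxE; field.
  by rewrite scaleNr [- _ + x]addrC.
transitivity (cint mu (fun x => cint mu (fun y => F (x, y)))); first by apply: eq_cint => x; rewrite EK.
(* For e <= 1 the transform is at most M / wgt(x - y), and Peetre turns this into a multiple of
   wgt(y) / wgt(x). The bound [qQ] leaves q wgt integrable. *)
rewrite (@cfubini_prod _ _ F (fun x => ((wgt x)^-1)%:C * h x) 
  (fun y => ((e ^- d) * q y * wgt y * (2 ^+ d * M))%:C)) //.
- rewrite (@eq_cint _ _ _ _ _ (fun=> 0)) ?cint0// => y.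
  have [ty Ey] : tfn (fun l => cexpi (dot y l) * b0 (e *: l)) /\ forall x,
      fourier (fun l => cexpi (dot y l) * b0 (e *: l)) x = (e ^- d)%:C * fourier b0 (e^-1 *: (x - y)).
    by split=> [|x]; have [] := fourier_dilate_modulate y 0 e0; last by have [] := fourier_dilate_modulate y x e0.
  rewrite -(hF (tfnZ (q y)%:C ty)); apply: eq_cint => x.
  by rewrite (fourierZ _ _ (tfn_cintegrable ty)) Ey /F /=; ring.
- apply: (wgtV_cintegrable (M := e ^- d * Q * (2 ^+ d * M))).
    apply: cmeas_real; apply: measurable_funM => //; apply: measurable_funM; last exact: measurable_wgt.
    by apply: measurable_funM => //; exact: continuous_measurable_rV.
  move=> y; rewrite cabsC !normrM (ger0_norm M0).
  have e2 : 0 <= e ^- d by rewrite invr_ge0 exprn_ge0// ltW.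
  rewrite (ger0_norm e2) (ger0_norm (exprn_ge0 _ (ler0n R 2))) (gtr0_norm (wgt_gt0 y)).
  have := qQ y; rewrite ler_pdivlMr ?wgt_gt0// => qy.
  have -> : e ^- d * Q * (2 ^+ d * M) / wgt y = e ^- d * (Q / wgt y) * (2 ^+ d * M) by ring.
  by rewrite ler_wpM2r ?mulr_ge0 ?exprn_ge0// -mulrA ler_wpM2l.
- move=> x y; have -> : F (x, y) = h x * ((e ^- d)%:C * (q y)%:C * fourier b0 (e^-1 *: (x - y))) by [].
  rewrite [cabs (h x * _)]cabsM [cabs (_ * fourier _ _)]cabsM [cabs (_ * (q y)%:C)]cabsM [cabs (_ * h x)]cabsM.
  rewrite !cabsC !normrM.
  rewrite (ger0_norm (wgtV_ge0 x)) (gtr0_norm (wgt_gt0 y)) (ger0_norm M0) (ger0_norm (exprn_ge0 _ (ler0n R 2))).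
  have -> : (wgt x)^-1 * cabs (h x) * (`|e ^- d| * `|q y| * wgt y * (2 ^+ d * M)) =
    cabs (h x) * (`|e ^- d| * `|q y| * (M * (2 ^+ d * wgt y / wgt x))) by ring.
  rewrite ler_wpM2l ?cabs_ge0// ler_wpM2l ?mulr_ge0//.
  apply: le_trans (hM _) _; rewrite ler_wpM2l//.
  apply: le_trans (wgtVB_le x y); rewrite lef_pV2 ?posrE ?wgt_gt0//.
  rewrite -[x - y in leLHS](scale1r) -(mulfV en0) -scalerA.
  by apply: wgt_scale_le; rewrite gtr0_norm.
Qed.

(** Uniform in e: Peetre at the point x - e z costs wgt(z), which the second power of decay of F b0
    pays for. *)
Lemma mollify_le : exists M : R, forall e x, 0 < e -> e <= 1 -> cabs (K e x) <= M / wgt x.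
Proof.
have [M M0 hM] := fourier_le_wgtV2 tb0.
exists (2 * (2 ^+ d * Q * M * wgtV_mass R d)) => e x e0 e1.
have -> : 2 * (2 ^+ d * Q * M * wgtV_mass R d) / wgt x = 2 * ((2 ^+ d * Q * M / wgt x) * wgtV_mass R d).
  by ring.
apply: cint_wgt_le.
  by apply: cmeasM; [exact: mqs|exact: smooth_cmeas (smooth_fourier tb0)].
move=> z; rewrite cabsM cabsC.
have h1 : `|q (x - e *: z)| <= Q * (2 ^+ d * wgt z / wgt x).
  apply: le_trans (qQ1 _) _; rewrite ler_wpM2l//; apply: le_trans (wgtVB_le _ _) _.
  by rewrite ler_wpM2r ?wgtV_ge0// ler_wpM2l ?exprn_ge0// wgt_scale_le// gtr0_norm.
have -> : 2 ^+ d * Q * M / wgt x / wgt z = Q * (2 ^+ d * wgt z / wgt x) * (M / wgt z / wgt z).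
  by field; rewrite !gt_eqF ?wgt_gt0.
by rewrite ler_pM ?cabs_ge0.
Qed.

(** Dominated convergence along e = 1 / (n + 1), with the majorant M |h| / wgt; then divide by
    [inv_cst]. *)
Lemma cint_mul_eq0 : cint mu (fun x => (q x)%:C * h x) = 0.
Proof.
have [M hM] := mollify_le.
have e0 n : 0 < n.+1%:R^-1 :> R by rewrite invr_gt0.
have e1 n : n.+1%:R^-1 <= 1 :> R by rewrite invf_le1 ?ler1n.
have mF0 := smooth_cmeas (smooth_fourier tb0).
have cvK x : cabs (K n.+1%:R^-1 x - (q x)%:C * inv_cst R d) @[n --> \oo] --> (0 : R).
  rewrite -(cintZ (q x)%:C (cintegrable_fourier tb0)).
  apply: (@dominated_cint _ _ _ _ _ _ (fun z => Q * cabs (fourier b0 z))).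
  - by move=> n; apply: cmeasM.
  - exact: cmeasZ.
  - by apply: measurable_funM => //; exact: measurable_cabs.
  - have [_] := cintegrableZ (Q%:C) (cintegrable_fourier tb0).
    by under eq_integral do rewrite cabsM cabsC ger0_norm//.
  - move=> n z; rewrite cabsM ler_wpM2r ?cabs_ge0// cabsC.
    by rewrite (le_trans (qQ1 _))// ler_piMr// wgtV_le1.
  - move=> z; have cqC : ccontinuous (fun x : Rd => (q x)%:C) by split => //; exact: cst_continuous.
    have := seq_cvg_cabs x (- z) cqC.
    rewrite (_ : (fun n => cabs ((q (x - n.+1%:R^-1 *: z))%:C * fourier b0 z - (q x)%:C * fourier b0 z)) =
        fun n => cabs ((q (x + n.+1%:R^-1 *: - z))%:C - (q x)%:C) * cabs (fourier b0 z)); last first.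
      by apply/funext => n; rewrite -mulrBl cabsM scalerN.
    by move=> hc; rewrite -[X in _ --> X](mul0r (cabs (fourier b0 z))); exact: (cvgM hc (cvg_cst _)).
have mK n : cmeas (K n.+1%:R^-1).
  have mF : cmeas (fun z : Rd * Rd => (q (z.1 - n.+1%:R^-1 *: z.2))%:C * fourier b0 z.2).
    apply: cmeasM; last exact: cmeas_snd.
    apply: (cmeas_comp mq).
    rewrite (_ : (fun _ => _) = fun z : Rd * Rd => 1 *: z.1 + (- n.+1%:R^-1) *: z.2).
      exact: measurable_lin.
    by apply/funext => z; rewrite scale1r scaleNr.
  exact: (cmeas_cint mu mF).
have M0 : 0 <= M by exact: wgtV_bound_ge0 (fun x => hM _ x (e0 0%N) (e1 0%N)).
have key : cabs (cint mu (fun x => h x * K n.+1%:R^-1 x) - cint mu (fun x => h x * ((q x)%:C * inv_cst R d)))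
    @[n --> \oo] --> (0 : R).
  apply: (@dominated_cint _ _ _ _ (fun n x => h x * K n.+1%:R^-1 x) _ (fun x => M * cabs (((wgt x)^-1)%:C * h x))).
  - by move=> n; exact: cmeasM.
  - by apply: cmeasM => //; apply: cmeasM => //; exact: cmeas_cst.
  - by apply: measurable_funM => //; apply: measurable_cabs; case: ih.
  - have [_] := cintegrableZ (M%:C) ih.
    by under eq_integral do rewrite cabsM cabsC ger0_norm//.
  - move=> n x; rewrite !cabsM cabsC (ger0_norm (wgtV_ge0 x)) mulrA [leRHS]mulrC.
    by rewrite ler_wpM2l ?cabs_ge0// hM.
  - move=> x.
    rewrite (_ : (fun n => cabs (h x * K n.+1%:R^-1 x - h x * ((q x)%:C * inv_cst R d))) =
        fun n => cabs (h x) * cabs (K n.+1%:R^-1 x - (q x)%:C * inv_cst R d)); last first.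
      by apply/funext => n; rewrite -mulrBr cabsM.
    by rewrite -[X in _ --> X](mulr0 (cabs (h x))); exact: (cvgM (cvg_cst _) (cvK x)).
have z0 : cint mu (fun x => h x * ((q x)%:C * inv_cst R d)) = 0.
  apply: (cabs_cvg_unique key).
  by rewrite (_ : (fun n => _) = cst 0); [exact: cvg_cst|apply/funext => n; rewrite mollify_eq0// subrr cabs0].
have iqh : cintegrable mu (fun x => (q x)%:C * h x).
  apply: (le_cintegrable (G := fun x => Q * cabs (((wgt x)^-1)%:C * h x))).
  - exact: cmeasM.
  - by apply: measurable_funM => //; apply: measurable_cabs; case: ih.
  - by move=> x; rewrite !cabsM !cabsC (ger0_norm (wgtV_ge0 x)) mulrA ler_wpM2r ?cabs_ge0.
  - have [_] := cintegrableZ (Q%:C) ih.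
    by under eq_integral do rewrite cabsM cabsC ger0_norm//.
have := cintZ (inv_cst R d) iqh; rewrite (_ : cint mu _ = 0).
  by move/esym/eqP; rewrite mulf_eq0 (negbTE inv_cst_neq0) => /eqP.
by rewrite -z0; apply: eq_cint => x; ring.
Qed.

End mollification.

(** * From vanishing integrals to vanishing almost everywhere *)

Section density.
Context {R : realType} {disp : measure_display} {T : measurableType disp}.
Variables (mu : {measure set T -> \bar R}) (f : T -> \bar R).
Hypotheses (mf : measurable_fun setT f) (f0 : forall x, (0 <= f x)%E).

(* The proofs are arguments so that the measure structure below can be inferred. *)
Definition density of measurable_fun setT f & (forall x, (0 <= f x)%E) : set T -> \bar R :=
  fun A => (\int[mu]_(x in A) f x)%E.

Let density0 : density mf f0 set0 = 0%E.
Proof. by rewrite /density integral_set0. Qed.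

Let density_ge0 A : (0 <= density mf f0 A)%E.
Proof. exact: integral_ge0. Qed.

Let density_sigma_additive : semi_sigma_additive (density mf f0).
Proof.
move=> /= F mF tF mUF; rewrite /density ge0_integral_bigcup//.
  by apply: is_cvg_ereal_nneg_natsum_cond => n _ _; exact: integral_ge0.
exact: measurable_funTS.
Qed.

HB.instance Definition _ := isMeasure.Build _ _ _ (density mf f0) density0 density_ge0 density_sigma_additive.

End density.

Section orthant.
Context {R : realType} {d : nat}.
Local Notation Rd := 'rV[R]_d.
Local Notation mu := (@lebesgue_rV R d).

(** An intersection-stable family that generates the measurable sets and has indicators that are
    limits of continuous functions. *)
Definition orthant (a : Rd) : set Rd := [set x | forall i, a 0 i < x 0 i].

Lemma measurable_orthant a : measurable (orthant a).
Proof.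
rewrite (_ : orthant a = \bigcap_(i in [set: 'I_d]) ((fun y : Rd => y 0 i) @^-1` [set z | a 0 i < z])).
  apply: fin_bigcap_measurable => // i _.
  rewrite -[X in measurable X]setTI; apply: measurable_rV_coord => //.
  by rewrite -set_itvoy; exact: measurable_itv.
by apply/seteqP; split=> y /= h i; [move=> _|]; exact: h.
Qed.

Lemma orthantI a b : orthant a `&` orthant b = orthant (\row_i Num.max (a 0 i) (b 0 i)).
Proof.
apply/seteqP; split=> [x [ax bx] i|x h]; first by rewrite mxE gt_max ax bx.
by split=> i; have := h i; rewrite mxE gt_max => /andP[].
Qed.

Lemma measurable_orthants : (measurable : set (set Rd)) = <<s range orthant >>.
Proof.
apply/seteqP; split; last first.
  apply: smallest_sub; first exact: sigma_algebra_measurable.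
  by move=> _ [a _ <-]; exact: measurable_orthant.
apply: smallest_sub; first exact: smallest_sigma_algebra.
move=> A; rewrite -bigcup_seq => -[i _ [B mB <-]].
have mi : measurable_fun (setT : set (g_sigma_algebraType (range orthant))) (fun x : Rd => x 0 i).
  apply: (measurability _ (RGenOInfty.measurableE R)) => //.
  move=> /= _ [_ [a ->] <-]; rewrite setTI set_itvoy.
  (* A half-space is exhausted by orthants whose other corner coordinates tend to minus infinity. *)
  rewrite (_ : _ @^-1` _ = \bigcup_n orthant (\row_j (if j == i then a else - n%:R))).
    apply: bigcupT_measurable => n; apply: sub_sigma_algebra.
    by exists (\row_j (if j == i then a else - n%:R)).
  apply/seteqP; split=> [x /= ax|x [n _] /(_ i) /=].
    have [n hn] : exists n : nat, `|x| < n%:R.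
      by exists (Num.truncn `|x|).+1; exact: truncnS_gt.
    exists n => // j; rewrite mxE; case: eqP => [->//|_].
    by rewrite ltrNl (le_lt_trans _ hn)// (le_trans _ (coord_le_norm x j))// -normrN ler_norm.
  by rewrite mxE eqxx.
by have := mi measurableT B mB.
Qed.

Lemma orthant_cover : \bigcup_n orthant (const_mx (- n%:R)) = setT.
Proof.
apply/seteqP; split => // x _; exists (Num.truncn `|x|).+1 => // j; rewrite mxE.
rewrite ltrNl (le_lt_trans _ (truncnS_gt _))// (le_trans _ (coord_le_norm x j))//.
by rewrite -normrN ler_norm.
Qed.

(** The positive and negative parts of m are densities of two measures that agree on orthants, hence
    everywhere; so m integrates to 0 over every measurable set. *)
Lemma orthant_integral_eq0 (m : Rd -> R) : mu.-integrable setT (EFin \o m) ->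
  (forall a, \int[mu]_(x in orthant a) (m x)%:E = 0)%E -> {ae mu, forall x, m x = 0}.
Proof.
move=> im m0; have mm : measurable_fun setT (EFin \o m) by case/integrableP: im.
have iS A : measurable A -> mu.-integrable A (EFin \o m) by move=> mA; exact: integrableS im.
pose f1 := (EFin \o m)^\+%E; pose f2 := (EFin \o m)^\-%E.
have f10 x : (0 <= f1 x)%E by exact: funepos_ge0.
have f20 x : (0 <= f2 x)%E by exact: funeneg_ge0.
have mf1 : measurable_fun setT f1 by exact: measurable_funepos.
have mf2 : measurable_fun setT f2 by exact: measurable_funeneg.
have fin1 A : measurable A -> (\int[mu]_(x in A) f1 x)%E \is a fin_num.
  by move=> mA; apply: integrable_pos_fin_num => //; exact: iS.
have fin2 A : measurable A -> (\int[mu]_(x in A) f2 x)%E \is a fin_num.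
  by move=> mA; apply: integrable_neg_fin_num => //; exact: iS.
have E A : measurable A -> density mu mf1 f10 A = density mu mf2 f20 A.
  move=> mA; apply: (@measure_unique _ _ _ (range orthant) (fun n => orthant (const_mx (- n%:R)))) => //.
  - exact: measurable_orthants.
  - by move=> _ _ [a _ <-] [b _ <-]; rewrite orthantI; exists (\row_i Num.max (a 0 i) (b 0 i)).
  - exact: orthant_cover.
  - move=> _ [a _ <-]; have := m0 a; rewrite integralE => /eqP.
    have mo := measurable_orthant a.
    by rewrite sube_eq ?fin1 ?fin_num_adde_defl ?fin2// add0e => /eqP.
  - move=> n; have := fin1 _ (measurable_orthant (const_mx (- n%:R))).
    by rewrite ge0_fin_numE//; exact: integral_ge0.
have := @integral_ae_eq _ _ _ mu setT measurableT (cst 0%E) (EFin \o m) im (measurable_cst _).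
have h A : A `<=` setT -> measurable A -> (\int[mu]_(x in A) (EFin \o m) x = \int[mu]_(x in A) cst 0 x)%E.
  move=> _ mA; rewrite integral0 integralE; have := E A mA; rewrite /density -/f1 -/f2 => ->.
  by rewrite subee// fin2.
by move=> /(_ h); apply: filterS => x /= /(_ Logic.I) [].
Qed.

End orthant.

Section uniqueness.
Context {R : realType} {d : nat}.
Local Notation C := R[i].
Local Notation Re := (@complex.Re R).
Local Notation Im := (@complex.Im R).
Local Notation Rd := 'rV[R]_d.
Local Notation mu := (@lebesgue_rV R d).

Lemma continuous_wgtV : continuous (fun x : Rd => (wgt x)^-1).
Proof.
have [cw _] := smooth_continuous (smooth_wgt (R := R) (d := d)).
by move=> x; exact: (cvgV (lt0r_neq0 (wgt_gt0 x)) (cw x)).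
Qed.

Definition soft_orthant (a : Rd) (k : nat) (x : Rd) : R := \prod_i step (k%:R * x 0 i - k%:R * a 0 i).

Lemma soft_orthant_ge0 a k x : 0 <= soft_orthant a k x.
Proof. by apply: prodr_ge0 => i _; exact: step_ge0. Qed.

Lemma soft_orthant_le1 a k x : soft_orthant a k x <= 1.
Proof. by apply: prodr_ile1 => i; rewrite step_ge0 step_le1. Qed.

Lemma continuous_soft_orthant a k : continuous (soft_orthant a k).
Proof.
have : smooth (fun x : Rd => \prod_i (step (k%:R * x 0 i + - (k%:R * a 0 i)))%:C).
  by apply: smooth_prod => i; exact: smooth_step.
rewrite (_ : (fun _ => _) = fun x => (soft_orthant a k x)%:C); first by move=> /smooth_continuous[].
by apply/funext => x; rewrite rmorph_prod.
Qed.

Lemma soft_orthant_cvg a x : soft_orthant a k x @[k --> \oo] --> (\1_(orthant a) x : R).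
Proof.
have [ax|ax] := pselect (orthant a x); last first.
  have -> : \1_(orthant a) x = 0 :> R by rewrite indicE memNset.
  rewrite (_ : (fun k => _) = cst 0); first exact: cvg_cst.
  apply/funext => k; move/existsNP: ax => [i /negP]; rewrite -leNgt => xi.
  rewrite /soft_orthant (bigD1 i)//= step0 ?mul0r// -mulrBr.
  by rewrite mulr_ge0_le0// subr_le0.
have -> : \1_(orthant a) x = 1 :> R by rewrite indicE mem_set.
apply: cvg_near_cst.
have h i : \forall k \near \oo, step (k%:R * x 0 i - k%:R * a 0 i) = 1 :> R.
  near=> k; apply: step1; rewrite -mulrBr -ler_pdivrMr ?subr_gt0//.
  by near: k; exact: nbhs_infty_ger.
have : \forall k \near \oo, forall i : 'I_d, step (k%:R * x 0 i - k%:R * a 0 i) = 1 :> R.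
  exact: filter_forall.
by apply: filterS => k hk; rewrite /soft_orthant big1.
Unshelve. all: by end_near.
Qed.

Lemma fourier_orthogonal_eq0 (h : Rd -> C) : cmeas h ->
  cintegrable mu (fun x => ((wgt x)^-1)%:C * h x) ->
  (forall psi, tfn psi -> cint mu (fun x => h x * fourier psi x) = 0) ->
  {ae mu, forall x, h x = 0}.
Proof.
move=> mh ih hF.
(* Soft orthants do not decay, so this factor supplies what [cint_mul_eq0] asks of q. It is positive
   and drops out at the end. *)
pose w2 (x : Rd) : R := (wgt x)^-1 / wgt x.
have w20 x : 0 <= w2 x by rewrite mulr_ge0 ?wgtV_ge0.
have mw2 : measurable_fun setT w2 by apply: measurable_funM; exact: measurable_wgtV.
have cw2 : continuous w2.
  by move=> x; exact: (cvgM (@continuous_wgtV x) (@continuous_wgtV x)).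
have iw2 : cintegrable mu (fun x => (w2 x)%:C * h x).
  have := cintegrable_bounded (M := 1) ih (cmeas_real (measurable_wgtV (R := R) (d := d))).
  have -> : (fun x : Rd => ((wgt x)^-1)%:C * (((wgt x)^-1)%:C * h x)) = fun x => (w2 x)%:C * h x.
    by apply/funext => x; rewrite mulrA -rmorphM.
  by apply=> x; rewrite cabsC ger0_norm ?wgtV_ge0 ?wgtV_le1.
have soft a k : cint mu (fun x => (soft_orthant a k x)%:C * ((w2 x)%:C * h x)) = 0.
  rewrite (@eq_cint _ _ _ _ _ (fun x => (soft_orthant a k x * w2 x)%:C * h x)); last first.
    by move=> x; rewrite mulrA -rmorphM.
  apply: (@cint_mul_eq0 _ _ h (fun x => soft_orthant a k x * w2 x) 1) => //.
    by move=> x; exact: (cvgM (@continuous_soft_orthant a k x) (cw2 x)).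
  move=> x; rewrite normrM (ger0_norm (w20 x)) (ger0_norm (soft_orthant_ge0 a k x)) div1r.
  by rewrite ler_piMl// soft_orthant_le1.
have ind a : cint mu (fun x => ((\1_(orthant a) x)%:C : C) * ((w2 x)%:C * h x)) = 0.
  have ms k : cmeas (fun x : Rd => (soft_orthant a k x)%:C).
    by apply: cmeas_real; apply: continuous_measurable_rV; exact: continuous_soft_orthant.
  have mi : cmeas (fun x : Rd => (\1_(orthant a) x : R)%:C).
    by apply: cmeas_real; apply: measurable_indic; exact: measurable_orthant.
  have mw : cmeas (fun x => (w2 x)%:C * h x) by case: iw2.
  have : cabs (cint mu (fun x => (soft_orthant a n x)%:C * ((w2 x)%:C * h x)) -
      cint mu (fun x => (\1_(orthant a) x)%:C * ((w2 x)%:C * h x))) @[n --> \oo] --> (0 : R).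
    apply: (@dominated_cint _ _ _ _ _ _ (fun x => cabs ((w2 x)%:C * h x))).
    - by move=> n; exact: cmeasM.
    - exact: cmeasM.
    - exact: measurable_cabs.
    - by case: iw2.
    - move=> n x; rewrite cabsM cabsC ler_piMl ?cabs_ge0// ger0_norm ?soft_orthant_ge0//.
      exact: soft_orthant_le1.
    - move=> x; rewrite (_ : (fun n => _) = fun n => `|soft_orthant a n x - \1_(orthant a) x| * cabs ((w2 x)%:C * h x)).
        rewrite -[X in _ --> X](mul0r (cabs ((w2 x)%:C * h x))).
        exact: (cvgM (cvgr_normB0 (@soft_orthant_cvg a x)) (cvg_cst _)).
      apply/funext => n; rewrite -mulrBl.
      have -> : (soft_orthant a n x)%:C - (\1_(orthant a) x)%:C = (soft_orthant a n x - \1_(orthant a) x)%:C :> C.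
        by rewrite rmorphB.
      by rewrite [LHS]cabsM cabsC.
  move=> /cabs_cvg_unique; apply.
  by rewrite (_ : (fun n => _) = cst 0); [exact: cvg_cst|apply/funext => n; rewrite soft subr0 cabs0].
have part (pr : C -> R) : (forall (r : R) z, pr (r%:C * z) = r * pr z) ->
    mu.-integrable setT (EFin \o (pr \o (fun x => (w2 x)%:C * h x))) ->
    (forall a, \int[mu]_x pr ((\1_(orthant a) x)%:C * ((w2 x)%:C * h x)) = 0) ->
    {ae mu, forall x, pr (h x) = 0}.
  move=> prZ ipr pr0.
  have : {ae mu, forall x, (pr \o (fun x => (w2 x)%:C * h x)) x = 0}.
    apply: orthant_integral_eq0 => // a.
    have := pr0 a; rewrite /Rintegral => /eqP.
    have mo := measurable_orthant a.
    have E : (\int[mu]_x (pr ((\1_(orthant a) x)%:C * ((w2 x)%:C * h x)))%:E =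
        \int[mu]_(x in orthant a) (pr ((w2 x)%:C * h x))%:E)%E.
      rewrite [RHS]integral_mkcond; apply: eq_integral => x _; rewrite patchE !prZ indicE.
      by case: (x \in orthant a); rewrite ?mul1r ?mul0r.
    rewrite E fine_eq0; first by move/eqP.
    by apply: integrable_fin_num => //; exact: integrableS ipr.
  apply: filterS => x /=; rewrite prZ => /eqP; rewrite mulf_eq0 => /orP[|/eqP//].
  by rewrite mulf_eq0 !invr_eq0 orbb gt_eqF// wgt_gt0.
have hR : {ae mu, forall x, Re (h x) = 0}.
  apply: part; first by move=> r z; rewrite cReM /= mul0r subr0.
    exact: cintegrable_Re.
  by move=> a; have := ind a => -[].
have hI : {ae mu, forall x, Im (h x) = 0}.
  apply: part; first by move=> r z; rewrite cImM /= mul0r addr0.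
    exact: cintegrable_Im.
  by move=> a; have := ind a => -[].
by apply: filterS2 hR hI => x hr hi; exact: complexP.
Qed.

End uniqueness.

(** * Weighted Lp estimates *)

Section Lp.
Context {R : realType} {d : nat}.
Local Notation C := R[i].
Local Notation Rd := 'rV[R]_d.
Local Notation mu := (@lebesgue_rV R d).
Local Notation W := (wgtV_mass R d).
Implicit Types (p : \bar R) (g h k : Rd -> C).

(* [|g|_p <= c] iff [int gauge p (|g| / c) <= 1], which treats [p = oo] and [p < oo] alike. *)
Definition gauge p (t : R) : \bar R :=
  match p with
  | r%:E => (t `^ r)%:E
  | +oo%E => if t <= 1 then 0%E else +oo%E
  | -oo%E => 0%E
  end.

Lemma gauge_ge0 p t : (0 <= gauge p t)%E.
Proof. by case: p => [r||] //=; [rewrite lee_fin powR_ge0|case: ifP]. Qed.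

Lemma measurable_gauge p : measurable_fun setT (gauge p).
Proof.
case: p => [r||]; last exact: measurable_cst.
  by apply/measurable_EFinP; exact: measurable_powR.
apply: measurable_fun_ifT => //; exact: measurable_fun_ler.
Qed.

(** Replaces Hoelder's inequality: integrated against the finite measure dx / wgt, it embeds L^p
    into L^1(dx / wgt) for all p at once. *)
Lemma gauge_lin p t : (1 <= p)%E -> 0 <= t -> (t%:E <= 1 + gauge p t)%E.
Proof.
move=> p1 t0; case: p p1 => [r|_|//] /=; last first.
  by case: ifP => t1; rewrite ?adde0 ?lee_fin// leey.
rewrite lee_fin => r1; rewrite -EFinD lee_fin; have [t1|/ltW t1] := lerP t 1.
  by rewrite ler_wpDr// powR_ge0.
by rewrite ler_wpDl// le1r_powR.
Qed.

Lemma le_gauge p (s t : R) : (1 <= p)%E -> 0 <= s -> s <= t -> (gauge p s <= gauge p t)%E.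
Proof.
case: p => [r|_|//] /=.
  rewrite !lee_fin => r1 s0 st.
  by apply: ge0_ler_powR => //; rewrite ?nnegrE ?(le_trans ler01 r1)// (le_trans s0).
by move=> s0 st; case: ifP => s1; case: ifP => t1 //; rewrite (le_trans st t1) in s1.
Qed.

(** [Lnorm] at +oo is the essential supremum only on a space of positive measure. *)
Lemma mu_setT_gt0 : (0 < mu setT)%E.
Proof.
have := @integral_continuous_gt0 R d (cst 1) 0 (@cst_continuous _ _ _) (fun=> ler01) ltr01.
by rewrite (_ : (\int[mu]_x _)%E = (\int[mu]_x cst 1%:E x)%E)// integral_cst// mul1e.
Qed.

Lemma measurable_gauge_cabs p g (c : R) : cmeas g -> measurable_fun setT (fun x => gauge p (cabs (g x) / c)).
Proof.
move=> mg; apply: (measurableT_comp (measurable_gauge p)).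
by apply: measurable_funM => //; exact: measurable_cabs.
Qed.

Lemma Lp_norm_leP p g (c : R) : (1 <= p)%E -> cmeas g -> 0 < c ->
  (Lp_norm p g <= c%:E)%E <-> (\int[mu]_x gauge p (cabs (g x) / c) <= 1)%E.
Proof.
move=> p1 mg c0; case: p p1 => [r||//].
  rewrite lee_fin => r1; have r0 : 0 < r by exact: lt_le_trans r1.
  have rn0 : r != 0 by rewrite gt_eqF.
  pose X := (\int[mu]_x `|(cabs (g x))%:E| `^ r)%E.
  have -> : Lp_norm r%:E g = (X `^ r^-1)%E by rewrite /Lp_norm unlock.
  have X0 : (0 <= X)%E by apply: integral_ge0 => x _; exact: poweR_ge0.
  have -> : (\int[mu]_x gauge r%:E (cabs (g x) / c) = ((c `^ r)^-1)%:E * X)%E.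
    rewrite -ge0_integralZl//.
    - apply: eq_integral => x _; rewrite gee0_abs ?cabs_gee0// poweR_EFin -EFinM; congr EFin.
      rewrite powRM ?cabs_ge0 ?invr_ge0 1?ltW// mulrC; congr (_ * _).
      by rewrite -[c^-1]powR_inv1 ?(ltW c0)// -powRrM mulrC powRrM powR_inv1 ?powR_ge0.
    - apply: (measurableT_comp (measurable_poweR _)).
      by apply: measurableT_comp => //; exact: measurable_cabsE.
    - by move=> x _; exact: poweR_ge0.
    - by rewrite lee_fin invr_ge0 powR_ge0.
  have cr0 : 0 < c `^ r by rewrite powR_gt0.
  have -> : (((c `^ r)^-1)%:E * X <= 1)%E = (X <= (c `^ r)%:E)%E.
    by rewrite -[RHS](@lee_pmul2l _ ((c `^ r)^-1)%:E) ?lte_fin ?invr_gt0//= -EFinM mulVf ?gt_eqF.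
  have mem (x : \bar R) : (0 <= x)%E -> x \in `[0%E, +oo%E] by move=> x0; rewrite in_itv; apply/andP; split => //; exact: leey.
  split=> h.
    have := gt0_ler_poweR (ltW r0) (mem _ (poweR_ge0 X r^-1)) (mem c%:E _) h.
    by rewrite -poweRrM mulVf// poweRe1// poweR_EFin lee_fin; apply; exact: ltW.
  have ri0 : 0 <= r^-1 by rewrite invr_ge0 ltW.
  have cE : (0 <= (c `^ r)%:E)%E by rewrite lee_fin powR_ge0.
  have := gt0_ler_poweR ri0 (mem _ X0) (mem _ cE) h.
  by rewrite poweR_EFin -powRrM mulfV// powRr1// ltW.
move=> _; rewrite {1}/Lp_norm unlock mu_setT_gt0.
have mG := measurable_gauge_cabs +oo%E c mg.
have -> : (ess_sup mu (abse \o (fun x => (cabs (g x))%:E)) <= c%:E)%E <-> {ae mu, forall x, cabs (g x) <= c}.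
  split.
    move=> /ess_supP; apply: filterS => x /=; rewrite lee_fin ger0_norm ?cabs_ge0//.
  by move=> h; apply/ess_supP; apply: filterS h => x /=; rewrite lee_fin ger0_norm ?cabs_ge0.
(* At p = oo the gauge takes the values 0 and +oo, so its integral is at most 1 exactly when it
   vanishes almost everywhere. *)
have h1 x : cabs (g x) <= c <-> gauge +oo (cabs (g x) / c) = 0%E.
  by rewrite /= ler_pdivrMr// mul1r; case: ifP.
split=> [h|h].
  rewrite (_ : (\int[mu]_x _)%E = 0%E)//.
  have /(ae_eq_integral_abs mu measurableT mG) : ae_eq mu setT (fun x => gauge +oo (cabs (g x) / c)) (cst 0%E).
    by apply: filterS h => x /h1.
  by under eq_integral do rewrite gee0_abs ?gauge_ge0//.
pose A := [set x : Rd | ~ (cabs (g x) <= c)].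
have mA : measurable A.
  rewrite (_ : A = (fun x => cabs (g x)) @^-1` [set z | c < z]).
    by rewrite -[X in measurable X]setTI -set_itvoy; apply: measurable_cabs.
  by apply/seteqP; split=> x /=; [move=> /negP; rewrite -ltNge|rewrite ltNge => /negP].
exists A; split => //.
apply/eqP/negPn/negP => muA.
have : (\int[mu]_(x in A) cst +oo x <= 1)%E.
  apply: le_trans h; apply: (@le_trans _ _ (\int[mu]_(x in A) gauge +oo (cabs (g x) / c))%E).
    apply: ge0_le_integral => //.
    - by move=> x _; exact: leey.
    - exact: measurable_funTS.
    - by move=> x /=; rewrite ler_pdivrMr// mul1r; case: ifP.
  by apply: ge0_subset_integral => // x _; exact: gauge_ge0.
by rewrite integral_cst// gt0_mulye// lt0e muA measure_ge0.
Qed.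

Lemma Lp_norm_ae_le p g h (c : R) : (1 <= p)%E -> cmeas g -> cmeas h -> 0 < c ->
  {ae mu, forall x, g x = h x} -> (Lp_norm p h <= c%:E)%E -> (Lp_norm p g <= c%:E)%E.
Proof.
move=> p1 mg mh c0 gh /(Lp_norm_leP p1 mh c0) hc; apply/(Lp_norm_leP p1 mg c0).
rewrite (ge0_ae_eq_integral (g := fun x => gauge p (cabs (h x) / c)))//.
- exact: measurable_gauge_cabs.
- exact: measurable_gauge_cabs.
- by move=> x _; exact: gauge_ge0.
- by move=> x _; exact: gauge_ge0.
- by apply: filterS gh => x ->.
Qed.

Lemma int_wgt_le p g (c : R) : (1 <= p)%E -> cmeas g -> 0 < c -> (Lp_norm p g <= c%:E)%E ->
  (\int[mu]_x (cabs (((wgt x)^-1)%:C * g x))%:E <= (c * (W + 1))%:E)%E.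
Proof.
move=> p1 mg c0 /(Lp_norm_leP p1 mg c0) hc.
have mG := measurable_gauge_cabs p c mg.
have mw := measurable_wgtV (R := R) (d := d).
have le1 x : ((cabs (((wgt x)^-1)%:C * g x))%:E <= c%:E * (((wgt x)^-1)%:E + gauge p (cabs (g x) / c)))%E.
  rewrite cabsM cabsC ger0_norm ?wgtV_ge0//.
  have E : (wgt x)^-1 * cabs (g x) = c * ((wgt x)^-1 * (cabs (g x) / c)).
    by field; rewrite !gt_eqF ?wgt_gt0.
  rewrite E EFinM lee_pmul2l//= EFinM.
  apply: (@le_trans _ _ (((wgt x)^-1)%:E * (1 + gauge p (cabs (g x) / c)))%E).
    by rewrite lee_wpmul2l ?lee_fin ?wgtV_ge0// gauge_lin// divr_ge0 ?cabs_ge0 ?ltW.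
  rewrite ge0_muleDr ?gauge_ge0// mule1 leeD2l// -[leRHS]mul1e.
  by rewrite lee_wpmul2r ?gauge_ge0// lee_fin wgtV_le1.
apply: (@le_trans _ _ (\int[mu]_x (c%:E * (((wgt x)^-1)%:E + gauge p (cabs (g x) / c))))%E).
  apply: ge0_le_integral => //.
  - by move=> x _; rewrite lee_fin cabs_ge0.
  - by apply: measurable_cabsE; apply: cmeasM => //; exact: cmeas_real.
  - apply: emeasurable_funM => //; apply: emeasurable_funD => //; exact/measurable_EFinP.
rewrite ge0_integralZl//; last 3 first.
- by apply: emeasurable_funD => //; exact/measurable_EFinP.
- by move=> x _; rewrite adde_ge0 ?gauge_ge0// lee_fin wgtV_ge0.
- by rewrite lee_fin ltW.
rewrite EFinM lee_pmul2l//= ge0_integralD//; last 3 first.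
- by move=> x _; rewrite lee_fin wgtV_ge0.
- exact/measurable_EFinP.
- by move=> x _; exact: gauge_ge0.
by rewrite wgtV_massE EFinD leeD2l.
Qed.

Lemma Lp_cintegrable_wgt p g : (1 <= p)%E -> cmeas g -> (Lp_norm p g < +oo)%E ->
  cintegrable mu (fun x => ((wgt x)^-1)%:C * g x).
Proof.
move=> p1 mg goo; split; first by apply: cmeasM => //; apply: cmeas_real; exact: measurable_wgtV.
have N0 : (0 <= Lp_norm p g)%E by exact: Lnorm_ge0.
apply: le_lt_trans (ltry ((fine (Lp_norm p g) + 1) * (W + 1))).
apply: (int_wgt_le p1 mg).
  by rewrite ltr_pwDr// fine_ge0.
by rewrite -[leLHS]fineK ?ge0_fin_numE// lee_fin lerDl.
Qed.

Lemma wgtV_mass_gt0 : 0 < W.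
Proof.
have h : (0 < \int[mu]_x ((wgt x)^-1)%:E)%E.
  apply: (integral_continuous_gt0 (x := 0)); first exact: continuous_wgtV.
    exact: wgtV_ge0.
  by rewrite invr_gt0 wgt_gt0.
by rewrite -lte_fin -wgtV_massE.
Qed.

(** The coefficients a and q are left free, to be chosen according to p in [gauge_mean_le]. *)
Lemma int_gauge_wgt_ge p (G : Rd -> R) (J a q : R) : 0 <= a -> 0 <= q -> measurable_fun setT G -> (forall x, 0 <= G x) ->
  (\int[mu]_x (G x / wgt x)%:E = J%:E)%E ->
  (forall x, (G x)%:E <= a%:E + q%:E * gauge p (G x))%E ->
  (J%:E <= (a * W)%:E + q%:E * \int[mu]_x (((wgt x)^-1)%:E * gauge p (G x)))%E.
Proof.
move=> a0 q0 mG G0 GJ h.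
have mw := measurable_wgtV (R := R) (d := d).
have mwE : measurable_fun setT (fun x : Rd => ((wgt x)^-1)%:E) by exact/measurable_EFinP.
have mI : measurable_fun setT (fun x => (((wgt x)^-1)%:E * gauge p (G x))%E).
  by apply: emeasurable_funM => //; exact: (measurableT_comp (measurable_gauge p)).
have w0 (x : Rd) : (0 <= ((wgt x)^-1)%:E)%E by rewrite lee_fin wgtV_ge0.
have I0 x : (0 <= ((wgt x)^-1)%:E * gauge p (G x))%E by rewrite mule_ge0 ?gauge_ge0.
rewrite -GJ EFinM -wgtV_massE -ge0_integralZl//.
rewrite -ge0_integralZl// -ge0_integralD//.
- apply: ge0_le_integral => //.
  + by move=> x _; rewrite lee_fin mulr_ge0// wgtV_ge0.
  + by apply/measurable_EFinP; exact: measurable_funM.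
  + by apply: emeasurable_funD; exact: emeasurable_funM.
  + move=> x _; rewrite mulrC EFinM.
    have -> : (a%:E * ((wgt x)^-1)%:E + q%:E * (((wgt x)^-1)%:E * gauge p (G x)) =
        ((wgt x)^-1)%:E * (a%:E + q%:E * gauge p (G x)))%E.
      by rewrite ge0_muleDr ?mule_ge0 ?gauge_ge0// muleC muleCA.
    by rewrite lee_wpmul2l.
- by move=> x _; rewrite mule_ge0.
- exact: emeasurable_funM.
- by move=> x _; rewrite mule_ge0.
- exact: emeasurable_funM.
Qed.

(* A weak form of Jensen's inequality for the finite measure [dx / wgt x]. *)
Lemma gauge_mean_le p (G : Rd -> R) (J : R) : (1 <= p)%E -> measurable_fun setT G -> (forall x, 0 <= G x) ->
  (\int[mu]_x (G x / wgt x)%:E = J%:E)%E ->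
  (W%:E * gauge p (J / (2 * W)) <= \int[mu]_x (((wgt x)^-1)%:E * gauge p (G x)))%E.
Proof.
move=> p1 mG G0 GJ; have W0 := wgtV_mass_gt0.
have key a q a0 q0 := @int_gauge_wgt_ge p G J a q a0 q0 mG G0 GJ.
have : (0 <= \int[mu]_x (((wgt x)^-1)%:E * gauge p (G x)))%E.
  by apply: integral_ge0 => x _; rewrite mule_ge0 ?gauge_ge0// lee_fin wgtV_ge0.
move: key; set I := (\int[mu]_x _)%E; move: I => I key I0.
have J0 : 0 <= J.
  by rewrite -lee_fin -GJ; apply: integral_ge0 => x _; rewrite lee_fin mulr_ge0 ?wgtV_ge0.
set b := J / (2 * W); have b0 : 0 <= b by rewrite divr_ge0// mulr_ge0// ltW.
have Jb : J = 2 * W * b by rewrite /b; field; rewrite gt_eqF.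
case: I I0 key => [I|_ _|//]; last exact: leey.
rewrite lee_fin => I0 key.
case: p p1 key => [r|_|//]; rewrite /gauge.
  rewrite lee_fin => r1 key; have r0 : r != 0 by rewrite gt_eqF// (lt_le_trans ltr01).
  have [->|bn0] := eqVneq b 0; first by rewrite powR0// mule0 lee_fin.
  have b1 : 0 < b by rewrite lt0r bn0.
  have c0 : 0 < b `^ r by rewrite powR_gt0.
  (* [gauge_lin] at G / b reads G <= b + (b / b^r) G^r. As J = 2 W b, integration leaves half of J
     for the gauge term. *)
  have q0 : 0 <= b / b `^ r by rewrite divr_ge0 ?ltW.
  have := key b (b / b `^ r) b0 q0; rewrite -EFinM -EFinD !lee_fin => h.
  have : J <= b * W + b / b `^ r * I.
    apply: h => x; rewrite -EFinM -EFinD lee_fin.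
    have := gauge_lin (p := r%:E) r1 (divr_ge0 (G0 x) b0).
    rewrite /gauge -EFinD lee_fin ler_pdivrMr// powRM ?invr_ge0//.
    have -> : b^-1 `^ r = (b `^ r)^-1 by rewrite -[b^-1]powR_inv1// -powRrM mulrC powRrM powR_inv1 ?powR_ge0.
    by move=> /le_trans; apply; rewrite le_eqVlt; apply/orP; left; apply/eqP; ring.
  rewrite Jb => h2; have : b * W * b `^ r <= b * I; last by rewrite -mulrA ler_pM2l.
  have : b * W <= b / b `^ r * I by lra.
  by rewrite -(ler_pM2r c0) => /le_trans; apply; rewrite le_eqVlt; apply/orP; left; apply/eqP; field; rewrite gt_eqF.
move=> key; case: ifP => [_|/negbT]; first by rewrite mule0 lee_fin.
rewrite -ltNge => b1.
(* Any positive coefficient is admissible in front of an infinite gauge; this one gives J <= 2 W,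
   contradicting b > 1. *)
have q0 : 0 < W / (I + 1) by rewrite divr_gt0// ltr_wpDl.
have := key 1 (W / (I + 1)) ler01 (ltW q0); rewrite -EFinM -EFinD lee_fin mul1r => h.
have : J <= W + W / (I + 1) * I.
  apply: h => x; case: ifP => Gx; first by rewrite mule0 adde0 lee_fin.
  by rewrite gt0_muley ?lte_fin// addey// leey.
rewrite Jb => h2; exfalso.
have : W / (I + 1) * I <= W.
  have I1 : 0 < I + 1 by rewrite ltr_wpDl.
  by rewrite mulrAC ler_pdivrMr// ler_pM2l// lerDl.
by nra.
Qed.

(** A correlation: duality produces the kernel k(x - z), and x = z + y puts it in this form. *)
Definition ccorr g k (z : Rd) : C := cint mu (fun y => g (z + y) * k y).

Lemma Lp_norm_shift p g (z : Rd) (c : R) : (1 <= p)%E -> cmeas g -> 0 < c -> (Lp_norm p g <= c%:E)%E ->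
  cmeas (fun y => g (z + y)%R) /\ (Lp_norm p (fun y => g (z + y)%R) <= c%:E)%E.
Proof.
move=> p1 mg c0 gc.
have mgz : cmeas (fun y => g (z + y)%R).
  apply: (cmeas_comp mg).
  by have := measurable_affineN (- 1) z; under eq_fun do rewrite scaleN1r opprK.
split => //; apply/(Lp_norm_leP p1 mgz c0); move/(Lp_norm_leP p1 mg c0) : gc.
congr (_ <= _)%E.
have := ge0_integral_affine z (oner_neq0 R) (measurable_gauge_cabs p c mg) (fun x => gauge_ge0 p _).
rewrite normr1 expr1n invr1 mul1e => <-.
by apply: eq_integral => x _; rewrite scale1r addrC.
Qed.

Lemma cmeas_ccorr g k : cmeas g -> cmeas k -> cmeas (ccorr g k).
Proof.
move=> mg mk; have mF : cmeas (fun z : Rd * Rd => g (z.1 + z.2) * k z.2).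
  apply: cmeasM; last exact: cmeas_snd.
  apply: (cmeas_comp mg).
  rewrite (_ : (fun _ => _) = fun z : Rd * Rd => 1 *: z.1 + 1 *: z.2); first exact: measurable_lin.
  by apply/funext => z; rewrite !scale1r.
exact: (cmeas_cint mu mF).
Qed.

(** Young's inequality for a kernel dominated by M / wgt. The constant 4 is one factor 2 from
    [le_cabs_cint] and one from [gauge_mean_le]. *)
Lemma Lp_norm_ccorr p g k (c M : R) : (1 <= p)%E -> cmeas g -> cmeas k -> 0 < c -> 0 < M ->
  (forall y, cabs (k y) <= M / wgt y) -> (Lp_norm p g <= c%:E)%E ->
  (Lp_norm p (ccorr g k) <= (4 * W * M * c)%:E)%E.
Proof.
move=> p1 mg mk c0 M0 kM gc; have W0 := wgtV_mass_gt0.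
have mw := measurable_wgtV (R := R) (d := d).
have mc := cmeas_ccorr mg mk.
have C0 : 0 < 4 * W * M * c by rewrite !mulr_gt0.
apply/(Lp_norm_leP p1 mc C0).
have mG : measurable_fun setT (fun z : Rd * Rd => (((wgt z.2)^-1)%:E * gauge p (cabs (g (z.1 + z.2)%R) / c))%E).
  apply: emeasurable_funM.
    by apply/measurable_EFinP; exact: (measurableT_comp mw measurable_snd).
  apply: (measurableT_comp (measurable_gauge_cabs p c mg)).
  rewrite (_ : (fun _ => _) = fun z : Rd * Rd => 1 *: z.1 + 1 *: z.2); first exact: measurable_lin.
  by apply/funext => z; rewrite !scale1r.
have G0 (z : Rd * Rd) : (0 <= ((wgt z.2)^-1)%:E * gauge p (cabs (g (z.1 + z.2)%R) / c))%E.
  by rewrite mule_ge0 ?gauge_ge0// lee_fin wgtV_ge0.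
have pw z : (W%:E * gauge p (cabs (ccorr g k z) / (4 * W * M * c)) <=
    \int[mu]_y (((wgt y)^-1)%:E * gauge p (cabs (g (z + y)%R) / c)))%E.
  have [mgz gzc] := Lp_norm_shift z p1 mg c0 gc.
  have igz := Lp_cintegrable_wgt p1 mgz (le_lt_trans gzc (ltry c)).
  pose J := fine (\int[mu]_y (cabs (g (z + y)%R) / c / wgt y)%:E)%E.
  have EJ : (\int[mu]_y (cabs (g (z + y)%R) / c / wgt y)%:E = (c^-1)%:E * \int[mu]_y (cabs (((wgt y)^-1)%:C * g (z + y)%R))%:E)%E.
    rewrite -ge0_integralZl//.
    - apply: eq_integral => y _; rewrite -EFinM; congr EFin.
      by rewrite cabsM cabsC (ger0_norm (wgtV_ge0 _)); ring.
    - by apply: measurable_cabsE; case: igz.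
    - by move=> y _; rewrite lee_fin cabs_ge0.
    - by rewrite lee_fin invr_ge0 ltW.
  have JJ : (\int[mu]_y (cabs (g (z + y)%R) / c / wgt y)%:E = J%:E)%E.
    rewrite /J fineK// EJ ge0_fin_numE; last first.
      by rewrite mule_ge0 ?int_cabs_ge0// lee_fin invr_ge0 ltW.
    by rewrite lte_mul_pinfty ?lee_fin ?invr_ge0 ?(ltW c0)//; case: igz.
  apply: le_trans (gauge_mean_le p1 _ _ JJ); last 2 first.
  - by apply: measurable_funM => //; exact: measurable_cabs.
  - by move=> y; rewrite divr_ge0 ?cabs_ge0 ?ltW.
  rewrite lee_pmul2l ?lte_fin//.
  apply: le_gauge => //; first by rewrite divr_ge0 ?cabs_ge0// ltW.
  have ik : cintegrable mu (fun y => g (z + y) * k y).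
    apply: (le_cintegrable (G := fun y => M * cabs (((wgt y)^-1)%:C * g (z + y)%R))).
    - exact: cmeasM.
    - by apply: measurable_funM => //; apply: measurable_cabs; case: igz.
    - move=> y; rewrite !cabsM cabsC (ger0_norm (wgtV_ge0 _)) mulrA [leRHS]mulrC.
      by rewrite ler_wpM2l ?cabs_ge0.
    - have [_] := cintegrableZ (M%:C) igz.
      by under eq_integral do rewrite cabsM cabsC gtr0_norm//.
  have hk : cabs (ccorr g k z) <= 2 * (M * (c * J)).
    rewrite -lee_fin; apply: le_trans (le_cabs_cint ik) _.
    rewrite [leRHS]EFinM lee_pmul2l//=.
    have -> : ((M * (c * J))%:E = M%:E * \int[mu]_y (cabs (((wgt y)^-1)%:C * g (z + y)%R))%:E)%E.
      rewrite EFinM; congr (_ * _)%E; rewrite EFinM -JJ EJ muleA -EFinM mulfV ?gt_eqF//.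
      by rewrite mul1e.
    rewrite -ge0_integralZl//.
    - apply: ge0_le_integral => //.
      + by move=> y _; rewrite lee_fin cabs_ge0.
      + by apply: measurable_cabsE; exact: cmeasM.
      + by apply: emeasurable_funM => //; apply: measurable_cabsE; case: igz.
      + move=> y _; rewrite -EFinM lee_fin !cabsM cabsC (ger0_norm (wgtV_ge0 _)) mulrA [leRHS]mulrC.
        by rewrite ler_wpM2l ?cabs_ge0.
    - by apply: measurable_cabsE; case: igz.
    - by move=> y _; rewrite lee_fin cabs_ge0.
    - by rewrite lee_fin ltW.
  rewrite ler_pdivrMr//; apply: (le_trans hk); rewrite le_eqVlt; apply/orP; left; apply/eqP.
  by field; rewrite gt_eqF.
have mgc := measurable_gauge_cabs p (4 * W * M * c) mc.
have : (W%:E * \int[mu]_x gauge p (cabs (ccorr g k x) / (4 * W * M * c)) <= W%:E * 1)%E; last first.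
  by rewrite lee_pmul2l.
rewrite -ge0_integralZl//; last 2 first.
- by move=> x _; exact: gauge_ge0.
- by rewrite lee_fin ltW.
apply: (@le_trans _ _ (\int[mu]_z \int[mu]_y (((wgt y)^-1)%:E * gauge p (cabs (g (z + y)%R) / c)))%E).
  apply: ge0_le_integral => //.
  - by move=> x _; rewrite mule_ge0 ?gauge_ge0// lee_fin ltW.
  - exact: emeasurable_funM.
  - by apply: (measurable_fun_fubini_tonelli_F (fun z : Rd * Rd => (((wgt z.2)^-1)%:E * gauge p (cabs (g (z.1 + z.2)%R) / c))%E)).
(* With the integration in z inside, translation invariance removes y from the gauge; the remaining
   mass of 1 / wgt is W. *)
rewrite (fubini_tonelli _ mG G0) /=.
rewrite mule1 -wgtV_massE.
have E y : (\int[mu]_x (((wgt y)^-1)%:E * gauge p (cabs (g (x + y)%R) / c)) =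
   ((wgt y)^-1)%:E * \int[mu]_x gauge p (cabs (g x) / c))%E.
  have mgc0 := measurable_gauge_cabs p c mg.
  have := ge0_integral_affine y (oner_neq0 R) mgc0 (fun x => gauge_ge0 p _).
  rewrite normr1 expr1n invr1 mul1e => <-.
  rewrite -ge0_integralZl//.
  - by apply: eq_integral => x _; rewrite scale1r.
  - exact: (measurableT_comp mgc0 (measurable_affine_rV 1 y)).
  - by move=> x _; exact: gauge_ge0.
  - by rewrite lee_fin wgtV_ge0.
apply: ge0_le_integral => //.
- by move=> y _; apply: integral_ge0 => x _; exact: (G0 (x, y)).
- by apply: (measurable_fun_fubini_tonelli_G (fun z : Rd * Rd => (((wgt z.2)^-1)%:E * gauge p (cabs (g (z.1 + z.2)%R) / c))%E)).
- exact/measurable_EFinP.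
- move=> y _; rewrite E -[leRHS]mule1 lee_wpmul2l ?lee_fin ?wgtV_ge0//.
  exact/(Lp_norm_leP p1 mg c0).
Qed.

End Lp.

(** * Inverting the symbol, and duality with correlations *)

Section symbol_cutoff.
Context {R : realType} {d : nat}.
Local Notation C := R[i].
Local Notation Re := (@complex.Re R).
Local Notation Im := (@complex.Im R).
Local Notation Rd := 'rV[R]_d.
Local Notation mu := (@lebesgue_rV R d).

Lemma continuous_cabs (f : Rd -> C) : ccontinuous f -> continuous (fun x => cabs (f x)).
Proof.
move=> [cr ci].
have E : (fun x => cabs (f x)) = (fun x => Num.sqrt ((Re \o f) x ^+ 2 + (Im \o f) x ^+ 2)).
  by apply/funext => x; rewrite /cabs /=; case: (f x).
have c2 (g : Rd -> R) : continuous g -> continuous (fun y => g y ^+ 2).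
  by move=> cg y; exact: (cvgM (cg y) (cg y)).
have cs : continuous (fun x => (Re \o f) x ^+ 2 + (Im \o f) x ^+ 2).
  by move=> y; exact: (cvgD (c2 _ cr y) (c2 _ ci y)).
rewrite E => x; exact: (continuous_comp (cs x) (@sqrt_continuous R _)).
Qed.

Lemma open_cabs_gt (f : Rd -> C) (s : R) : ccontinuous f -> open [set x | s < cabs (f x)].
Proof.
move=> cf; rewrite (_ : [set x | _] = (fun x => cabs (f x)) @^-1` [set r | s < r])//.
by apply: open_comp; [move=> x _; exact: continuous_cabs|exact: open_gt].
Qed.

Lemma open_cabs_lt (f : Rd -> C) (s : R) : ccontinuous f -> open [set x | cabs (f x) < s].
Proof.
move=> cf; rewrite (_ : [set x | _] = (fun x => cabs (f x)) @^-1` [set r | r < s])//.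
by apply: open_comp; [move=> x _; exact: continuous_cabs|exact: open_lt].
Qed.

(** Write t / P as t conj P / |P|^2 and apply [smooth_quot] to the real denominator |P|^2. *)
Lemma smooth_inv (t P : Rd -> C) : smooth t -> smooth P -> (forall x, P x = 0 -> near0 t x) ->
  smooth (fun x => t x * (P x)^-1).
Proof.
move=> st sP P0; pose cj x : C := (Re (P x))%:C - (0 +i* 1) * (Im (P x))%:C.
have scj : smooth cj by exact: smooth_conj.
pose N x : R := cabs (P x) ^+ 2.
have EN x : P x * cj x = (N x)%:C.
  by rewrite /N cabs_sqr /cj; case: (P x) => a b; apply: complexP; rewrite ?cReM ?cImM /=; ring.
have sN : smooth (fun x => (N x)%:C) by rewrite (_ : (fun _ => _) = fun x => P x * cj x);
  [exact: smoothM sP scj|apply/funext => x; rewrite EN].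
have N0 x : N x = 0 -> P x = 0.
  by move=> /eqP; rewrite sqrf_eq0 => /eqP; exact: cabs0_eq0.
rewrite (_ : (fun x => _) = fun x => (cj x * t x) * ((N x)^-1)%:C).
  apply: (smooth_quot (t := fun x => cj x * t x) (smoothM scj st) sN) => x.
  have [/N0/P0 h|] := eqVneq (N x) 0; [right|by left].
  by apply: filterS h => y ->; rewrite mulr0.
apply/funext => x; rewrite [cj x * _]mulrC -mulrA; congr (_ * _).
have [P0x|Px] := eqVneq (P x) 0.
  by rewrite P0x invr0 /N P0x cabs0 expr0n /= invr0 mulr0.
have Nx : N x != 0 by apply: contra Px => /eqP/N0 ->.
apply: (mulfI Px); rewrite mulfV// mulrA EN -rmorphM /= mulfV//.
Qed.

End symbol_cutoff.

Section convolution_duality.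
Context {R : realType} {d : nat}.
Local Notation C := R[i].
Local Notation Rd := 'rV[R]_d.
Local Notation mu := (@lebesgue_rV R d).

Lemma cintegrable_mul_fourier (g psi : Rd -> C) : cmeas g -> cintegrable mu (fun x => ((wgt x)^-1)%:C * g x) ->
  tfn psi -> cintegrable mu (fun x => g x * fourier psi x).
Proof.
move=> mg ig tpsi; have [M M0 hM] := fourier_le_wgtV tpsi.
apply: (le_cintegrable (G := fun x => M * cabs (((wgt x)^-1)%:C * g x))).
- by apply: cmeasM => //; exact: smooth_cmeas (smooth_fourier tpsi).
- by apply: measurable_funM => //; apply: measurable_cabs; case: ig.
- move=> x; rewrite [leLHS]cabsM [cabs (_ * g x)]cabsM cabsC (ger0_norm (wgtV_ge0 _)) mulrA [leRHS]mulrC.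
  by rewrite ler_wpM2l ?cabs_ge0.
- have [_] := cintegrableZ (M%:C) ig.
  by under eq_integral do rewrite cabsM cabsC ger0_norm//.
Qed.

(** The form of Hoelder's inequality that is used: the kernel enters only through its bound by M /
    wgt. *)
Lemma cabs_cint_mul_le (g k : Rd -> C) (p : \bar R) (M c : R) : (1 <= p)%E -> cmeas g -> cmeas k ->
  (forall x, cabs (k x) <= M / wgt x) -> 0 < c -> (Lp_norm p g <= c%:E)%E ->
  cabs (cint mu (fun x => g x * k x)) <= 2 * (M * (c * (wgtV_mass R d + 1))).
Proof.
move=> p1 mg mk kM c0 gc; have M0 := wgtV_bound_ge0 kM.
have ig := Lp_cintegrable_wgt p1 mg (le_lt_trans gc (ltry c)).
have le1 x : cabs (g x * k x) <= M * cabs (((wgt x)^-1)%:C * g x).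
  rewrite !cabsM cabsC (ger0_norm (wgtV_ge0 _)) mulrA [leRHS]mulrC.
  by rewrite ler_wpM2l ?cabs_ge0.
have mm : measurable_fun setT (fun x => M * cabs (((wgt x)^-1)%:C * g x)).
  by apply: measurable_funM => //; apply: measurable_cabs; case: ig.
have igk : cintegrable mu (fun x => g x * k x).
  apply: (le_cintegrable _ mm le1); first exact: cmeasM.
  have [_] := cintegrableZ (M%:C) ig.
  by under eq_integral do rewrite cabsM cabsC ger0_norm//.
rewrite -lee_fin; apply: le_trans (le_cabs_cint igk) _.
rewrite [leRHS]EFinM lee_pmul2l ?lte_fin//.
apply: (@le_trans _ _ (M%:E * \int[mu]_x (cabs (((wgt x)^-1)%:C * g x))%:E)%E).
  rewrite -ge0_integralZl//.
  - apply: ge0_le_integral => //.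
    + by move=> x _; rewrite lee_fin cabs_ge0.
    + by apply: measurable_cabsE; exact: cmeasM.
    + exact/measurable_EFinP.
    + by move=> x _; rewrite -EFinM lee_fin.
  - by apply: measurable_cabsE; case: ig.
  - by move=> x _; rewrite lee_fin cabs_ge0.
rewrite [leRHS]EFinM lee_wpmul2l ?lee_fin//.
exact: (int_wgt_le p1 mg c0 gc).
Qed.

(** The transpose of multiplication by v. Peetre's inequality turns the kernel into an integrable
    factor in x times wgt(y), and F psi decays twice to compensate. *)
Lemma cint_fourier_mul (g v psi : Rd -> C) : cmeas g -> cintegrable mu (fun x => ((wgt x)^-1)%:C * g x) ->
  tfn v -> tfn psi ->
  cint mu (fun x => g x * (inv_cst R d * fourier (fun l => v l * psi l) x)) =
  cint mu (fun z => ccorr g (fourier v) z * fourier psi z).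
Proof.
move=> mg ig tv tpsi.
have [Mv Mv0 hv] := fourier_le_wgtV tv; have [Mp Mp0 hp] := fourier_le_wgtV2 tpsi.
have mv := smooth_cmeas (smooth_fourier tv); have mp := smooth_cmeas (smooth_fourier tpsi).
pose F (z : Rd * Rd) := g z.1 * (fourier v (z.1 - z.2) * fourier psi z.2).
have msub : measurable_fun setT (fun z : Rd * Rd => z.1 - z.2).
  rewrite (_ : (fun _ => _) = fun z : Rd * Rd => 1 *: z.1 + (- 1) *: z.2); first exact: measurable_lin.
  by apply/funext => z; rewrite scale1r scaleN1r.
have mF : cmeas F.
  apply: cmeasM; first exact: cmeas_fst.
  by apply: cmeasM; [exact: (cmeas_comp mv msub)|exact: cmeas_snd].
have msubl (x : Rd) : measurable_fun setT (fun y : Rd => x - y).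
  by have := measurable_affineN 1 x; under eq_fun do rewrite scale1r.
have msubr (y : Rd) : measurable_fun setT (fun x : Rd => x - y).
  by have := measurable_affine_rV 1 (- y); under eq_fun do rewrite scale1r.
have vMv x : cabs (fourier v x) <= Mv.
  by apply: le_trans (hv x) _; rewrite ler_piMr// wgtV_le1.
have gvE x y : cabs (g x * fourier v (x - y)) <= 2 ^+ d * wgt y * Mv * cabs (((wgt x)^-1)%:C * g x).
  rewrite cabsM [cabs (_ * g x)]cabsM cabsC (ger0_norm (wgtV_ge0 _)).
  have -> : 2 ^+ d * wgt y * Mv * ((wgt x)^-1 * cabs (g x)) = cabs (g x) * (Mv * (2 ^+ d * wgt y / wgt x)) by ring.
  rewrite ler_wpM2l ?cabs_ge0//; apply: le_trans (hv _) _; rewrite ler_wpM2l//; exact: wgtVB_le.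
have mgw : measurable_fun setT (fun x => cabs (((wgt x)^-1)%:C * g x)) by apply: measurable_cabs; case: ig.
transitivity (cint mu (fun x => cint mu (fun y => F (x, y)))).
  apply: eq_cint => x.
  have ii : cintegrable mu (fun y => fourier v (x - y) * fourier psi y).
    apply: (cintegrable_bounded (M := Mv)) (cintegrable_fourier tpsi) _ _ => //.
    exact: (cmeas_comp mv (msubl x)).
  have E : inv_cst R d * fourier (fun l => v l * psi l) x = cint mu (fun y => fourier v (x - y) * fourier psi y).
    rewrite [RHS](@eq_cint _ _ _ _ _ (fun y => fourier psi y * fourier v (x - y))); last by move=> y; exact: mulrC.
    rewrite -(fourier_prod x tpsi tv); congr (_ * _).
    by apply: (congr1 (fun h => fourier h x)); apply/funext => y; exact: mulrC.
  by rewrite E -(cintZ (g x) ii).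
rewrite (@cfubini_prod _ _ F (fun x => ((wgt x)^-1)%:C * g x) (fun y => (2 ^+ d * Mv * Mp / wgt y)%:C))//.
- apply: eq_cint => y.
  have iy : cintegrable mu (fun x => g x * fourier v (x - y)).
    apply: (le_cintegrable _ _ (fun x => gvE x y)).
    - by apply: cmeasM => //; exact: (cmeas_comp mv (msubr y)).
    - by apply: measurable_funM.
    - have [_] := cintegrableZ ((2 ^+ d * wgt y * Mv)%:C) ig.
      under eq_integral do rewrite cabsM cabsC ger0_norm ?mulr_ge0 ?exprn_ge0 ?(ltW (wgt_gt0 y))//.
      by [].
  have := cint_shift y iy; rewrite /ccorr => Ey.
  transitivity (fourier psi y * cint mu (fun x => g x * fourier v (x - y))).
    by rewrite -(cintZ (fourier psi y) iy); apply: eq_cint => x; rewrite /F [LHS]mulrA [LHS]mulrC.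
  rewrite -Ey [LHS]mulrC; apply: (congr1 (fun c => c * fourier psi y)); apply: eq_cint => x.
  by rewrite addrK addrC.
- apply: (wgtV_cintegrable (M := 2 ^+ d * Mv * Mp)).
    by apply: cmeas_real; apply: measurable_funM => //; exact: measurable_wgtV.
  by move=> y; rewrite cabsC ger0_norm// !mulr_ge0 ?exprn_ge0 ?wgtV_ge0.
- move=> x y; have -> : F (x, y) = g x * fourier v (x - y) * fourier psi y by rewrite /F mulrA.
  rewrite [cabs (_ * fourier psi y)]cabsM cabsC ger0_norm ?mulr_ge0 ?exprn_ge0 ?wgtV_ge0//.
  apply: le_trans (ler_pM (cabs_ge0 _) (cabs_ge0 _) (gvE x y) (hp y)) _.
  rewrite le_eqVlt; apply/orP; left; apply/eqP; field.
  by rewrite gt_eqF// wgt_gt0.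
Qed.

End convolution_duality.

(** * The spectral radius *)

Section roots.
Context {R : realType}.

(** Bernoulli's inequality for t = q^(1/(K+1)), raised to the power K + 1: the extra factor n + 1
    beats every constant. *)
Lemma near_poly_le_exp (q c : R) (K : nat) : 1 < q -> \forall n \near \oo, c * n.+1%:R ^+ K <= q ^+ n.
Proof.
move=> q1; pose t := q `^ (K.+1%:R^-1).
have q0 : 0 <= q by lra.
have tq : t ^+ K.+1 = q by rewrite -powR_mulrn ?powR_ge0// -powRrM mulVf ?pnatr_eq0// powRr1.
have t1 : 1 < t.
  rewrite ltNge; apply/negP => t1; move: q1; rewrite -tq ltNge => /negP; apply.
  by rewrite exprn_ile1// powR_ge0.
(* e <= 1 starts the induction at n = 0, and e <= t - 1 carries it on. *)
pose e := Num.min 1 (t - 1); have e0 : 0 < e by rewrite lt_min ltr01 subr_gt0.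
have bern n : e * n.+1%:R <= t ^+ n.
  elim: n => [|n IH]; first by rewrite mulr1 expr0 ge_min lexx.
  have : e <= t - 1 by rewrite ge_min lexx orbT.
  have : 1 <= t ^+ n by rewrite exprn_ege1// ltW.
  rewrite exprS -[n.+2%:R]natr1; nra.
near=> n.
have -> : q ^+ n = (t ^+ n) ^+ K.+1 by rewrite exprAC tq.
apply: le_trans (_ : (e * n.+1%:R) ^+ K.+1 <= _); last by rewrite lerXn2r ?nnegrE ?mulr_ge0 ?exprn_ge0 ?powR_ge0// ltW.
rewrite exprMn exprSr [_ ^+ K.+1 in leRHS]exprS !mulrA ler_wpM2r ?exprn_ge0//.
rewrite -exprSr mulrC -ler_pdivrMr ?exprn_gt0//.
apply: (@le_trans _ _ n%:R); last by rewrite ler_nat.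
by near: n; exact: nbhs_infty_ger.
Unshelve. all: by end_near. Qed.

(** The gap between A and B absorbs everything: (B / A)^n outgrows the polynomial factor and the
    constant B^-N caused by the shift of the index. *)
Lemma near_root_le (a : nat -> R) (A B M : R) (N K : nat) : 0 < A -> A < B -> (forall n, 0 <= a n) ->
  (forall n, a (n + N)%N <= M * n.+1%:R ^+ K * A ^+ n) -> \forall n \near \oo, a n `^ (n%:R^-1) <= B.
Proof.
move=> A0 AB a0 aM; have B0 : 0 < B by exact: lt_trans AB.
have q1 : 1 < B / A by rewrite ltr_pdivlMr// mul1r.
have [n0 _ hn0] := near_poly_le_exp (M / B ^+ N) K q1.
exists (n0 + N).+1 => // m /= hm.
have mN : (m - N + N)%N = m by rewrite subnK//; lia.
have am : a m <= B ^+ m.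
  have key (X a' b' k : R) : 0 < a' -> 0 < k -> M / k * X <= b' / a' -> M * X * a' <= b' * k.
    move=> a'0 k0; rewrite ler_pdivlMr// => h; have := ler_wpM2r (ltW k0) h.
    by rewrite (_ : M / k * X * a' * k = M * X * a')//; field; rewrite gt_eqF.
  rewrite -mN; apply: le_trans (aM _) _; rewrite exprD; apply: key; rewrite ?exprn_gt0//.
  by rewrite -expr_div_n; apply: hn0; rewrite /=; lia.
have m0 : m%:R != 0 :> R by rewrite pnatr_eq0; lia.
have -> : B = (B ^+ m) `^ (m%:R^-1) by rewrite -powR_mulrn ?(ltW B0)// -powRrM mulfV// powRr1// ltW.
by apply: ge0_ler_powR; rewrite ?nnegrE ?invr_ge0// exprn_ge0// ltW.
Qed.

Lemma near_root_ge (a : nat -> R) (A B M : R) (N K : nat) : 0 < B -> B < A -> 0 < M ->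
  (forall n, M * A ^+ n / n.+1%:R ^+ K <= a (n + N)%N) -> \forall n \near \oo, B <= a n `^ (n%:R^-1).
Proof.
move=> B0 BA M0 aM; have A0 : 0 < A by exact: lt_trans BA.
have q1 : 1 < A / B by rewrite ltr_pdivlMr// mul1r.
have [n0 _ hn0] := near_poly_le_exp (B ^+ N / M) K q1.
exists (n0 + N).+1 => // m /= hm.
have mN : (m - N + N)%N = m by rewrite subnK//; lia.
have am : B ^+ m <= a m.
  have key (X a' b' k : R) : 0 < b' -> 0 < X -> k / M * X <= a' / b' -> b' * k <= M * a' / X.
    move=> b'0 X0; rewrite !ler_pdivlMr// => h; have := ler_wpM2r (ltW M0) h.
    by rewrite (_ : k / M * X * b' * M = b' * k * X) ?[M * a']mulrC//; field; rewrite gt_eqF.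
  rewrite -mN; apply: le_trans (aM _); rewrite exprD; apply: key; rewrite ?exprn_gt0//.
  by rewrite -expr_div_n; apply: hn0; rewrite /=; lia.
have m0 : m%:R != 0 :> R by rewrite pnatr_eq0; lia.
have -> : B = (B ^+ m) `^ (m%:R^-1) by rewrite -powR_mulrn ?(ltW B0)// -powRrM mulfV// powRr1// ltW.
apply: ge0_ler_powR; rewrite ?nnegrE ?invr_ge0//; first by rewrite exprn_ge0// ltW.
by apply: le_trans am; rewrite exprn_ge0// ltW.
Qed.

End roots.

(** * Lower and upper bounds for the norms *)

Section spectral_bounds.
Context {R : realType} {d : nat}.
Local Notation C := R[i].
Local Notation Rd := 'rV[R]_d.
Local Notation mu := (@lebesgue_rV R d).
Variables (P : mpoly d C) (p : \bar R) (f : functional R d) (g : nat -> Rd -> C).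
Hypothesis p1 : (1 <= p)%E.
Hypothesis hg : forall n : nat, Lp_representative p (iter n (diffop_dist P) f) (g n).

Let T := fourier_dist f.
Let Pl : Rd -> C := symbol P.

Let mg n : cmeas (g n).
Proof. by have [[]] := hg n. Qed.

Let goo n : (Lp_norm p (g n) < +oo)%E.
Proof. by have [[]] := hg n. Qed.

Let ig n : cintegrable mu (fun x => ((wgt x)^-1)%:C * g n x).
Proof. exact: Lp_cintegrable_wgt p1 (mg n) (goo n). Qed.

Lemma fourier_dist_symbol_pow n psi : tfn psi ->
  T (fun x => Pl x ^+ n * psi x) = cint mu (fun x => g n x * fourier psi x).
Proof.
move=> tpsi.
have E1 (phi : Rd -> C) : iter n (diffop_dist P) f phi = f (iter n (diffop (mpoly_reflect P)) phi).
  elim: n phi => [//|m IH] phi; rewrite [in RHS]iterSr -IH.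
  by [].
have E2 : iter n (diffop (mpoly_reflect P)) (fourier psi) = fourier (fun x => Pl x ^+ n * psi x) /\
    tfn (fun x => Pl x ^+ n * psi x).
  split; last exact: tfnM (smoothX n (smooth_symbol P)) tpsi.
  elim: n {E1} => [|m IH].
    by apply: (congr1 fourier); apply/funext => x; rewrite expr0 mul1r.
  rewrite iterS IH fourier_symbol; last exact: tfnM (smoothX m (smooth_symbol P)) tpsi.
  by apply: (congr1 fourier); apply/funext => x; rewrite mulrA -exprS.
have [_ hn] := hg n; have := hn _ (schwartz_fourier tpsi).
by rewrite E1 E2.1.
Qed.

Lemma fourier_dist_tfn psi : tfn psi -> T psi = cint mu (fun x => g 0%N x * fourier psi x).
Proof.
move=> tpsi; rewrite -fourier_dist_symbol_pow//; apply: (congr1 T).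
by apply/funext => x; rewrite expr0 mul1r.
Qed.

Let TD phi psi : tfn phi -> tfn psi -> T (fun x => phi x + psi x) = T phi + T psi.
Proof.
move=> tphi tpsi; rewrite !fourier_dist_tfn//; last exact: tfnD.
rewrite -cintD; [|exact: cintegrable_mul_fourier..].
by apply: eq_cint => x; rewrite fourierD ?mulrDr//; exact: tfn_cintegrable.
Qed.

Lemma dist_supportP (x : Rd) : ~ dist_support T x ->
  exists2 U, nbhs x U & forall phi, tfn_in U phi -> T phi = 0.
Proof.
move=> /contrapT[U [oU vU] Ux]; exists U; first exact: open_nbhs_nbhs.
by move=> phi /test_functionP; exact: vU.
Qed.

Lemma spectral_lower (lam : Rd) (s : R) : dist_support T lam -> 0 < s -> s < cabs (Pl lam) ->
  exists N K : nat, exists2 M : R, 0 < M &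
    forall n, ((M * s ^+ n / n.+1%:R ^+ K)%:E <= Lp_norm p (g (n + N)%N))%E.
Proof.
move=> slam s0 slt; pose U := [set x | s < cabs (Pl x)].
have oU : open U by apply: open_cabs_gt; exact: smooth_continuous (smooth_symbol P).
have [phi [tphi Tphi]] : exists phi, tfn_in U phi /\ T phi != 0.
  apply: contrapT => h; apply: slam; exists U => //; split => // phi /test_functionP tphi.
  by apply/eqP/negPn/negP => Tphi; apply: h; exists phi.
have [sphi cL LU] : test_function U phi by apply/test_functionP.
have [tt _] := tphi.
(* On the support of phi, th = 1 and hence u P = 1; outside it u remains smooth and bounded by 1 /
   s. *)
have [th [[tth thU] th01 th1]] := smooth_urysohn cL oU LU.
pose u x := (th x)%:C * (Pl x)^-1.
have su : smooth u.
  apply: smooth_inv (tfn_smooth tth) (smooth_symbol P) _ => x Px0; apply: thU.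
  by rewrite /U /= /Pl Px0 cabs0; apply/negP; rewrite -leNgt ltW.
have uA x : cabs (u x) <= s^-1.
  rewrite /u cabsM cabsV cabsC; have /andP[t0 t1] := th01 x; rewrite ger0_norm//.
  have [Ux|/thU/near0_id /=] := pselect (U x); last first.
    by move=> /(congr1 (@complex.Re R)) /= ->; rewrite mul0r invr_ge0 ltW.
  apply: (@le_trans _ _ (cabs (Pl x))^-1); first by rewrite ler_piMl// invr_ge0 cabs_ge0.
  have sP : s < cabs (Pl x) by exact: Ux.
  have P0 : 0 < cabs (Pl x) by exact: lt_trans s0 sP.
  by rewrite lef_pV2 ?posrE; [exact: ltW|exact: P0|exact: s0].
have [N [K [M M0 hM]]] := fourier_pow_growth su uA tt.
have W1 : 0 < wgtV_mass R d + 1 by rewrite ltr_wpDl// wgtV_mass_ge0.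
(* M + 1 instead of M keeps D positive and makes the contradiction strict: a norm below c would give
   |T phi| <= |T phi| M / (M + 1). *)
pose D := 2 * (M + 1) * (wgtV_mass R d + 1).
have D0 : 0 < D by rewrite !mulr_gt0// ltr_wpDl.
have T0 : 0 < cabs (T phi) by exact: cabs_gt0.
exists N, K, (cabs (T phi) / D); first by rewrite divr_gt0.
move=> n; set c := _ / _; rewrite leNgt; apply/negP => gc.
have c0 : 0 < c.
  by rewrite /c; apply: divr_gt0; [apply: mulr_gt0; [exact: divr_gt0|exact: exprn_gt0]|exact: exprn_gt0].
have tv : tfn (fun x => phi x * u x ^+ (n + N)).
  rewrite (_ : (fun _ => _) = fun x => u x ^+ (n + N) * phi x); first exact: tfnM (smoothX _ su) tt.
  by apply/funext => x; rewrite mulrC.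
have E : T phi = cint mu (fun x => g (n + N)%N x * fourier (fun x => phi x * u x ^+ (n + N)) x).
  rewrite -fourier_dist_symbol_pow//; apply: (congr1 T); apply/funext => x.
  have [->|phix] := eqVneq (phi x) 0; first by rewrite mul0r mulr0.
  have Lx : closure [set y | phi y != 0] x by exact: subset_closure.
  have Px : Pl x != 0.
    by apply/eqP => Px; have := LU _ Lx; rewrite /U /= Px cabs0 ltNge (ltW s0).
  by rewrite /u (nbhs_singleton (th1 x Lx)) mul1r mulrCA -exprMn mulfV// expr1n mulr1.
have := cabs_cint_mul_le p1 (mg (n + N)%N) (smooth_cmeas (smooth_fourier tv)) (hM n) c0 (ltW gc).
rewrite -E leNgt => /negP; apply.
have -> : 2 * (M * n.+1%:R ^+ K * s^-1 ^+ n * (c * (wgtV_mass R d + 1))) = cabs (T phi) * (M / (M + 1)).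
  rewrite /c /D exprVn.
  have sn0 : s ^+ n != 0 by rewrite expf_neq0// gt_eqF.
  have n0 : n.+1%:R ^+ K != 0 :> R by rewrite expf_neq0// pnatr_eq0.
  have M10 : M + 1 != 0 by rewrite gt_eqF// ltr_wpDl.
  have W10 : wgtV_mass R d + 1 != 0 by rewrite gt_eqF.
  move: (s ^+ n) (n.+1%:R ^+ K) (wgtV_mass R d) (cabs (T phi)) sn0 n0 W10 => a b w t a0 b0 w0.
  by field; rewrite a0 b0 M10 w0.
rewrite gtr_pMr// ltr_pdivrMr ?mul1r ?ltrDl//; lra.
Qed.

Lemma spectral_upper (A : R) : compact (dist_support T) -> 0 < A ->
  (forall lam, dist_support T lam -> cabs (Pl lam) < A) ->
  exists N K : nat, exists2 M : R, 0 < M &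
    forall n, (Lp_norm p (g (n + N)%N) <= (M * n.+1%:R ^+ K * A ^+ n)%:E)%E.
Proof.
move=> cK A0 KA; pose V := [set x | cabs (Pl x) < A].
have oV : open V by apply: open_cabs_lt; exact: smooth_continuous (smooth_symbol P).
have [chi [tchi chi01 chi1]] := smooth_urysohn cK oV KA.
pose chiC (x : Rd) : C := (chi x)%:C.
have [schi cL LV] : test_function V chiC by apply/test_functionP.
have [tc _] := tchi.
have [th [[tth thV] th01 th1]] := smooth_urysohn cL oV LV.
pose u x := (th x)%:C * Pl x.
have su : smooth u by exact: smoothM (tfn_smooth tth) (smooth_symbol P).
have uA x : cabs (u x) <= A.
  rewrite /u cabsM cabsC; have /andP[t0 t1] := th01 x; rewrite ger0_norm//.
  have [Vx|/thV/near0_id /=] := pselect (V x); last by move=> /(congr1 (@complex.Re R)) /= ->; rewrite mul0r ltW.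
  by apply: le_trans (ltW Vx); rewrite ler_piMl// cabs_ge0.
have [N [K [M M0 hM]]] := fourier_pow_growth su uA tc.
pose ic := inv_cst R d; have ic0 : ic != 0 by exact: inv_cst_neq0.
have aic0 : 0 < cabs ic^-1 by rewrite cabs_gt0// invr_eq0.
pose W := wgtV_mass R d; have W0 : 0 < W by exact: wgtV_mass_gt0.
(* The summand 1 keeps this bound positive even when the norm is 0. *)
pose c0 := fine (Lp_norm p (g 0%N)) + 1.
have L0 : (0 <= Lp_norm p (g 0%N))%E by exact: Lnorm_ge0.
have c00 : 0 < c0 by rewrite ltr_pwDr// fine_ge0.
have gc0 : (Lp_norm p (g 0%N) <= c0%:E)%E.
  by rewrite -[leLHS]fineK ?ge0_fin_numE// lee_fin lerDl.
have M1 : 0 < M + 1 by rewrite ltr_wpDl.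
exists N, K, (4 * W * (cabs ic^-1 * (M + 1)) * c0); first by rewrite !mulr_gt0.
move=> n; pose m := (n + N)%N; pose v x := chiC x * u x ^+ m; pose v' x := ic^-1 * v x.
have tv : tfn v.
  rewrite (_ : v = fun x => u x ^+ m * chiC x); first exact: tfnM (smoothX _ su) tc.
  by apply/funext => x; rewrite mulrC.
have tv' : tfn v' by exact: tfnZ.
have mF := smooth_cmeas (smooth_fourier tv').
pose h := ccorr (g 0%N) (fourier v').
have mh : cmeas h by exact: cmeas_ccorr.
pose M' := cabs ic^-1 * (M + 1) * n.+1%:R ^+ K * A ^+ n.
have M'0 : 0 < M' by rewrite !mulr_gt0// exprn_gt0.
have kM y : cabs (fourier v' y) <= M' / wgt y.
  rewrite (fourierZ _ _ (tfn_cintegrable tv)) [leLHS]cabsM.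
  have -> : M' / wgt y = cabs ic^-1 * ((M + 1) * n.+1%:R ^+ K * A ^+ n / wgt y) by rewrite /M'; ring.
  rewrite ler_wpM2l ?cabs_ge0//; apply: le_trans (hM n y) _.
  rewrite !ler_wpM2r ?invr_ge0 ?exprn_ge0 ?lerDl//; first by rewrite ltW// wgt_gt0.
  exact: ltW.
have hn := Lp_norm_ccorr p1 (mg 0%N) mF c00 M'0 kM gc0.
have -> : 4 * W * (cabs ic^-1 * (M + 1)) * c0 * n.+1%:R ^+ K * A ^+ n = 4 * W * M' * c0.
  by rewrite /M'; ring.
have C0 : 0 < 4 * W * M' * c0 by apply: mulr_gt0 c00; apply: mulr_gt0 M'0; apply: mulr_gt0 W0.
apply: (Lp_norm_ae_le p1 (mg m) mh C0 _ hn).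
have ih : cintegrable mu (fun x => ((wgt x)^-1)%:C * h x).
  exact: Lp_cintegrable_wgt p1 mh (le_lt_trans hn (ltry _)).
have ae0 : {ae mu, forall x, g m x - h x = 0}.
  apply: fourier_orthogonal_eq0.
  - exact: cmeasB.
  - rewrite (_ : (fun _ => _) = fun x => ((wgt x)^-1)%:C * g m x - ((wgt x)^-1)%:C * h x).
      exact: cintegrableB.
    by apply/funext => x; rewrite mulrBr.
  - move=> psi tpsi.
    rewrite (@eq_cint _ _ _ _ _ (fun x => g m x * fourier psi x - h x * fourier psi x)); last first.
      by move=> x; rewrite mulrBl.
    rewrite cintB; [|exact: cintegrable_mul_fourier..].
    rewrite -fourier_dist_symbol_pow// -(cint_fourier_mul (mg 0%N) (ig 0%N) tv' tpsi).
    have tvp : tfn (fun x => v x * psi x) by exact: tfnM (tfn_smooth tv) tpsi.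
    have -> : cint mu (fun x => g 0%N x * (inv_cst R d * fourier (fun l => v' l * psi l) x)) =
        T (fun x => v x * psi x).
      rewrite fourier_dist_tfn//; apply: eq_cint => x; congr (_ * _).
      have -> : (fun l => v' l * psi l) = fun l => ic^-1 * (v l * psi l).
        by apply/funext => l; exact: esym (mulrA ic^-1 (v l) (psi l)).
      by rewrite (fourierZ _ _ (tfn_cintegrable tvp)) mulrA mulfV// mul1r.
    have vE x : v x = chiC x * Pl x ^+ m.
      rewrite /v; have [->|cx] := eqVneq (chiC x) 0; first by rewrite !mul0r.
      have Lx : closure [set y | chiC y != 0] x by exact: subset_closure.
      by rewrite /u (nbhs_singleton (th1 x Lx)) mul1r.
    have tPm : tfn (fun x => Pl x ^+ m * psi x) by exact: tfnM (smoothX m (smooth_symbol P)) tpsi.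
    have s1c : smooth (fun x => 1 - chiC x) by exact: smoothB (smooth_cst 1) schi.
    have tr : tfn (fun x => (1 - chiC x) * (Pl x ^+ m * psi x)) by exact: tfnM s1c tPm.
    (* The second part vanishes near every point of the support of T, so [vanish_cover] removes
       it. *)
    have -> : T (fun x => Pl x ^+ m * psi x) = T (fun x => v x * psi x) + T (fun x => (1 - chiC x) * (Pl x ^+ m * psi x)).
      rewrite -TD//; apply: (congr1 T); apply/funext => x; rewrite vE; ring.
    rewrite [X in _ + X - _](vanish_cover TD tr) ?addr0 ?subrr// => x.
    have [Kx|/dist_supportP] := pselect (dist_support T x); last by right.
    by left; apply: filterS (chi1 x Kx) => y cy; rewrite /chiC cy subrr mul0r.
by apply: filterS ae0 => x /eqP; rewrite subr_eq0 => /eqP.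
Qed.

Lemma closed_dist_support : closed (dist_support T).
Proof. by apply: open_closedC; apply: bigcup_open => U []. Qed.

End spectral_bounds.

(* Passage to the limit *)
Local Close Scope complex_scope.
Unset Implicit Arguments.

Theorem theorem2p6 (R : realType) (d : nat) (P : mpoly d R[i])
    (p : \bar R) (hp : (1 <= p)%E)
    (f : functional R d) (hf : tempered f)
    (g : nat -> 'rV[R]_d -> R[i])
    (hg : forall n : nat,
       Lp_representative p (iter n (diffop_dist P) f) (g n))
    (hP : compact (dist_support (fourier_dist f)) \/
       forall r : R, 0 <= r ->
         compact [set lam : 'rV[R]_d | cabs (symbol P lam) <= r]) :
  (poweR (Lp_norm p (g n)) (n%:R^-1))
    @[n --> \oo] --> spectral_sup P (fourier_dist f).
Proof.
pose a n : R := fine (Lp_norm p (g n)).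
have Ea n : Lp_norm p (g n) = (a n)%:E.
  rewrite /a fineK// ge0_fin_numE; first by have [[]] := hg n.
  exact: Lnorm_ge0.
have a0 n : 0 <= a n by rewrite fine_ge0// Lnorm_ge0.
rewrite (_ : (fun n => _) = EFin \o (fun n => a n `^ (n%:R^-1))); last first.
  by apply/funext => n; rewrite Ea.
set S := dist_support (fourier_dist f).
set L := spectral_sup P (fourier_dist f).
have SL lam : S lam -> ((cabs (symbol P lam))%:E <= L)%E.
  by move=> Slam; apply: ereal_sup_ubound; right; exists lam.
have L0 : (0 <= L)%E by apply: ereal_sup_ubound; left.
have lower (B : R) : 0 < B -> (B%:E < L)%E -> \forall n \near \oo, B <= a n `^ (n%:R^-1).
  (* The adjoined value 0 does not exceed B > 0, so the witness is a point of the support. *)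
  move=> B0 /ereal_sup_gt[_ [->|[lam Slam <-]]].
    by rewrite lte_fin ltNge ltW.
  rewrite lte_fin => Blam; pose s := (B + cabs (symbol P lam)) / 2.
  have Bs : B < s by rewrite /s; lra.
  have slam : s < cabs (symbol P lam) by rewrite /s; lra.
  have [N [K [M M0 hM]]] := spectral_lower hp hg Slam (lt_trans B0 Bs) slam.
  apply: (near_root_ge (N := N) (K := K) B0 Bs M0) => n.
  by rewrite -lee_fin -Ea.
case: L L0 SL lower => [l|_ _ lower|//].
  rewrite lee_fin => l0 SL lower.
  (* A finite supremum gives compactness in both cases of [hP]: the support is closed and contained
     in the sublevel set at level l. *)
  have cS : compact S.
    case: hP => [//|/(_ _ l0) cl].
    apply: (subclosed_compact _ cl); first exact: closed_dist_support.
    by move=> lam /SL; rewrite lee_fin.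
  apply: cvg_EFin; first exact: nearW.
  apply/cvgrPdist_le => e e0.
  have upper : \forall n \near \oo, a n `^ (n%:R^-1) <= l + e.
    (* Half of e keeps the rate positive when l = 0; the other half absorbs the polynomial
       growth. *)
    have A0 : 0 < l + e / 2 by lra.
    have Ae : l + e / 2 < l + e by lra.
    have SA lam : S lam -> cabs (symbol P lam) < l + e / 2.
      by move=> /SL; rewrite lee_fin => h; lra.
    have [N [K [M M0 hM]]] := spectral_upper hp hg cS A0 SA.
    apply: (near_root_le (N := N) (K := K) A0 Ae a0) => n.
    by rewrite -lee_fin -Ea.
  have low : \forall n \near \oo, l - e <= a n `^ (n%:R^-1).
    (* [lower] only concerns positive levels; the others are trivial because roots are
       nonnegative. *)
    have [le|le] := lerP (l - e) 0.
      by apply: nearW => n; rewrite (le_trans le)// powR_ge0.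
    by apply: lower => //; rewrite lte_fin; lra.
  apply: filterS2 upper low => n h1 h2; rewrite /= ler_norml; lra.
apply/cvgeryP/cvgryPge => A; have A1 : 0 < Num.max A 1 by rewrite lt_max ltr01 orbT.
apply: filterS (lower _ A1 (ltry _)) => n; apply: le_trans.
by rewrite le_max lexx.
Qed.
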